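(* Let $B$ be a standard Brownian motion. Define $\beta(1)=1$, $\beta(n)=n^2\beta(n-1)^6$ for $n=2,3,\dots$, and set $\alpha(n)=\beta(n)^{1/2}$, $\gamma(n)=\beta(n)^{-1}$. Then the bounded, continuous process $$Y=\sum_{n=2}^\infty \alpha(n)\left(B-B^{\gamma(n)}\right),$$ adapted to the natural filtration of $B$ (made right-continuous and complete), where for $c>0$ the process $B^c$ is obtained from $B$ by the construction $X\mapsto X^c$ described in the context, is not a semimartingale (with respect to that filtration).
   Context: Construction of $X^c$ from a càdlàg path $X$ and $c>0$. Let $T_u^{2c}X=\inf\{s\ge0:\sup_{t\in[0,s]}X_t-X_0>c\}$ and $T_d^{2c}X=\inf\{s\ge0:X_0-\inf_{t\in[0,s]}X_t>c\}$ ($\inf\emptyset=+\infty$). If $T_d^{2c}X\ge T_u^{2c}X$, put $T_{u,0}^{2c}=T_u^{2c}X$ and for $k=0,1,2,\dots$ $$T_{d,k}^{2c}=\inf\{s\ge T_{u,k}^{2c}:\sup_{t\in[T_{u,k}^{2c},s]}X_t-X_s>2c\}\ \text{ if } T_{u,k}^{2c}<+\infty,\quad T_{d,k}^{2c}=+\infty\text{ otherwise},$$ $$T_{u,k+1}^{2c}=\inf\{s\ge T_{d,k}^{2c}:X_s-\inf_{t\in[T_{d,k}^{2c},s]}X_t>2c\}\ \text{ if } T_{d,k}^{2c}<+\infty,\quad T_{u,k+1}^{2c}=+\infty\text{ otherwise},$$ and define $$X_s^c=\begin{cases}X_0 & s\in[0,T_{u,0}^{2c}),\\ \sup_{t\in[T_{u,k}^{2c},s]}X_t-c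 & s\in[T_{u,k}^{2c},T_{d,k}^{2c}),\ k\ge0,\\ \inf_{t\in[T_{d,k}^{2c},s]}X_t+c & s\in[T_{d,k}^{2c},T_{u,k+1}^{2c}),\ k\ge0.\end{cases}$$ If $T_d^{2c}X<T_u^{2c}X$, apply this construction to $-X$ and set $X^c=-\big((-X)^c\big)$. For a stochastic process the construction is applied pathwise. One has $|X-X^c|\le c$, so the series defining $Y$ converges uniformly. *)

(* Defs.v *)
From mathcomp Require Import all_boot all_order all_algebra.
From mathcomp Require Import all_classical all_reals all_analysis.

Set Implicit Arguments.
Unset Strict Implicit.
Unset Printing Implicit Defensive.

Import Order.TTheory GRing.Theory Num.Theory.
Import numFieldNormedType.Exports.

Local Open Scope classical_set_scope.
Local Open Scope ring_scope.

(* Paths are functions R -> R and processes functions R -> T -> R; only their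
   values at times t >= 0 are meaningful, and every definition below looks at
   times t >= 0 only. *)

Section Skeleton.
Context {R : realType}.
Implicit Types (X : R -> R) (c a s : R).

Definition first_up_time X c : \bar R :=
  ereal_inf [set s%:E | s in
    [set s | 0 <= s /\ c < sup (X @` `[0, s]) - X 0]].

Definition first_down_time X c : \bar R :=
  ereal_inf [set s%:E | s in
    [set s | 0 <= s /\ c < X 0 - inf (X @` `[0, s])]].

Definition next_down_time X c a : \bar R :=
  ereal_inf [set s%:E | s in
    [set s | a <= s /\ 2 * c < sup (X @` `[a, s]) - X s]].

Definition next_up_time X c a : \bar R :=
  ereal_inf [set s%:E | s in
    [set s | a <= s /\ 2 * c < X s - inf (X @` `[a, s])]].

(* The times fed to [after] are never -oo. *)
Definition after (f : R -> \bar R) (S : \bar R) : \bar R :=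
  if S is a%:E then f a else +oo%E.

Fixpoint up_time X c (k : nat) : \bar R :=
  if k is j.+1
  then after (next_up_time X c) (after (next_down_time X c) (up_time X c j))
  else first_up_time X c.

Definition down_time X c (k : nat) : \bar R :=
  after (next_down_time X c) (up_time X c k).

(* Graph of the piecewise definition of X^c when X goes up first: y = X^c_s. *)
Definition skeleton_up_graph X c s (y : R) : Prop :=
  [\/ (s%:E < up_time X c 0)%E /\ y = X 0,
      exists k, [/\ (up_time X c k <= s%:E)%E, (s%:E < down_time X c k)%E &
        y = sup (X @` `[fine (up_time X c k), s]) - c] |
      exists k, [/\ (down_time X c k <= s%:E)%E, (s%:E < up_time X c k.+1)%E &
        y = inf (X @` `[fine (down_time X c k), s]) + c]].

(* The pieces are disjoint and, for a cadlag X and c > 0, cover [0, +oo[; the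
   default value X 0 is then irrelevant. *)
Definition skeleton_up X c s : R := xget (X 0) [set y | skeleton_up_graph X c s y].

(* X^c *)
Definition skeleton X c s : R :=
  if (first_up_time X c <= first_down_time X c)%E then skeleton_up X c s
  else - skeleton_up (fun u => - X u) c s.

End Skeleton.

Section Processes.
Context {R : realType} {d : measure_display} {T : measurableType d}.
Variable P : probability T R.
Implicit Types (X M A B : R -> T -> R) (F : R -> set (set T)).

Definition continuous_process X :=
  forall w, {within `[0, +oo[, continuous (fun t => X t w)}.

Definition bounded_process X :=
  exists C : R, forall (t : R) w, 0 <= t -> `|X t w| <= C.

Definition cadlag_process X := forall w (t : R), 0 <= t ->
  (X u w @[u --> t^'+] --> X t w) /\
  (0 < t -> cvg (X u w @[u --> t^'-])).

Definition independent_increments B :=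
  forall (n : nat) (t : nat -> R) (U : nat -> set R),
    0 <= t 0 -> nondecreasing_seq t -> (forall i, measurable (U i)) ->
    P (\bigcap_(i < n) [set w | U i (B (t i.+1) w - B (t i) w)]) =
    (\prod_(i < n) P [set w | U i (B (t i.+1) w - B (t i) w)%R])%E.

(* The second parameter of normal_prob is the standard deviation. *)
Definition standard_brownian_motion B :=
  [/\ forall t : R, 0 <= t -> measurable_fun setT (B t),
      {ae P, forall w, B 0 w = 0},
      independent_increments B,
      forall (s t : R) (U : set R), 0 <= s -> s < t -> measurable U ->
        P [set w | U (B t w - B s w)] = normal_prob 0 (Num.sqrt (t - s)) U &
      continuous_process B].

(* Generators of sigma(B_u, 0 <= u <= t). *)
Definition past_events B (t : R) : set (set T) :=
  [set E | exists u (U : set R),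
     [/\ 0 <= u, u <= t, measurable U & E = B u @^-1` U]].

(* The null sets adjoined are those of the sigma-algebra of T. When P is
   complete they are all the P-negligible sets; when it is not, they are the
   ones on which P is defined, so that every event of the filtration has a
   probability. *)
Definition null_events : set (set T) := [set N | measurable N /\ P N = 0%E].

Definition usual_filtration B (t : R) : set (set T) :=
  \bigcap_(s in [set s | t < s]) <<s past_events B s `|` null_events >>.

Definition adapted F X :=
  forall (t : R) (U : set R), 0 <= t -> measurable U -> F t (X t @^-1` U).

Definition stopping_time F (tau : T -> \bar R) :=
  (forall w, (0 <= tau w)%E) /\
  (forall t : R, 0 <= t -> F t [set w | (tau w <= t%:E)%E]).

Definition stopped X (tau : T -> \bar R) (t : R) (w : T) : R :=
  X (fine (Order.min (tau w) t%:E)) w.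

Definition martingale F M :=
  [/\ adapted F M,
      forall t : R, 0 <= t -> P.-integrable setT (EFin \o M t) &
      forall (s t : R) E, 0 <= s -> s <= t -> F s E ->
        (\int[P]_(w in E) (M t w)%:E = \int[P]_(w in E) (M s w)%:E)%E].

Definition local_martingale F M :=
  [/\ adapted F M,
      cadlag_process M &
      exists tau : nat -> T -> \bar R,
        [/\ forall n, stopping_time F (tau n),
            {ae P, forall w, nondecreasing_seq (fun n => tau n w) /\
                             tau n w @[n --> \oo] --> +oo%E} &
            forall n, martingale F (fun t w => stopped M (tau n) t w - M 0 w)]].

Definition finite_variation_process F A :=
  [/\ adapted F A,
      cadlag_process A &
      forall w (t : R), 0 <= t -> bounded_variation 0 t (fun u => A u w)].

Definition semimartingale F X :=
  [/\ adapted F X,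
      cadlag_process X &
      exists M A,
        [/\ local_martingale F M,
            finite_variation_process F A,
            forall w, M 0 w = 0 /\ A 0 w = 0 &
            {ae P, forall w, forall t : R, 0 <= t -> X t w = X 0 w + M t w + A t w}]].

End Processes.

Section Series.
Context {R : realType}.

(* The value at index 0 is never used. *)
Fixpoint beta_seq (n : nat) : R :=
  match n with
  | 0%N | 1%N => 1
  | (m.+1 as p).+1 => n%:R ^+ 2 * beta_seq p ^+ 6
  end.

Definition alpha_seq (n : nat) : R := Num.sqrt (beta_seq n).

Definition gamma_seq (n : nat) : R := (beta_seq n)^-1.

Definition partial_Y (T : Type) (B : R -> T -> R) (n : nat) (t : R) (w : T) : R :=
  \sum_(2 <= k < n)
    alpha_seq k * (B t w - skeleton (fun u => B u w) (gamma_seq k) t).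

Definition Y_process (T : Type) (B : R -> T -> R) (t : R) (w : T) : R :=
  limn (fun n => partial_Y B n t w).

End Series.

(* Main.v *)
Require Import Defs.
From mathcomp Require Import all_boot all_order all_algebra.
From mathcomp Require Import all_classical all_reals all_analysis.
From mathcomp Require Import measurable_realfun simple_functions.
From mathcomp Require Import ring lra.
Import Order.TTheory GRing.Theory Num.Theory.
Import numFieldNormedType.Exports.
Set Implicit Arguments.
Unset Strict Implicit.
Unset Printing Implicit Defensive.
Local Open Scope classical_set_scope.
Local Open Scope ring_scope.

(** Why Y is not a semimartingale.

    For a continuous path X the process X^c is the play (backlash) operator
    applied to X: it rests while X stays within c of it and is pushed along
    when X tries to leave that band.  Hence Z = X - X^c is bounded by c, and
    X^c only moves up when Z = c and only moves down when Z = - c.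
    [skeleton_step] extracts this from the construction by stopping times, and
    [play_skeleton_cvg] turns it into convergence of an explicit recursion along
    finer and finer grids.  Measurability, continuity and |Y| <= 1 follow, since
    alpha(n) gamma(n) = 1 / alpha(n) is summable.

    Two estimates on [0, 1] drive the proof.  The recursion has an energy
    identity which bounds the expected variation of B^c by a constant over c
    ([skel_variation]).  Conversely, weights - Z / c against the increments of
    Z itself capture its quadratic variation, because
    - 2 Z dZ = (dZ)^2 - d(Z^2), (dZ)^2 >= (dB)^2 - 2 dB dB^c and Z^2 <= c^2;
    so along the grid with 1 / c^3 steps the expected gain is at least a
    constant over c ([energy_lower]), even when the weights are switched off
    on an event of probability at most one half.

    On the other hand, if Y = Y_0 + M + A with M a local martingale and A of
    finite variation, adapted weights bounded by 1 cannot gain more than a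
    constant, uniformly in the grid, provided that they are switched off once
    the localising time has passed or A has varied by more than K
    ([semimartingale_bound]).  Only the last interval before the switch needs
    care, and there the increment of A is controlled by the boundedness of Y
    and by M.

    In the n-th test the weights are built from c = gamma(n).  The n-th term of
    the series gains at least alpha(n) beta(n) / 128; the earlier terms change
    the total by at most the sum of 33 alpha(k) beta(k), by the variation
    bound, since B itself contributes nothing in mean; the later terms are so
    small that beta(n)^3 steps change the total by at most 4.  Since
    alpha(n) beta(n) = n^3 beta(n - 1)^9 outgrows all the rest, the gain is
    unbounded ([growth_contradiction]). *)

(** * Continuity on a half-line *)

Section ContFrom.
Context {R : realType}.
Implicit Types (X g : R -> R) (a b c s t : R).

(** An epsilon-delta form of {within `[a, +oo[, continuous g}: the path
    arguments below are by explicit moduli. *)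
Definition cont_from a g := forall t e, a <= t -> 0 < e ->
  exists2 d, 0 < d & forall s, a <= s -> `|s - t| < d -> `|g s - g t| < e.

Lemma continuous_cont_from X a :
  {within `[a, +oo[, continuous X} -> cont_from a X.
Proof.
move=> /continuous_within_itvcyP[Xr Xa] t e at_ e0.
have [<-{at_}|at_'] := eqVneq a t.
  have /cvgrPdist_lt/(_ e e0) := Xa.
  rewrite /at_right near_withinE => /nbhs_ballP[d /= d0 H].
  exists d => // s ; rewrite le_eqVlt => /predU1P[<- _|as_ sd].
    by rewrite subrr normr0.
  by rewrite distrC; apply: H => //; rewrite /ball/= distrC.
have a_t : a < t by rewrite lt_neqAle at_' at_.
have /cvgrPdist_lt/(_ e e0) : {for t, continuous X} by apply: Xr; rewrite in_itv/= a_t.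
move=> /nbhs_ballP[d /= d0 H].
exists d => // s as_ sd.
by rewrite distrC; apply: H => //; rewrite /ball/= distrC.
Qed.

Lemma cont_from_continuous X a :
  cont_from a X -> {within `[a, +oo[, continuous X}.
Proof.
move=> H; apply/continuous_within_itvcyP; split.
  move=> t; rewrite in_itv/= andbT => a_t.
  apply/cvgrPdist_lt => e e0; have [d d0 Hd] := H t e (ltW a_t) e0.
  apply/nbhs_ballP; exists (Num.min d (t - a)) => /=.
    by rewrite lt_min d0 subr_gt0.
  move=> s; rewrite /ball/= lt_min => /andP[ts sta].
  rewrite distrC; apply: Hd; last by rewrite distrC.
  by move: sta; rewrite ltr_norml => /andP[_]; lra.
apply/cvgrPdist_lt => e e0; have [d d0 Hd] := H a e (lexx _) e0.
rewrite /at_right near_withinE; apply/nbhs_ballP; exists d => //= s.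
by rewrite /ball/= => sd as_; rewrite distrC; apply: Hd; rewrite ?(ltW as_)// distrC.
Qed.

Lemma cont_fromS X a b : a <= b -> cont_from a X -> cont_from b X.
Proof.
move=> ab H t e bt e0; have [d d0 Hd] := H t e (le_trans ab bt) e0.
by exists d => // s bs; apply: Hd; exact: le_trans bs.
Qed.

Lemma cont_fromN X a : cont_from a X -> cont_from a (fun u => - X u).
Proof.
move=> H t e at_ e0; have [d d0 Hd] := H t e at_ e0.
by exists d => // s as_ sd; rewrite -opprD normrN; exact: Hd.
Qed.

Lemma cont_fromD X g a : cont_from a X -> cont_from a g ->
  cont_from a (fun u => X u + g u).
Proof.
move=> HX Hg t e at_ e0; have e20 : 0 < e / 2 by rewrite divr_gt0.
have [d d0 Hd] := HX t _ at_ e20; have [d' d'0 Hd'] := Hg t _ at_ e20.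
exists (Num.min d d') => [|s as_]; first by rewrite lt_min d0.
rewrite lt_min => /andP[/(Hd _ as_) + /(Hd' _ as_)].
rewrite !ltr_norml => /andP[? ?] /andP[? ?]; lra.
Qed.

Lemma cont_from_cst k a : cont_from a (fun=> k).
Proof. by move=> t e _ e0; exists 1 => // s _ _; rewrite subrr normr0. Qed.

Lemma cont_from_segment X a b s : a <= b -> cont_from a X ->
  {within `[b, s], continuous X}.
Proof.
move=> ab H; have := cont_from_continuous (cont_fromS ab H).
apply: continuous_subspaceW => x /=; rewrite !in_itv/= andbT.
by case/andP.
Qed.

(** Heine-Cantor: two sequences of points at vanishing distance whose images
    stay apart would both cluster at a point of discontinuity. *)
Lemma cont_from_unif X a b e : cont_from a X -> 0 < e ->
  exists2 d, 0 < d & forall s t, a <= s -> s <= b -> a <= t -> t <= b ->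
    `|s - t| < d -> `|X s - X t| < e.
Proof.
move=> H e0.
have e20 : 0 < e / 2 by rewrite divr_gt0.
apply: contrapT => nH.
have [u Hu] : {u : nat -> R * R & forall n, [/\ a <= (u n).1, (u n).1 <= b,
   a <= (u n).2, (u n).2 <= b & `|(u n).1 - (u n).2| < n.+1%:R^-1 /\ e <= `|X (u n).1 - X (u n).2|]}.
  apply: (@choice _ _ (fun n (p : R * R) => [/\ a <= p.1, p.1 <= b,
   a <= p.2, p.2 <= b & `|p.1 - p.2| < n.+1%:R^-1 /\ e <= `|X p.1 - X p.2|])) => n.
  apply: contrapT => nE; apply: nH; exists n.+1%:R^-1 => // s t as_ sb at_ tb st.
  rewrite ltNge; apply/negP => ge; apply: nE; exists (s, t); split => //.
have cpt : compact `[a, b]%classic by exact: segment_compact.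
have F : ProperFilter ((fun n => (u n).1) @ \oo) by apply: fmap_proper_filter.
have /cpt : ((fun n => (u n).1) @ \oo) `[a, b]%classic.
  by exists 0%N => // n _ /=; rewrite in_itv/=; have [-> ->] := Hu n.
move=> [t [/= + clt]]; rewrite in_itv/= => /andP[at_ tb].
have [d d0 Hd] := H t _ at_ e20.
have /clt : ((fun n => (u n).1) @ \oo) [set x | exists2 n, x = (u n).1 & n.+1%:R^-1 < d / 2].
  have := near_infty_natSinv_lt (PosNum (divr_gt0 d0 (@ltr0Sn R 1))).
  by apply: filterS => n /= nd; exists n.
move=> /(_ (ball t (d / 2))) [].
  by apply: nbhsx_ballx; rewrite divr_gt0.
move=> _ [[n -> nd]]; rewrite /ball/= => tu.
have [u1 u2 u3 u4 [u5 u6]] := Hu n.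
have A1 : `|(u n).1 - t| < d by rewrite distrC; apply: lt_le_trans tu _; lra.
have A2 : `|(u n).2 - t| < d.
  move: tu (lt_trans u5 nd); rewrite !ltr_norml => /andP[? ?] /andP[? ?]; apply/andP; split; lra.
have := Hd _ u1 A1; have := Hd _ u3 A2; move: u6.
rewrite !ltr_norml => + /andP[? ?] /andP[? ?].
by apply/negP; rewrite -ltNge ltr_norml; apply/andP; split; lra.
Qed.

End ContFrom.

(** * Running suprema and hitting times *)

Section RunningSup.
Context {R : realType}.
Implicit Types (X g : R -> R) (a b c s t : R).

Definition run_sup X a s : R := sup (X @` `[a, s]).

(** Since the supremum is attained, it is handled below through a
    maximiser. *)
Lemma run_sup_max X a s : cont_from a X -> a <= s ->
  exists r, [/\ a <= r, r <= s, run_sup X a s = X r &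
    forall u, a <= u -> u <= s -> X u <= X r].
Proof.
move=> H as_.
have [r + hr] := EVT_max as_ (cont_from_segment (lexx a) H).
rewrite in_itv/= => /andP[ar rs]; exists r.
have ub : forall u, a <= u -> u <= s -> X u <= X r.
  by move=> u au us; apply: hr; rewrite in_itv/= au us.
split => //; apply/eqP; rewrite eq_le; apply/andP; split.
  apply: ge_sup; first by exists (X r), r => //=; rewrite in_itv/= ar rs.
  by move=> _ [u /= + <-]; rewrite in_itv/= => /andP[au us]; exact: ub.
apply: sup_upper_bound; last by exists r => //=; rewrite in_itv/= ar rs.
split; first by exists (X r), r => //=; rewrite in_itv/= ar rs.
by exists (X r) => _ [u /= + <-]; rewrite in_itv/= => /andP[au us]; exact: ub.
Qed.

Lemma le_run_sup X a s r : cont_from a X -> a <= r -> r <= s ->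
  X r <= run_sup X a s.
Proof.
by move=> H ar rs; have [q [_ _ -> ub]] := run_sup_max H (le_trans ar rs); exact: ub.
Qed.

Lemma run_sup_le X a s y : cont_from a X -> a <= s ->
  (forall r, a <= r -> r <= s -> X r <= y) -> run_sup X a s <= y.
Proof. by move=> H as_ ub; have [q [aq qs -> _]] := run_sup_max H as_; exact: ub. Qed.

Lemma run_sup_homo X a s t : cont_from a X -> a <= s -> s <= t ->
  run_sup X a s <= run_sup X a t.
Proof.
move=> H as_ st; apply: run_sup_le => // r ar rs.
by apply: le_run_sup => //; exact: le_trans st.
Qed.

Lemma run_sup_id X a : cont_from a X -> run_sup X a a = X a.
Proof.
move=> H; apply/eqP; rewrite eq_le le_run_sup// andbT.
by apply: run_sup_le => // r ar ra; rewrite (_ : r = a)//; apply/eqP; rewrite eq_le ar ra.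
Qed.

(** Between two times near t the running supremum can only grow by values
    that X takes near t. *)
Lemma cont_from_run_sup X a : cont_from a X -> cont_from a (run_sup X a).
Proof.
move=> H t e at_ e0; have e30 : 0 < e / 3 by rewrite divr_gt0.
have [d d0 Hd] := H t _ at_ e30; exists d => // s as_ sd.
have K : forall p q, a <= p -> p <= q -> `|p - t| < d -> `|q - t| < d ->
    run_sup X a q <= run_sup X a p + 2 * (e / 3).
  move=> p q ap pq pd qd; apply: run_sup_le => [//||r ar rq]; first exact: le_trans pq.
  have [rp|pr] := leP r p.
    by have := le_run_sup H ar rp; lra.
  have rd : `|r - t| < d.
    by move: pd qd; rewrite !ltr_norml => /andP[? ?] /andP[? ?]; apply/andP; split; lra.
  have := le_run_sup H ap (lexx p); have := Hd _ ar rd; have := Hd _ ap pd.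
  by rewrite !ltr_norml => /andP[? ?] /andP[? ?]; lra.
have td : `|t - t| < d by rewrite subrr normr0.
rewrite ltr_norml; have [st|ts] := leP s t.
  by have := run_sup_homo H as_ st; have := K _ _ as_ st sd td; lra.
by have := run_sup_homo H at_ (ltW ts); have := K _ _ at_ (ltW ts) td sd; lra.
Qed.

(** All the stopping times of the construction are of this form, for a
    continuous g. *)
Definition hit g (th : R) a : \bar R :=
  ereal_inf [set s%:E | s in [set s | a <= s /\ th < g s]].

Lemma hit_ge g th a : (a%:E <= hit g th a)%E.
Proof. by apply: le_ereal_inf_tmp => _ [s [as_ _] <-]; rewrite lee_fin. Qed.

Lemma before_hit g th a r : a <= r -> (r%:E < hit g th a)%E -> g r <= th.
Proof.
move=> ar; apply: contraTT; rewrite -leNgt -ltNge => thr.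
by apply: ereal_inf_lbound; exists r.
Qed.

(** Right continuity gives g b >= th, because times with g > th accumulate at
    b from the right; left continuity gives g b <= th. *)
Lemma at_hit g th a b : cont_from a g -> g a < th -> hit g th a = b%:E ->
  g b = th /\ a < b.
Proof.
move=> H ga hb.
have ab : a <= b by rewrite -lee_fin -hb hit_ge.
have gb : g b <= th.
  rewrite leNgt; apply/negP => thb.
  have ab' : a < b.
    by rewrite lt_neqAle ab andbT; apply/eqP => E; move: thb; rewrite -E; lra.
  have [d d0 Hd] := H b (g b - th) ab ltac:(lra).
  pose r := Num.max a (b - d / 2).
  have ar : a <= r by rewrite le_max lexx.
  have rb : r < b by rewrite /r gt_max ab'/=; lra.
  have rd : b - d / 2 <= r by rewrite le_max lexx orbT.
  have : `|r - b| < d by rewrite ltr_norml; apply/andP; split; lra.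
  move=> /(Hd _ ar); rewrite ltr_norml => /andP[? _].
  have : g r <= th by apply: (@before_hit _ _ a) => //; rewrite hb lte_fin.
  by lra.
have gb' : th <= g b.
  rewrite leNgt; apply/negP => thb.
  have [d d0 Hd] := H b (th - g b) ab ltac:(lra).
  have : (hit g th a < (b + d)%:E)%E by rewrite hb lte_fin; lra.
  move=> /ereal_inf_lt[_ [s [as_ gs] <-]]; rewrite lte_fin => sd.
  have bs : b <= s by rewrite -lee_fin -hb; apply: ereal_inf_lbound; exists s.
  have : `|s - b| < d by rewrite ltr_norml; apply/andP; split; lra.
  by move=> /(Hd _ as_); rewrite ltr_norml => /andP[_]; lra.
have E : g b = th by apply/eqP; rewrite eq_le gb gb'.
split => //; rewrite lt_neqAle ab andbT; apply/eqP => E'.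
by move: ga; rewrite E' E ltxx.
Qed.

Lemma hit_gt g th a : cont_from a g -> g a < th -> (a%:E < hit g th a)%E.
Proof.
move=> H ga; have := hit_ge g th a; rewrite le_eqVlt => /predU1P[E|//].
by have [_] := at_hit H ga (esym E); rewrite ltxx.
Qed.

End RunningSup.

Section Switches.
Context {R : realType}.
Implicit Types (X g : R -> R) (a b c s t : R).

Lemma image_oppr X (A : set R) : (fun u => - X u) @` A = -%R @` (X @` A).
Proof. by rewrite image_comp. Qed.

Lemma inf_run_sup X a s : inf (X @` `[a, s]) = - run_sup (fun u => - X u) a s.
Proof. by rewrite /run_sup image_oppr. Qed.

Lemma next_down_hit X c a :
  next_down_time X c a = hit (fun s => run_sup X a s - X s) (2 * c) a.
Proof. by []. Qed.

Lemma next_up_hit X c a :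
  next_up_time X c a = hit (fun s => run_sup (fun u => - X u) a s - - X s) (2 * c) a.
Proof.
rewrite /next_up_time /hit; congr (ereal_inf (image _ _)).
by apply/funext => s /=; rewrite inf_run_sup opprK opprK addrC.
Qed.

(** Replacing the supremum of X by X itself makes the hitting time reveal
    the value of X, not only that of its running supremum. *)
Lemma first_up_hit X c : cont_from 0 X ->
  first_up_time X c = hit (fun s => X s - X 0) c 0.
Proof.
move=> H; apply/eqP; rewrite eq_le; apply/andP; split.
  apply: ereal_inf_le_tmp => _ [s [s0 cs] <-]; exists s => //; split => //.
  by apply: lt_le_trans cs _; rewrite lerD2r; exact: le_run_sup.
apply: le_ereal_inf_tmp => _ [s [s0 cs] <-].
have [r [r0 rs Er _]] := run_sup_max H s0.
apply: (@le_trans _ _ r%:E); last by rewrite lee_fin.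
by apply: ereal_inf_lbound; exists r => //; split => //; rewrite -Er.
Qed.

Lemma first_down_oppr X c : first_down_time X c = first_up_time (fun u => - X u) c.
Proof.
rewrite /first_down_time /first_up_time; congr (ereal_inf (image _ _)).
by apply/funext => s /=; rewrite inf_run_sup !opprK addrC.
Qed.

(** During an up phase X never drops by more than 2c below its past
    maximum: this keeps X^c at maximum - c until the phase ends. *)
Lemma phase_before X c a s r : cont_from a X -> 0 < c ->
  (s%:E < next_down_time X c a)%E -> a <= r -> r <= s -> forall u, a <= u -> u <= r ->
  X u - X r <= 2 * c.
Proof.
move=> H c0 se ar rs u au ur.
have : (r%:E < next_down_time X c a)%E by apply: le_lt_trans se; rewrite lee_fin.
rewrite next_down_hit => /(before_hit ar) /=; apply: le_trans.
by rewrite lerD2r; exact: le_run_sup.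
Qed.

Lemma next_down_spec X c a : cont_from a X -> 0 < c ->
  (a%:E < next_down_time X c a)%E /\
  (forall b, next_down_time X c a = b%:E -> run_sup X a b - X b = 2 * c /\ a < b).
Proof.
move=> H c0; rewrite next_down_hit.
have Hg : cont_from a (fun s => run_sup X a s - X s).
  by apply: cont_fromD; [exact: cont_from_run_sup|exact: cont_fromN].
have ga : run_sup X a a - X a < 2 * c by rewrite run_sup_id// subrr mulr_gt0.
split; first exact: hit_gt.
by move=> b hb; exact: at_hit Hg ga hb.
Qed.

End Switches.

(** * The skeleton as a play operator *)

Section PlayStep.
Context {R : realType}.
Implicit Types (X Z : R -> R) (a b c s t u v : R).

(** What the play operator with threshold c does from value u at time s to
    value v at time t, when X oscillates by less than 2c on [s, t]: v is u
    clamped to [max X - c, min X + c].  The form chosen here avoids suprema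
    and is invariant under the change of sign. *)
Definition play_step X c s t u v :=
  [/\ forall r, s <= r -> r <= t -> X r - c <= v /\ v <= X r + c,
      u < v -> exists r, [/\ s <= r, r <= t & v = X r - c] &
      v < u -> exists r, [/\ s <= r, r <= t & v = X r + c]].

Lemma play_stepN X c s t u v :
  play_step X c s t u v -> play_step (fun r => - X r) c s t (- u) (- v).
Proof.
move=> [h1 h2 h3]; split.
- by move=> r sr rt; have := h1 r sr rt; lra.
- rewrite ltrN2 => /h3[r [sr rt ->]]; exists r; split => //; lra.
- rewrite ltrN2 => /h2[r [sr rt ->]]; exists r; split => //; lra.
Qed.

Definition small_osc X c s t := forall r r', s <= r -> r <= t -> s <= r' -> r' <= t ->
  X r - X r' < 2 * c.

Lemma small_oscN X c s t : small_osc X c s t -> small_osc (fun r => - X r) c s t.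
Proof. by move=> H r r' sr rt sr' r't; have := H r' r sr' r't sr rt; lra. Qed.

Lemma play_step_same_phase Z c a s t : cont_from a Z -> 0 < c ->
  a <= s -> s <= t -> (t%:E < next_down_time Z c a)%E -> small_osc Z c s t ->
  play_step Z c s t (run_sup Z a s - c) (run_sup Z a t - c).
Proof.
move=> H c0 as_ st te osc.
have [q [aq qt -> qmax]] := run_sup_max H (le_trans as_ st); split.
- move=> r sr rt; split; first by rewrite lerD2r; apply: qmax => //; exact: le_trans sr.
  have [qr|rq] := leP q r.
    have ar := le_trans as_ sr.
    by have := phase_before H c0 te ar rt aq qr; lra.
  by have := osc q r (le_trans sr (ltW rq)) qt sr rt; lra.
- rewrite ltrD2r => sq; exists q; split => //.
  by rewrite leNgt; apply/negP => /ltW qs; have := le_run_sup H aq qs; lra.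
- by move=> qs; have := run_sup_homo H as_ st; have := qmax s as_ st;
     have := run_sup_le H as_ (fun r ar rs => qmax r ar (le_trans rs st)); lra.
Qed.

(** At the end b of an up phase X is exactly 2c below the maximum of that
    phase, which was reached before s as X oscillates less than 2c on [s, t].
    Thus max - c = X b + c, and the down phase takes over continuously. *)
Lemma play_step_switch Z c a b s t : cont_from a Z -> 0 < c ->
  a <= s -> s < b -> b <= t -> next_down_time Z c a = b%:E -> small_osc Z c s t ->
  play_step Z c s t (run_sup Z a s - c) (- (run_sup (fun r => - Z r) b t - c)).
Proof.
move=> H c0 as_ sb bt hb osc.
have ab : a <= b by apply: le_trans as_ (ltW sb).
have Hb : cont_from b (fun r => - Z r) by apply: cont_fromN; exact: cont_fromS H.
have [_ /(_ b hb)[+ _]] := next_down_spec H c0.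
have [q [aq qb Eq qmax]] := run_sup_max H ab; rewrite Eq => EZ.
have qs : q < s.
  rewrite ltNge; apply/negP => sq.
  by have := osc q b sq (le_trans qb bt) (ltW sb) bt; lra.
have -> : run_sup Z a s = Z q.
  apply/eqP; rewrite eq_le le_run_sup ?(ltW qs)// andbT.
  by apply: run_sup_le => // r ar rs; apply: qmax => //; exact: (le_trans rs (ltW sb)).
have [p [bp pt -> pmax]] := run_sup_max Hb bt.
have pb := pmax b (lexx b) bt.
split.
- move=> r sr rt; split.
    have := osc r p sr rt (le_trans (ltW sb) bp) pt; lra.
  have [br|rb] := leP b r; first by have := pmax r br rt; lra.
  have hr : (r%:E < next_down_time Z c a)%E by rewrite hb lte_fin.
  have := phase_before H c0 hr (le_trans as_ sr) (lexx r) aq (le_trans (ltW qs) sr).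
  lra.
- lra.
- by move=> _; exists p; split => //; [exact: le_trans (ltW sb) bp|lra].
Qed.

End PlayStep.

Section Switch.
Context {R : realType}.
Implicit Types (X Z : R -> R) (a b c s t u v : R).

Lemma next_up_oppr X c a : next_up_time X c a = next_down_time (fun u => - X u) c a.
Proof. by rewrite next_up_hit. Qed.

(** Odd phases are up phases, even ones are down phases, which are up phases
    of the opposite path. *)
Definition flip j X : R -> R := if odd j then X else fun u => - X u.
Definition sgn_phase j (x : R) := if odd j then x else - x.

(** The times 0, T_u,0, T_d,0, T_u,1, T_d,1 and so on in a single sequence,
    so that an up phase and a down phase are treated by one argument. *)
Fixpoint switch X c (j : nat) : \bar R :=
  match j with
  | 0%N => 0%:E
  | (k.+1 as i).+1 => after (next_down_time (flip i X) c) (switch X c i)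
  | 1%N => first_up_time X c
  end.

Definition phase_val X c j s : R :=
  if j is 0%N then X 0
  else sgn_phase j (run_sup (flip j X) (fine (switch X c j)) s - c).

Lemma switchSS X c j : switch X c j.+2 = after (next_down_time (flip j.+1 X) c) (switch X c j.+1).
Proof. by []. Qed.

Lemma up_time_switch X c k : up_time X c k = switch X c k.*2.+1.
Proof.
elim: k => [//|k IH].
rewrite doubleS [LHS]/= IH !switchSS /flip /= odd_double /=.
by congr after; apply/funext => a; rewrite next_up_oppr.
Qed.

Lemma down_time_switch X c k : down_time X c k = switch X c k.*2.+2.
Proof. by rewrite /down_time up_time_switch switchSS /flip /= odd_double. Qed.

Lemma skeleton_up_graphE X c s y : 0 <= s -> skeleton_up_graph X c s y <->
  exists j, [/\ (switch X c j <= s%:E)%E, (s%:E < switch X c j.+1)%E & y = phase_val X c j s].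
Proof.
move=> s0; split.
- case.
  + by move=> [h ->]; exists 0%N; split => //=; rewrite lee_fin.
  + move=> [k]; rewrite up_time_switch down_time_switch => -[h1 h2 ->].
    exists k.*2.+1; split => //.
    by rewrite /phase_val /sgn_phase /flip /= odd_double.
  + move=> [k]; rewrite up_time_switch down_time_switch doubleS => -[h1 h2 ->].
    exists k.*2.+2; split => //.
    by rewrite /phase_val /sgn_phase /flip /= odd_double /= inf_run_sup; lra.
- move=> [[|j] [h1 h2 ->]]; first by constructor 1.
  have [oj|ej] := boolP (odd j.+1).
    have Ej : j = j./2.*2 by rewrite -[LHS]odd_double_half; move: oj => /= /negbTE ->.
    constructor 2; exists j./2; rewrite up_time_switch down_time_switch -Ej; split => //.
    by rewrite /phase_val /sgn_phase /flip oj.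
  have Ej : j = j./2.*2.+1 by rewrite -[LHS]odd_double_half; move: ej => /= /negPn ->.
  constructor 3; exists j./2; rewrite up_time_switch down_time_switch doubleS -Ej; split => //.
  by rewrite /phase_val /sgn_phase /flip (negbTE ej) inf_run_sup; lra.
Qed.

Section Facts.
Variables (X : R -> R) (c : R).
Hypotheses (HX : cont_from 0 X) (c0 : 0 < c).

Lemma flip_cont j : cont_from 0 (flip j X).
Proof. by rewrite /flip; case: ifP => _ //; exact: cont_fromN. Qed.

Lemma switch_le j : (switch X c j <= switch X c j.+1)%E.
Proof.
elim: j => [|j IH]; first by rewrite /= first_up_hit// hit_ge.
rewrite switchSS; case E : (switch X c j.+1) => [a| |] //=; rewrite ?leey//.
by rewrite next_down_hit hit_ge.
Qed.

Lemma switch_homo i j : (i <= j)%N -> (switch X c i <= switch X c j)%E.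
Proof.
elim: j => [|j IH]; first by rewrite leqn0 => /eqP ->.
by rewrite leq_eqVlt => /predU1P[->//|/IH]; move/le_trans; apply; exact: switch_le.
Qed.

Lemma switch_ge0 j : (0 <= switch X c j)%E.
Proof. exact: (@switch_homo 0). Qed.

Lemma switch_fin j s : (switch X c j <= s%:E)%E ->
  exists2 a, switch X c j = a%:E & 0 <= a /\ a <= s.
Proof.
have := switch_ge0 j; case: (switch X c j) => [a| |]//; rewrite !lee_fin => a0 as_.
by exists a.
Qed.

(** X oscillates by 2c during each phase, so phases are not short. *)
Lemma switch_step j a b : switch X c j.+1 = a%:E -> switch X c j.+2 = b%:E ->
  [/\ 0 <= a, a < b & exists r, [/\ a <= r, r <= b & `|X r - X b| = 2 * c]].
Proof.
rewrite switchSS => Ea; rewrite Ea /= => Eb.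
have a0 : 0 <= a by rewrite -lee_fin -Ea switch_ge0.
have Ha := cont_fromS a0 (flip_cont j.+1).
have [_ /(_ b Eb)[+ ab]] := next_down_spec Ha c0.
have [r [ar rb -> _]] := run_sup_max Ha (ltW ab) => E.
split => //; exists r; split => //; move: E; rewrite /flip; case: ifP => _ E.
  by rewrite E gtr0_norm// mulr_gt0.
by rewrite -normrN opprB gtr0_norm; [lra|]; have := mulr_gt0 (ltr0Sn R 1) c0; lra.
Qed.

(** By uniform continuity on [0, s] each complete phase lasts at least some
    fixed d > 0, so only finitely many are completed before s. *)
Lemma switch_exceeds s : exists j, (s%:E < switch X c j)%E.
Proof.
have [s0|s0] := ltP s 0; first by exists 0%N; rewrite /= lte_fin.
have [d d0 Hd] := cont_from_unif s HX (mulr_gt0 (ltr0Sn R 1) c0).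
apply: contrapT => nE.
have H j : (switch X c j <= s%:E)%E.
  by rewrite leNgt; apply/negP => h; apply: nE; exists j.
have G j : (((j%:R * d)%:E) <= switch X c j.+1)%E.
  elim: j => [|j IH]; first by rewrite mul0r switch_ge0.
  have [a Ea [a0 as_]] := switch_fin (H j.+1).
  have [b Eb [b0 bs]] := switch_fin (H j.+2).
  have [_ ab [r [ar rb E]]] := switch_step Ea Eb.
  move: IH; rewrite Ea Eb !lee_fin => IH.
  have : d <= `|r - b|.
    rewrite leNgt; apply/negP => /(Hd _ _ (le_trans a0 ar) (le_trans rb bs) b0 bs).
    by rewrite E ltxx.
  rewrite ler0_norm ?subr_le0// -natr1 mulrDl mul1r; lra.
pose j := (Num.truncn (s / d)).+1.
have := le_trans (G j) (H j.+1); rewrite lee_fin leNgt => /negP; apply.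
by rewrite -ltr_pdivrMr// truncnS_gt.
Qed.

Lemma phase_exists s : 0 <= s ->
  exists j, (switch X c j <= s%:E)%E /\ (s%:E < switch X c j.+1)%E.
Proof.
move=> s0; have [n hn] := switch_exceeds s.
elim: n hn => [|n IH]; first by rewrite /= lte_fin ltNge s0.
have [h|h] := leP (switch X c n) s%:E; first by exists n.
by move=> _; exact: IH.
Qed.

Lemma phase_unique i j s : (switch X c i <= s%:E)%E -> (s%:E < switch X c i.+1)%E ->
  (switch X c j <= s%:E)%E -> (s%:E < switch X c j.+1)%E -> i = j.
Proof.
move=> i1 i2 j1 j2; apply/eqP; rewrite eqn_leq.
rewrite !(leqNgt i) !(leqNgt j); apply/andP; split; apply/negP => h.
  by have := le_lt_trans (le_trans (switch_homo h) i1) j2; rewrite ltxx.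
by have := le_lt_trans (le_trans (switch_homo h) j1) i2; rewrite ltxx.
Qed.

Lemma skeleton_upE j s : 0 <= s -> (switch X c j <= s%:E)%E ->
  (s%:E < switch X c j.+1)%E -> skeleton_up X c s = phase_val X c j s.
Proof.
move=> s0 j1 j2; rewrite /skeleton_up; case: xgetP => [y _|/(_ (phase_val X c j s))[]].
  move=> /(skeleton_up_graphE _ _ _ s0)[i [i1 i2 ->]].
  by rewrite (phase_unique i1 i2 j1 j2).
by apply/skeleton_up_graphE => //; exists j.
Qed.

Lemma skeleton_up0 : skeleton_up X c 0 = X 0.
Proof.
rewrite (@skeleton_upE 0)//= first_up_hit//; apply: hit_gt; last by rewrite subrr.
by apply: cont_fromD => //; exact: cont_from_cst.
Qed.

Hypothesis up_first : (first_up_time X c <= first_down_time X c)%E.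

Lemma before_first r : 0 <= r -> (r%:E < first_up_time X c)%E ->
  X 0 - c <= X r /\ X r <= X 0 + c.
Proof.
move=> r0 ru; have rd := lt_le_trans ru up_first; move: ru rd.
rewrite first_down_oppr !first_up_hit//; last exact: cont_fromN.
by move=> /(before_hit r0) + /(before_hit r0); lra.
Qed.

Lemma at_first a : first_up_time X c = a%:E -> 0 < a /\ X a = X 0 + c.
Proof.
rewrite first_up_hit// => h.
have Hc : cont_from 0 (fun s => X s - X 0).
  by apply: cont_fromD => //; exact: cont_from_cst.
by have [|] := at_hit Hc _ h; rewrite ?subrr//; lra.
Qed.

(** As X oscillates by less than 2c on [s, t], no phase is completed inside
    [s, t]: the two times are in the same phase or in consecutive ones. *)
Lemma skeleton_up_step s t : 0 <= s -> s <= t -> small_osc X c s t ->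
  play_step X c s t (skeleton_up X c s) (skeleton_up X c t).
Proof.
move=> s0 st osc; have t0 := le_trans s0 st.
have [i [i1 i2]] := phase_exists s0; have [j [j1 j2]] := phase_exists t0.
rewrite (skeleton_upE s0 i1 i2) (skeleton_upE t0 j1 j2).
have stE : (s%:E <= t%:E)%E by rewrite lee_fin.
have ij : (i <= j)%N.
  rewrite leqNgt; apply/negP => h.
  have := le_lt_trans (le_trans (le_trans (switch_homo h) i1) stE) j2.
  by rewrite ltxx.
have ji : (j <= i.+1)%N.
  rewrite leqNgt; apply/negP => h.
  have [b Eb [b0 bt]] := switch_fin (le_trans (switch_homo h) j1).
  have [a Ea [a0 ab']] : exists2 a, switch X c i.+1 = a%:E & 0 <= a /\ a <= b.
    by apply: switch_fin; rewrite -Eb; exact: switch_le.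
  have [_ ab [r [ar rb]]] := switch_step Ea Eb.
  have sa : s <= a by move: i2; rewrite Ea lte_fin => /ltW.
  have := osc r b (le_trans sa ar) (le_trans rb bt) (le_trans sa ab') bt.
  have := osc b r (le_trans sa ab') bt (le_trans sa ar) (le_trans rb bt).
  by move=> h1 h2 /eqP; rewrite lt_eqF// ltr_norml; apply/andP; split; lra.
have signed k u v : play_step (flip k X) c s t u v ->
    play_step X c s t (sgn_phase k u) (sgn_phase k v).
  rewrite /flip /sgn_phase; case: ifP => // _ /play_stepN.
  by under eq_fun do rewrite opprK.
have osc' k : small_osc (flip k X) c s t.
  by rewrite /flip; case: ifP => // _; exact: small_oscN.
have [E|nij] := eqVneq i j.
  subst j => {ij ji j1}.
  case: i i1 i2 j2 => [|i] i1 i2 j2.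
    rewrite /phase_val; split => [r sr rt||]; rewrite ?ltxx//.
    have h : (r%:E < first_up_time X c)%E by apply: le_lt_trans j2; rewrite lee_fin.
    by have /= := before_first (le_trans s0 sr) h; lra.
  apply: signed; have [a Ea [a0 as_]] := switch_fin i1.
  rewrite switchSS Ea /= in j2; rewrite Ea /=.
  by apply: play_step_same_phase => //; exact: cont_fromS (flip_cont _).
have Ej : j = i.+1 by apply/eqP; rewrite eqn_leq ji ltn_neqAle nij ij.
move: Ej j1 j2 => {j ij ji nij} -> j1 j2.
have [b Eb [b0 bt]] := switch_fin j1.
have sb : s < b by move: i2; rewrite Eb lte_fin.
case: i i1 i2 j1 j2 Eb => [|i] i1 i2 j1 j2 Eb.
  have [_ Xb] := at_first Eb.
  have Hb := cont_fromS b0 HX.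
  rewrite /phase_val /sgn_phase Eb /flip /=.
  have [q [bq qt -> qmax]] := run_sup_max Hb bt.
  have Xbq := qmax b (lexx b) bt; have sq := le_trans (ltW sb) bq.
  split => [r sr rt||].
  - split; last by have := osc q r sq qt sr rt; lra.
    have [br|rb] := leP b r; first by have := qmax r br rt; lra.
    have h : (r%:E < first_up_time X c)%E.
      by move: Eb => /= ->; rewrite lte_fin.
    by have := before_first (le_trans s0 sr) h; lra.
  - by move=> _; exists q.
  - lra.
have [a Ea [a0 as_]] := switch_fin i1.
rewrite /phase_val.
have -> : sgn_phase i.+2 (run_sup (flip i.+2 X) (fine (switch X c i.+2)) t - c) =
    sgn_phase i.+1 (- (run_sup (fun r => - flip i.+1 X r) b t - c)).
  rewrite Eb /sgn_phase /flip /=; case: (odd i) => /=; rewrite ?opprK//.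
  by under [in RHS]eq_fun do rewrite opprK.
apply: signed; rewrite Ea; apply: play_step_switch => //.
  exact: cont_fromS (flip_cont _).
by rewrite -Eb switchSS Ea.
Qed.

End Facts.

Lemma first_down_up X c : first_down_time (fun u => - X u) c = first_up_time X c.
Proof. by rewrite first_down_oppr; under eq_fun do rewrite opprK. Qed.

Theorem skeleton_step X c s t : cont_from 0 X -> 0 < c -> 0 <= s -> s <= t ->
  small_osc X c s t -> play_step X c s t (skeleton X c s) (skeleton X c t).
Proof.
move=> HX c0 s0 st osc; rewrite /skeleton; case: ifPn => h.
  exact: skeleton_up_step.
rewrite -ltNge in h; rewrite {1}(_ : X = fun u => - (- X u)); last first.
  by apply/funext => u; rewrite opprK.
apply: play_stepN; apply: skeleton_up_step => //; first exact: cont_fromN.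
  by rewrite -first_down_oppr first_down_up ltW.
exact: small_oscN.
Qed.

Lemma skeleton0 X c : cont_from 0 X -> 0 < c -> skeleton X c 0 = X 0.
Proof.
move=> HX c0; rewrite /skeleton; case: ifPn => h; first exact: skeleton_up0.
by rewrite skeleton_up0 ?opprK//; exact: cont_fromN.
Qed.

End Switch.

Section SkeletonPath.
Context {R : realType}.
Variables (X : R -> R) (c : R).
Hypotheses (HX : cont_from 0 X) (c0 : 0 < c).

Lemma skeleton_near t : 0 <= t -> X t - c <= skeleton X c t <= X t + c.
Proof.
move=> t0; have [|h _ _] := skeleton_step HX c0 t0 (lexx t).
  move=> r r' tr rt tr' r't; have -> : r = r' by apply/eqP; rewrite eq_le; lra.
  by rewrite subrr mulr_gt0.
by have := h t (lexx t) (lexx t); lra.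
Qed.

Lemma skeleton_dist t : 0 <= t -> `|X t - skeleton X c t| <= c.
Proof. by move=> /skeleton_near; rewrite ler_norml; lra. Qed.

Lemma skeleton_osc s t e : 0 <= s -> s <= t -> e <= c ->
  (forall r, s <= r -> r <= t -> `|X r - X s| < e) ->
  `|skeleton X c t - skeleton X c s| < e.
Proof.
move=> s0 st ec h; have e0 : 0 < e by apply: le_lt_trans (h s (lexx s) st).
have [|h1 h2 h3] := skeleton_step HX c0 s0 st.
  move=> r r' sr rt sr' r't; have := h r sr rt; have := h r' sr' r't.
  by rewrite !ltr_norml; lra.
have ns := skeleton_near s0; rewrite ltr_norml.
case: (ltgtP (skeleton X c s) (skeleton X c t)) => [lt|lt|->]; last by lra.
  by have [r [sr rt E]] := h2 lt; have := h r sr rt; rewrite ltr_norml; lra.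
by have [r [sr rt E]] := h3 lt; have := h r sr rt; rewrite ltr_norml; lra.
Qed.

Lemma cont_from_skeleton : cont_from 0 (skeleton X c).
Proof.
move=> t e t0 e0; pose e' := Num.min e c / 2.
have m0 : 0 < Num.min e c by rewrite lt_min e0.
have e'0 : 0 < e' by rewrite divr_gt0.
have [me mc] : Num.min e c <= e /\ Num.min e c <= c by rewrite !ge_min !lexx orbT.
have [d d0 Hd] := HX t0 e'0; exists d => // s s0; rewrite ltr_norml => /andP[s1 s2].
apply: lt_le_trans me; have [st|ts] := leP s t.
  rewrite distrC; apply: skeleton_osc => // r sr rt.
  have := Hd r (le_trans s0 sr) ltac:(rewrite ltr_norml; apply/andP; split; lra).
  have := Hd s s0 ltac:(rewrite ltr_norml; apply/andP; split; lra).
  by rewrite !ltr_norml /e'; lra.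
apply: skeleton_osc => // [|r sr rt]; first exact: ltW.
have := Hd r (le_trans t0 sr) ltac:(rewrite ltr_norml; apply/andP; split; lra).
by rewrite !ltr_norml /e'; lra.
Qed.

End SkeletonPath.

(** * The play operator along a grid *)

Section Play.
Context {R : realType}.
Implicit Types (x : nat -> R) (X : R -> R) (c h : R).

(** The play operator for an input that is monotone between the points of a
    grid. *)
Fixpoint play c x (i : nat) : R :=
  if i is j.+1 then Num.max (x i - c) (Num.min (x i + c) (play c x j)) else x 0%N.

Lemma clamp_cases (lo hi y : R) : lo <= hi ->
  [\/ y <= lo /\ Num.max lo (Num.min hi y) = lo,
      lo <= y <= hi /\ Num.max lo (Num.min hi y) = y |
      hi <= y /\ Num.max lo (Num.min hi y) = hi].
Proof.
move=> lh; have [hy|yh] := leP hi y.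
  by constructor 3; split => //; rewrite max_r.
have [yl|ly] := leP y lo; first by constructor 1.
by constructor 2; rewrite !ltW.
Qed.

Lemma play_near c x i : 0 <= c -> `|x i - play c x i| <= c.
Proof.
move=> c0; case: i => [|i] /=; first by rewrite subrr normr0.
have [] := @clamp_cases (x i.+1 - c) (x i.+1 + c) (play c x i) ltac:(lra);
  by move=> [? ->]; rewrite ler_norml; lra.
Qed.

(** When the play y moves, z = x - y sits at the end of the band
    in the direction of the motion, so
    (z + dx)^2 = (c + |dy|)^2 >= c^2 + 2 c |dy|.  Summing
    2 c |dy_i| <= z_i^2 - z_(i+1)^2 + 2 z_i dx_i + dx_i^2 telescopes,
    and z_0 = 0. *)
Lemma play_variation c x n : 0 <= c ->
  2 * c * \sum_(i < n) `|play c x i.+1 - play c x i| <=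
  2 * (\sum_(i < n) (x i - play c x i) * (x i.+1 - x i)) + \sum_(i < n) (x i.+1 - x i) ^+ 2.
Proof.
move=> c0; apply: (@le_trans _ _ (2 * c * \sum_(i < n) `|play c x i.+1 - play c x i| +
    (x n - play c x n) ^+ 2)); first by rewrite lerDl sqr_ge0.
elim: n => [|n IH]; first by rewrite !big_ord0 /= subrr; lra.
rewrite !big_ord_recr /=.
suff : 2 * c * `|Num.max (x n.+1 - c) (Num.min (x n.+1 + c) (play c x n)) - play c x n| +
   (x n.+1 - Num.max (x n.+1 - c) (Num.min (x n.+1 + c) (play c x n))) ^+ 2 <=
   (x n - play c x n) ^+ 2 + 2 * ((x n - play c x n) * (x n.+1 - x n)) + (x n.+1 - x n) ^+ 2.
  move: IH; lra.
move: (play c x n) => y; set a := x n.+1; set b := x n.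
have K z : (b - y) ^+ 2 + 2 * ((b - y) * (a - b)) + (a - b) ^+ 2 =
  (z - y) ^+ 2 + 2 * (z - y) * (a - z) + (a - z) ^+ 2 by ring.
have [] := @clamp_cases (a - c) (a + c) y ltac:(lra); move=> [h ->].
- rewrite (K (a - c)) ger0_norm; last lra.
  have := sqr_ge0 (a - c - y); lra.
- rewrite (K y) subrr normr0; lra.
- rewrite (K (a + c)) ler0_norm; last lra.
  have := sqr_ge0 (a + c - y); lra.
Qed.

(** Clamping is nonexpansive in the value and in the bounds, and on each step
    the bounds of the two clamps differ by less than e; so the error never
    exceeds e, whatever the number of steps. *)
Lemma play_skeleton_le X c h e i : cont_from 0 X -> 0 < c -> 0 <= h -> e <= c ->
  (forall j, (j < i)%N -> forall r, j%:R * h <= r -> r <= j.+1%:R * h -> 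
    `|X r - X (j.+1%:R * h)| < e) ->
  0 < e -> `|skeleton X c (i%:R * h) - play c (fun j => X (j%:R * h)) i| <= e.
Proof.
move=> HX c0 h0 ec + e0; elim: i => [|i IH] H.
  by rewrite /= mul0r skeleton0// subrr normr0 ltW.
have {}IH := IH (fun j ji => H j (ltnW ji)).
have {}H := H i (ltnSn i).
rewrite /=; set s := i%:R * h; set t := i.+1%:R * h.
have s0 : 0 <= s by rewrite mulr_ge0.
have st : s <= t by rewrite ler_wpM2r// ler_nat.
have [|h1 h2 h3] := skeleton_step HX c0 s0 st.
  move=> r r' sr rt sr' r't; have := H r sr rt; have := H r' sr' r't.
  by rewrite !ltr_norml; lra.
move: IH; rewrite -/s; move: (play c _ i) => y IH.
have := h1 t st (lexx t); move: IH.
set v := skeleton X c t in h1 h2 h3 *; set u := skeleton X c s in h1 h2 h3 *.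
rewrite !ler_norml => IH hv.
have : (u < v -> v <= X t - c + e) /\ (v < u -> X t + c - e <= v).
  split => [/h2|/h3] [r [sr rt E]]; have := H r sr rt; rewrite -/t ltr_norml; lra.
move=> [k1 k2].
have [] := @clamp_cases (X t - c) (X t + c) y ltac:(lra); move=> [h4 ->];
  case: (ltgtP u v) => [/k1|/k2|] uv; lra.
Qed.

Lemma play_skeleton_cvg X c a e : cont_from 0 X -> 0 < c -> 0 < e ->
  exists2 d, 0 < d & forall h i, 0 <= h -> h < d -> i%:R * h <= a ->
    `|skeleton X c (i%:R * h) - play c (fun j => X (j%:R * h)) i| <= e.
Proof.
move=> HX c0 e0; have m0 : 0 < Num.min e c by rewrite lt_min e0.
have [me mc] : Num.min e c <= e /\ Num.min e c <= c by rewrite !ge_min !lexx orbT.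
have [d d0 Hd] := cont_from_unif a HX m0; exists d => // h i h0 hd ia.
apply: le_trans me; apply: play_skeleton_le => // j ji r jr rj.
have j0 : 0 <= j%:R * h by rewrite mulr_ge0.
have ja : j.+1%:R * h <= a by apply: le_trans ia; rewrite ler_wpM2r// ler_nat.
apply: Hd => //; [exact: le_trans jr|exact: le_trans ja|by rewrite mulr_ge0|].
rewrite ler0_norm ?subr_le0//; apply: le_lt_trans hd.
by move: jr; rewrite -natr1 mulrDl mul1r; lra.
Qed.

End Play.

(** * The coefficients and the series Y *)

Section Coefficients.
Context {R : realType}.
Local Notation beta := (@beta_seq R).
Local Notation alpha := (@alpha_seq R).
Local Notation gamma := (@gamma_seq R).

(** The values of beta are integers: 1 / gamma(n)^3 can be a number of steps. *)
Fixpoint beta_nat (n : nat) : nat :=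
  match n with
  | 0 | 1 => 1
  | (m.+1 as p).+1 => n ^ 2 * beta_nat p ^ 6
  end%N.

Lemma beta_natE n : beta n = (beta_nat n)%:R.
Proof.
elim: n => [//|[//|n] IH].
rewrite -[LHS]/(n.+2%:R ^+ 2 * beta n.+1 ^+ 6).
by rewrite -[beta_nat n.+2]/(n.+2 ^ 2 * beta_nat n.+1 ^ 6)%N natrM !natrX IH.
Qed.

Lemma beta_seqSS n : beta n.+2 = n.+2%:R ^+ 2 * beta n.+1 ^+ 6.
Proof. by []. Qed.

Lemma beta_nat_gt0 n : (0 < beta_nat n)%N.
Proof.
elim: n => [//|[//|n] IH].
by rewrite -[beta_nat n.+2]/(n.+2 ^ 2 * beta_nat n.+1 ^ 6)%N muln_gt0 !expn_gt0 IH.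
Qed.

Lemma beta_ge1 n : 1 <= beta n.
Proof. by rewrite beta_natE (ler_nat _ 1) beta_nat_gt0. Qed.

Lemma beta_gt0 n : 0 < beta n.
Proof. exact: lt_le_trans (beta_ge1 n). Qed.

Lemma gamma_gt0 n : 0 < gamma n.
Proof. by rewrite invr_gt0 beta_gt0. Qed.

Lemma alphaSS n : alpha n.+2 = n.+2%:R * beta n.+1 ^+ 3.
Proof.
rewrite /alpha_seq beta_seqSS (_ : _ * _ = (n.+2%:R * beta n.+1 ^+ 3) ^+ 2).
  by rewrite sqrtr_sqr ger0_norm// mulr_ge0// exprn_ge0// ltW// beta_gt0.
by rewrite exprMn -exprM.
Qed.

Lemma alpha_gt0 n : 0 < alpha n.
Proof. by rewrite sqrtr_gt0 beta_gt0. Qed.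

Lemma alpha_sqr n : alpha n ^+ 2 = beta n.
Proof. by rewrite sqr_sqrtr// ltW// beta_gt0. Qed.

Lemma alpha_ge1 n : 1 <= alpha n.
Proof. by rewrite -[leLHS]sqrtr1 ler_wsqrtr// beta_ge1. Qed.

Lemma alpha_le_beta n : alpha n <= beta n.
Proof. by rewrite -alpha_sqr expr2 ler_peMr ?alpha_ge1// ltW// alpha_gt0. Qed.

Lemma alpha_gamma n : alpha n * gamma n = (alpha n)^-1.
Proof.
by rewrite /gamma_seq -alpha_sqr expr2 invfM mulVKf// gt_eqF// alpha_gt0.
Qed.

Lemma alpha_double n : 2 * alpha n.+1 <= alpha n.+2.
Proof.
rewrite alphaSS; apply: ler_pM; rewrite ?ler_nat// ?(ltW (alpha_gt0 _))//.
apply: le_trans (alpha_le_beta _) _; rewrite exprS ler_peMr ?exprn_ege1 ?beta_ge1//.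
exact: ltW (beta_gt0 _).
Qed.

(** alpha at least doubles at each index: compare with a geometric series. *)
Lemma sum_inv_alpha n m : \sum_(n.+1 <= k < m) (alpha k)^-1 <= 2 * (alpha n.+1)^-1.
Proof.
have P k := alpha_gt0 k.
have [mn|nm] := leqP m n.+1.
  by rewrite big_geq// mulr_ge0// invr_ge0 ltW.
suff : \sum_(n.+1 <= k < m) (alpha k)^-1 <= 2 * (alpha n.+1)^-1 - 2 * (alpha m)^-1.
  by have : 0 < (alpha m)^-1; [rewrite invr_gt0|lra].
elim: m nm => // m IH; rewrite ltnS leq_eqVlt => /predU1P[<-|nm].
  rewrite big_nat1.
  have : (alpha n.+2)^-1 <= (2 * alpha n.+1)^-1.
    by rewrite lef_pV2 ?posrE ?mulr_gt0// alpha_double.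
  by rewrite invfM; lra.
rewrite big_nat_recr//=; last exact: ltnW.
have {}IH := IH nm; case: m nm IH => // m _ IH.
have : (alpha m.+2)^-1 <= (2 * alpha m.+1)^-1.
  by rewrite lef_pV2 ?posrE ?mulr_gt0// alpha_double.
by rewrite invfM; lra.
Qed.

End Coefficients.

Section Series.
Context {R : realType} {T : Type}.
Variables (B : R -> T -> R).
Hypothesis HB : forall w, cont_from 0 (fun u => B u w).

Definition gap (k : nat) (t : R) (w : T) : R :=
  B t w - skeleton (fun u => B u w) (gamma_seq k) t.

Lemma partial_YE n t w : partial_Y B n t w = \sum_(2 <= k < n) alpha_seq k * gap k t w.
Proof. by []. Qed.

Lemma gap_le k t w : 0 <= t -> `|gap k t w| <= gamma_seq k.
Proof. by move=> t0; apply: skeleton_dist => //; exact: gamma_gt0. Qed.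

Lemma gap_cont k w : cont_from 0 (fun t => gap k t w).
Proof.
apply: cont_fromD => //; apply: cont_fromN; apply: cont_from_skeleton => //.
exact: gamma_gt0.
Qed.

Lemma partial_Y_tail n m t w : 0 <= t -> (2 <= n <= m)%N ->
  `|partial_Y B m t w - partial_Y B n t w| <= 2 * (alpha_seq n)^-1.
Proof.
move=> t0 /andP[n2 nm]; rewrite !partial_YE (big_cat_nat _ nm)//= addrAC subrr add0r.
apply: le_trans (ler_norm_sum _ _ _) _.
case: n n2 nm => // n _ _; apply: le_trans (sum_inv_alpha n m).
apply: ler_sum => k _; rewrite normrM gtr0_norm ?alpha_gt0// -alpha_gamma.
by rewrite ler_pM2l ?alpha_gt0// gap_le.
Qed.

Lemma inv_alpha_small (e : R) : 0 < e -> exists2 n, (2 <= n)%N & 2 * (alpha_seq n)^-1 < e.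
Proof.
move=> e0; pose n := (Num.truncn (2 / e)).+2; exists n => //.
have P := @alpha_gt0 R n.
rewrite ltr_pdivrMr// mulrC -ltr_pdivrMr//.
apply: lt_le_trans (truncnS_gt _) _.
apply: (@le_trans _ _ n%:R); first by rewrite ler_nat.
rewrite alphaSS ler_peMr// exprn_ege1//; exact: beta_ge1.
Qed.

Lemma partial_Y_cvg t w : 0 <= t -> cvgn (fun n => partial_Y B n t w).
Proof.
move=> t0; apply: R_complete; apply: cauchy_exP => e e0.
have [n n2 ne] := inv_alpha_small e0; exists (partial_Y B n t w).
exists n => // m /= nm; rewrite /ball/= distrC.
by apply: le_lt_trans ne; apply: partial_Y_tail => //; rewrite n2.
Qed.

(** The gap has size at most gamma(k), and alpha(k) gamma(k) = 1 / alpha(k). *)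
Lemma Y_tail n t w : 0 <= t -> (2 <= n)%N ->
  `|Y_process B t w - partial_Y B n t w| <= 2 * (alpha_seq n)^-1.
Proof.
move=> t0 n2; rewrite ler_distl; have cv := @partial_Y_cvg t w t0.
have H m : (n <= m)%N -> partial_Y B n t w - 2 * (alpha_seq n)^-1 <= partial_Y B m t w
   <= partial_Y B n t w + 2 * (alpha_seq n)^-1.
  by move=> nm; rewrite -ler_distl partial_Y_tail// n2.
apply/andP; split.
  by apply: limr_ge => //; exists n => // m /= /H/andP[].
by apply: limr_le => //; exists n => // m /= /H/andP[].
Qed.

Lemma Y_le1 t w : 0 <= t -> `|Y_process B t w| <= 1.
Proof.
move=> t0; have := @Y_tail 2 t w t0 isT.
rewrite partial_YE big_geq// subr0 => /le_trans; apply.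
by rewrite alphaSS /= expr1n mulr1 divff.
Qed.

Lemma Y_cont w : cont_from 0 (fun t => Y_process B t w).
Proof.
move=> t e t0 e0; have e30 : 0 < e / 3 by rewrite divr_gt0.
have [n n2 ne] := inv_alpha_small e30.
have [d d0 Hd] : exists2 d, 0 < d & forall s, 0 <= s -> `|s - t| < d ->
   `|partial_Y B n s w - partial_Y B n t w| < e / 3.
  suff : cont_from 0 (fun t => partial_Y B n t w) by move/(_ t (e / 3) t0 e30).
  elim: n {n2 ne} => [|n IH].
    have -> : (fun t => partial_Y B 0 t w) = fun=> 0.
      by apply/funext => s; rewrite partial_YE big_geq.
    exact: cont_from_cst.
  have [n1|n1] := leqP n 1.
    have -> : (fun t => partial_Y B n.+1 t w) = fun=> 0.
      by apply/funext => s; rewrite partial_YE big_geq.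
    exact: cont_from_cst.
  have -> : (fun t => partial_Y B n.+1 t w) =
      fun t => partial_Y B n t w + alpha_seq n * gap n t w.
    by apply/funext => s; rewrite !partial_YE big_nat_recr.
  apply: cont_fromD => // u e' u0 e'0.
  have [d' d'0 Hd'] := @gap_cont n w u _ u0 (divr_gt0 e'0 (@alpha_gt0 R n)).
  exists d' => // s s0 sd; rewrite -mulrBr normrM gtr0_norm ?alpha_gt0//.
  by rewrite mulrC -ltr_pdivlMr ?alpha_gt0// Hd'.
exists d => // s s0 sd.
have := Hd s s0 sd; have := le_lt_trans (Y_tail w s0 n2) ne.
have := le_lt_trans (Y_tail w t0 n2) ne.
move: (Y_process B s w) (Y_process B t w) (partial_Y B n s w) (partial_Y B n t w).
by move=> y y' p p'; rewrite !ltr_norml; lra.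
Qed.

End Series.

(** * Real-valued expectations *)

Section Expectation.
Context {R : realType} {d : measure_display} {T : measurableType d}.
Variable P : probability T R.
Implicit Types (f g h : T -> R) (E : set T).

Definition integ f := P.-integrable setT (EFin \o f).
Definition mean f : R := \int[P]_x f x.

Lemma integ_measurable f : integ f -> measurable_fun setT f.
Proof. by move=> /measurable_int/measurable_EFinP. Qed.

Lemma integ_le f g : measurable_fun setT f -> integ g ->
  (forall w, `|f w| <= g w) -> integ f.
Proof.
move=> mf ig fg; apply: (le_integrable _ _ _ ig) => //; first exact/measurable_EFinP.
move=> w _ /=; rewrite lee_fin; apply: le_trans (fg w) _; exact: ler_norm.
Qed.

Lemma integ_cst k : integ (fun=> k).
Proof. exact: finite_measure_integrable_cst. Qed.

Lemma integ_bounded f k : measurable_fun setT f -> (forall w, `|f w| <= k) -> integ f.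
Proof. by move=> mf fk; apply: (integ_le mf (integ_cst k)). Qed.

Lemma integD f g : integ f -> integ g -> integ (fun w => f w + g w).
Proof. by move=> fi gi; have := integrableD measurableT fi gi. Qed.

Lemma integZ k f : integ f -> integ (fun w => k * f w).
Proof. by move=> fi; have := integrableZl measurableT k fi. Qed.

Lemma integN f : integ f -> integ (fun w => - f w).
Proof. by move=> fi; under eq_fun do rewrite -mulN1r; exact: integZ. Qed.

Lemma integB f g : integ f -> integ g -> integ (fun w => f w - g w).
Proof. by move=> fi gi; apply: integD => //; exact: integN. Qed.

Lemma integ_norm f : integ f -> integ (fun w => `|f w|).
Proof. by move=> fi; have := integrable_norm fi. Qed.

Lemma integ_sum (I : Type) (r : seq I) (F : I -> T -> R) :
  (forall i, integ (F i)) -> integ (fun w => \sum_(i <- r) F i w).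
Proof.
move=> iF; elim: r => [|i r IH].
  by under eq_fun do rewrite big_nil; exact: integ_cst.
by under eq_fun do rewrite big_cons; exact: integD.
Qed.

Lemma integM f g k : measurable_fun setT f -> (forall w, `|f w| <= k) -> integ g ->
  integ (fun w => f w * g w).
Proof.
move=> mf fk gi; apply: (integ_le (g := fun w => k * `|g w|)).
- by apply: measurable_funM => //; exact: integ_measurable.
- by apply: integZ; exact: integ_norm.
- by move=> w; rewrite normrM ler_wpM2r.
Qed.

Lemma mean_cst k : mean (fun=> k) = k.
Proof. by rewrite /mean Rintegral_cst//= probability_setT mulr1. Qed.

Lemma meanD f g : integ f -> integ g -> mean (fun w => f w + g w) = mean f + mean g.
Proof. by move=> fi gi; rewrite /mean RintegralD. Qed.

Lemma meanZ k f : integ f -> mean (fun w => k * f w) = k * mean f.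
Proof. by move=> fi; rewrite /mean RintegralZl. Qed.

Lemma meanN f : integ f -> mean (fun w => - f w) = - mean f.
Proof. by move=> fi; under [X in mean X]eq_fun do rewrite -mulN1r; rewrite meanZ// mulN1r. Qed.

Lemma meanB f g : integ f -> integ g -> mean (fun w => f w - g w) = mean f - mean g.
Proof. by move=> fi gi; rewrite meanD ?meanN//; exact: integN. Qed.

Lemma mean_sum (I : Type) (r : seq I) (F : I -> T -> R) :
  (forall i, integ (F i)) ->
  mean (fun w => \sum_(i <- r) F i w) = \sum_(i <- r) mean (F i).
Proof.
move=> iF; elim: r => [|i r IH].
  by under [X in mean X]eq_fun do rewrite big_nil; rewrite mean_cst big_nil.
under [X in mean X]eq_fun do rewrite big_cons.
by rewrite meanD ?IH ?big_cons//; exact: integ_sum.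
Qed.

Lemma mean_le f g : integ f -> integ g -> (forall w, f w <= g w) -> mean f <= mean g.
Proof. by move=> fi gi fg; apply: le_Rintegral. Qed.

Lemma mean_ge0 f : (forall w, 0 <= f w) -> 0 <= mean f.
Proof. by move=> f0; apply: Rintegral_ge0. Qed.

Lemma mean_norm f : integ f -> `|mean f| <= mean (fun w => `|f w|).
Proof. by move=> fi; apply: le_normr_Rintegral. Qed.

Lemma mean_ae_eq f g : measurable_fun setT f -> measurable_fun setT g ->
  {ae P, forall w, f w = g w} -> mean f = mean g.
Proof.
move=> mf mg fg; rewrite /mean /Rintegral; congr fine.
apply: ae_eq_integral => //; try exact/measurable_EFinP.
by move: fg; apply: filterS => w /= ->.
Qed.

Lemma mean_ae_le f g : integ f -> integ g ->
  {ae P, forall w, f w <= g w} -> mean f <= mean g.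
Proof.
move=> fi gi fg.
have mf := integ_measurable fi; have mg := integ_measurable gi.
have mm : measurable_fun setT (fun w => Num.max (f w) (g w)).
  exact: measurable_maxr.
have mi : integ (fun w => Num.max (f w) (g w)).
  apply: (integ_le mm (integD (integ_norm fi) (integ_norm gi))) => w.
  by case: (leP (f w) (g w)) => _; rewrite ?lerDl ?lerDr.
apply: (@le_trans _ _ (mean (fun w => Num.max (f w) (g w)))).
  by apply: mean_le => // w; rewrite le_max lexx.
by rewrite (@mean_ae_eq _ g)//; move: fg; apply: filterS => w /= fg; rewrite max_r.
Qed.

Lemma mean_indic E : measurable E -> mean (\1_E) = fine (P E).
Proof. by move=> mE; rewrite /mean /Rintegral integral_indic// setIT. Qed.

Lemma mean_indicM E f : measurable E -> mean (fun w => \1_E w * f w) = \int[P]_(w in E) f w.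
Proof.
move=> mE; rewrite Rintegral_mkcond /mean; apply: eq_Rintegral => w _.
by rewrite patchE indicE; case: (w \in E); rewrite ?mul1r ?mul0r.
Qed.

Lemma indic_measurable E : measurable E -> measurable_fun setT (\1_E : T -> R).
Proof. by move=> mE; exact: measurable_indic. Qed.

Lemma indic_le1 E w : `|\1_E w : R| <= 1.
Proof. by rewrite indicE; case: (_ \in _); rewrite ?normr1 ?normr0. Qed.

Lemma integ_indicM E f : measurable E -> integ f -> integ (fun w => \1_E w * f w).
Proof.
move=> mE fi; apply: (@integM _ _ 1) => //.
by move=> w; exact: indic_le1.
Qed.


End Expectation.

(** * Normal distributions *)

Section Normal.
Context {R : realType}.
Local Notation mu := (@lebesgue_measure R).
Implicit Types (s x : R).

Import HBNNSimple.

(** The integral on the left is a supremum over simple functions below f, and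
    for each of these both sides are finite sums. *)
Lemma integral_density_le (nu : {measure set (measurableTypeR R) -> \bar R})
    (p f : measurableTypeR R -> R) :
  measurable_fun setT p -> (forall x, 0 <= p x) ->
  (forall U, measurable U -> nu U = (\int[mu]_(x in U) (p x)%:E)%E) ->
  measurable_fun setT f -> (forall x, 0 <= f x) ->
  (\int[nu]_x (f x)%:E <= \int[mu]_x (f x * p x)%:E)%E.
Proof.
move=> mp p0 nup mf f0; rewrite ge0_integralTE; last by move=> x; rewrite lee_fin.
apply/ereal_supP => /= _ [h hf <-].
have mhp : measurable_fun setT (fun x => h x * p x).
  apply: measurable_funM => //. exact: (@measurable_funPT _ _ _ _ h).
have mfp : measurable_fun setT (fun x => f x * p x) by apply: measurable_funM => //.
apply: (@le_trans _ _ (\int[mu]_x (h x * p x)%:E)%E); last first.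
  apply: ge0_le_integral => //=.
  - by move=> x _; rewrite lee_fin mulr_ge0.
  - by apply/measurable_EFinP; exact: mhp.
  - by apply/measurable_EFinP; exact: mfp.
  - by move=> x _; rewrite lee_fin ler_wpM2r//; have := hf x; rewrite lee_fin.
rewrite sintegralE.
under [leRHS]eq_integral => x _.
  rewrite fimfunE EFinM -fsumEFin// ge0_mule_fsuml; last first.
    by move=> r; rewrite EFinM nnfun_muleindic_ge0.
  over.
rewrite ge0_integral_fsum//; last 2 first.
- move=> r; apply: emeasurable_funM; apply/measurable_EFinP => //.
  by apply: measurable_funM => //; exact: measurable_indic.
- by move=> r x _; apply: mule_ge0; rewrite ?lee_fin// -lee_fin EFinM nnfun_muleindic_ge0.
rewrite le_eqVlt; apply/orP; left; apply/eqP; apply: eq_fsbigr => r; rewrite inE /= => -[y _ yr].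
have r0 : 0 <= r by rewrite -yr.
have mh : measurable (h @^-1` [set r]) by exact: measurable_sfunP.
rewrite nup// -ge0_integralZl//; last 2 first.
- by apply/measurable_EFinP; exact: measurable_funTS.
- by move=> x _; rewrite lee_fin.
rewrite integral_mkcond; apply: eq_integral => x _.
rewrite patchE indicE; case: ifPn => _; first by rewrite mulr1.
by rewrite mulr0 mul0e.
Qed.

Lemma normal_peak_double s : s != 0 -> normal_peak s = 2 * normal_peak (2 * s).
Proof.
move=> s0; rewrite /normal_peak exprMn.
have -> : 2 ^+ 2 * s ^+ 2 * pi *+ 2 = 2 ^+ 2 * (s ^+ 2 * pi *+ 2) :> R.
  by rewrite -mulrA -mulrnAr.
rewrite sqrtrM ?exprn_ge0// sqrtr_sqr ger0_norm// invfM mulVKf//.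
Qed.

(** With v = x^2 / (8 s^2) the claim is v^2 exp(- 4 v) <= exp(- v), which
    follows from v <= 1 + v <= exp v. *)
Lemma normal_pdf_fourth s x : 0 < s ->
  x ^+ 4 * normal_pdf 0 s x <= 128 * s ^+ 4 * normal_pdf 0 (2 * s) x.
Proof.
move=> s0; have s0' : s != 0 by rewrite gt_eqF.
rewrite !normal_pdfE// ?mulf_neq0// normal_peak_double// /normal_fun subr0.
pose v := x ^+ 2 / (8 * s ^+ 2).
have v0 : 0 <= v by rewrite divr_ge0 ?sqr_ge0// mulr_ge0// sqr_ge0.
have -> : - x ^+ 2 / (s ^+ 2 *+ 2) = - (4 * v) by rewrite /v; field.
have -> : - x ^+ 2 / ((2 * s) ^+ 2 *+ 2) = - v by rewrite /v; field.
have -> : x ^+ 4 = 64 * s ^+ 4 * v ^+ 2 by rewrite /v; field.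
rewrite !expRN.
have e1 : 1 + v <= expR v by exact: expR_ge1Dx.
have -> : expR (4 * v) = expR v ^+ 4 by rewrite mulrC expRM_natr.
move: (expR v) e1 => e e1; have e0 : 0 < e by lra.
have k : v ^+ 2 * (e ^+ 4)^-1 <= e^-1.
  rewrite ler_pdivrMr ?exprn_gt0//.
  have -> : e^-1 * e ^+ 4 = e ^+ 3 by field; rewrite gt_eqF.
  apply: (@le_trans _ _ (e ^+ 2)).
    by rewrite ler_pXn2r ?nnegrE// ?(ltW e0)//; lra.
  by apply: ler_weXn2l => //; lra.
have p0 := @normal_peak_ge0 R (2 * s).
have s40 : 0 <= 128 * s ^+ 4 * normal_peak (2 * s).
  by apply: mulr_ge0 => //; apply: mulr_ge0 => //; rewrite exprn_even_ge0.
have := ler_wpM2l s40 k.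
lra.
Qed.

Lemma normal_fourth s : 0 < s ->
  (\int[normal_prob 0 s]_x (x ^+ 4)%:E <= (128 * s ^+ 4)%:E)%E.
Proof.
move=> s0.
have mp s' : measurable_fun setT (normal_pdf 0 s' : R -> R).
  exact: measurable_normal_pdf.
have m4 : measurable_fun setT (fun x : R => x ^+ 4) by exact: measurable_funX.
have x40 (x : R) : 0 <= x ^+ 4 by rewrite exprn_even_ge0.
apply: le_trans (integral_density_le (mp s) _ _ m4 x40) _ => //.
  by move=> x; exact: normal_pdf_ge0.
have c0 : 0 <= 128 * s ^+ 4 by rewrite mulr_ge0// exprn_ge0// ltW.
apply: (@le_trans _ _ (\int[mu]_x ((128 * s ^+ 4) * normal_pdf 0 (2 * s) x)%:E)%E).
  apply: ge0_le_integral => //=.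
  - by move=> x _; rewrite lee_fin mulr_ge0// normal_pdf_ge0.
  - apply/measurable_EFinP; apply: measurable_funM => //. exact: mp.
  - by apply/measurable_EFinP; apply: measurable_funM => //; exact: mp.
  - by move=> x _; rewrite lee_fin normal_pdf_fourth.
under eq_integral do rewrite EFinM.
rewrite ge0_integralZl//=; last 2 first.
- by apply/measurable_EFinP; exact: mp.
- by move=> x _; rewrite lee_fin normal_pdf_ge0.
by rewrite integral_normal_pdf mule1.
Qed.

(** The density is at most 1 / (s sqrt(2 pi)) and pi >= 2. *)
Lemma normal_center_le s : 0 < s ->
  (normal_prob 0 s [set x : R | (`|x| < s / 2)%R] <= (2^-1)%:E)%E.
Proof.
move=> s0; have s0' : s != 0 by rewrite gt_eqF.
have -> : [set x : R | `|x| < s / 2] = `]- (s / 2), s / 2[%classic.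
  by apply/seteqP; split => x /=; rewrite in_itv/= ltr_norml.
set J := `]- (s / 2), s / 2[%classic.
have /le_trans : (normal_prob 0 s J <=
    \int[mu]_(x in J) (normal_peak s)%:E)%E.
  apply: ge0_le_integral => //=; first by rewrite /J.
  - by move=> x _; rewrite lee_fin normal_pdf_ge0.
  - by apply/measurable_EFinP/measurable_funTS; exact: measurable_normal_pdf.
  - by move=> x _; rewrite lee_fin normal_pdf_ub.
apply.
rewrite integral_cst//= ?/J//. rewrite lebesgue_measure_itv /= lte_fin.
have -> : - (s / 2) < s / 2 by lra.
rewrite -EFinD -EFinM lee_fin opprK -mulr2n -(mulr_natr (s / 2)) divfK//.
rewrite /normal_peak mulrC ler_pdivrMr; last first.
  by rewrite sqrtr_gt0 pmulrn_lgt0// mulr_gt0 ?pi_gt0// exprn_gt0.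
apply: (@le_trans _ _ (2^-1 * Num.sqrt ((2 * s) ^+ 2))).
  by rewrite sqrtr_sqr gtr0_norm ?mulr_gt0// mulKf.
rewrite ler_pM2l//; apply: ler_wsqrtr; rewrite exprMn mulr2n.
have h : 0 <= s ^+ 2 * (pi - 2) by rewrite mulr_ge0 ?sqr_ge0// subr_ge0 pi_ge2.
lra.
Qed.

Lemma normal_sym s (U : set R) : s != 0 -> measurable U ->
  normal_prob 0 s (-%R @^-1` U) = normal_prob 0 s U.
Proof.
move=> s0 mU; rewrite /normal_prob.
have E x : normal_pdf 0 s (- x) = normal_pdf 0 s x.
  by rewrite normal_pdfE//= /normal_fun !subr0 sqrrN.
have mN : measurable_fun setT (-%R : R -> measurableTypeR R) by [].
transitivity (\int[mu]_(x in (-%R : R -> measurableTypeR R) @^-1` U)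
    ((fun x => (normal_pdf 0 s x)%:E) \o -%R) x)%E.
  by apply: eq_integral => x _ /=; rewrite E.
rewrite -ge0_integral_pushforward//.
- by apply: eq_measure_integral => //= A mA _; exact: lebesgue_measureN.
- by apply/measurable_EFinP/measurable_funTS; exact: measurable_normal_pdf.
- by move=> x _; rewrite lee_fin normal_pdf_ge0.
Qed.

End Normal.

(** * Independence of Brownian increments from the past *)

Section Independence.
Context {R : realType} {d : measure_display} {T : measurableType d}.
Variable P : probability T R.

(** The two sides are finite measures of E that agree on a pi-system. *)
Lemma indep_generate (G : set (set T)) (D : set T) : G `<=` measurable -> G setT ->
  setI_closed G -> measurable D ->
  (forall A, G A -> P (A `&` D) = (P A * P D)%E) ->
  forall E, <<s G >> E -> P (E `&` D) = (P E * P D)%E.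
Proof.
move=> Gm GT GI mD GD E GE.
have PD0 : 0 <= fine (P D) by rewrite fine_ge0.
have PDE : P D = (fine (P D))%:E by rewrite fineK// fin_num_measure.
rewrite PDE muleC.
have := @g_sigma_algebra_measure_unique _ R T G Gm (fun=> setT) (fun=> GT) _
  (mrestr P mD) (mscale (NngNum PD0) P) GI _ _ E GE.
rewrite /mscale/= /mrestr/=; apply.
- by apply/seteqP; split => // w _; exists 0%N.
- by move=> A GA; rewrite /mrestr /= /mscale /= GD// {1}PDE muleC.
- by move=> _; rewrite setTI PDE ltry.
Qed.

(** Equality up to a null event absorbs both the null events of the
    filtration and the fact that B 0 = 0 only holds almost surely. *)
Definition ae_same (E E0 : set T) :=
  exists N, [/\ measurable N, P N = 0%E & forall w, ~ N w -> (E w <-> E0 w)].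

Lemma ae_sameI E E0 F F0 : ae_same E E0 -> ae_same F F0 ->
  ae_same (E `&` F) (E0 `&` F0).
Proof.
move=> [N [mN N0 HN]] [M [mM M0 HM]]; exists (N `|` M); split.
- exact: measurableU.
- by apply: null_set_setU.
- by move=> w /not_orP[/HN Nw /HM Mw]; rewrite /setI /=; tauto.
Qed.

Lemma ae_sameP E E0 : measurable E -> measurable E0 -> ae_same E E0 -> P E = P E0.
Proof.
have K A B : measurable A -> measurable B -> ae_same A B -> (P A <= P B)%E.
  move=> mA mB [N [mN N0 HN]]; apply: (@le_trans _ _ (P (B `|` N))).
    apply: le_measure; rewrite ?inE//; first exact: measurableU.
    by move=> w Aw; have [Nw|/HN[+ _]] := pselect (N w); [right|move=> /(_ Aw); left].
  apply: (le_trans (measureU2 P mB mN)).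
  by have -> : (P B + P N = P B + 0)%E by [congr (_ + _)%E]; rewrite adde0.
move=> mE mE0 H; apply/eqP; rewrite eq_le K//= K//.
by case: H => N [mN N0 HN]; exists N; split => // w /HN; tauto.
Qed.

End Independence.

Section Brownian.
Context {R : realType} {d : measure_display} {T : measurableType d}.
Variables (P : probability T R) (B : R -> T -> R).
Hypothesis hB : standard_brownian_motion P B.
Implicit Types (s t u : R) (E D : set T) (U : set R).

Lemma bm_measurable t : 0 <= t -> measurable_fun setT (B t).
Proof. by have [h _ _ _ _] := hB; exact: h. Qed.

Definition incr s t (w : T) : R := B t w - B s w.

Lemma incr_measurable s t : 0 <= s -> 0 <= t -> measurable_fun setT (incr s t).
Proof. by move=> s0 t0; apply: measurable_funB; exact: bm_measurable. Qed.

Lemma incr_event s t U : 0 <= s -> 0 <= t -> measurable U ->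
  measurable (incr s t @^-1` U).
Proof. by move=> s0 t0 mU; rewrite -[X in measurable X]setTI; exact: incr_measurable. Qed.

Definition past s : set (set T) := past_events B s `|` null_events P.

Lemma past_measurable s E : <<s past s >> E -> measurable E.
Proof.
apply: smallest_sub; first exact: sigma_algebra_measurable.
move=> A [[u [U [u0 us mU ->]]]|[mA _]]//.
by rewrite -[X in measurable X]setTI; apply: bm_measurable.
Qed.

Lemma filtration_past s s' E : s < s' -> usual_filtration P B s E -> <<s past s' >> E.
Proof. by move=> ss' /(_ s' ss'). Qed.

Lemma filtration_measurable s E : usual_filtration P B s E -> measurable E.
Proof. by move=> h; apply: (@past_measurable (s + 1)); apply: filtration_past h; lra. Qed.

Section Grid.
Variables (tt : nat -> R) (n : nat).
Hypotheses (tt0 : 0 <= tt 0%N) (ttnd : nondecreasing_seq tt).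

(** The pi-system of events about the first n increments along tt, for which
    independence of increments is stated. *)
Definition grid_events : set (set T) :=
  [set C | exists V : nat -> set R, (forall i, measurable (V i)) /\
     C = \bigcap_(i < n) (incr (tt i) (tt i.+1) @^-1` (V i))].

Lemma tt_ge0 i : 0 <= tt i.
Proof. by apply: le_trans tt0 _; exact: ttnd. Qed.

Lemma grid_events_measurable : grid_events `<=` measurable.
Proof.
move=> C [V [mV ->]]; apply: bigcap_measurableType.
by move=> i _; apply: incr_event => //; exact: tt_ge0.
Qed.

Lemma grid_eventsT : grid_events setT.
Proof. by exists (fun=> setT); split => //; apply/seteqP; split. Qed.

Lemma grid_eventsI : setI_closed grid_events.
Proof.
move=> _ _ [V [mV ->]] [W [mW ->]]; exists (fun i => V i `&` W i); split.
  by move=> i; exact: measurableI.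
apply/seteqP; split => w /=.
  by move=> [h1 h2] i ni; split; [exact: h1|exact: h2].
by move=> h; split => i ni; have [] := h i ni.
Qed.

(** The independence assumption for n + 1 increments, divided by the one for n
    increments. *)
Lemma grid_indep U E : measurable U -> <<s grid_events >> E ->
  P (E `&` incr (tt n) (tt n.+1) @^-1` U) = (P E * P (incr (tt n) (tt n.+1) @^-1` U))%E.
Proof.
move=> mU; apply: indep_generate.
- exact: grid_events_measurable.
- exact: grid_eventsT.
- exact: grid_eventsI.
- by apply: incr_event => //; exact: tt_ge0.
move=> _ [V [mV ->]].
have [_ _ indep _ _] := hB.
pose W i := if (i < n)%N then V i else U.
have mW i : measurable (W i) by rewrite /W; case: ifP.
have WE i : (i < n)%N -> W i = V i by rewrite /W => ->.
have Wn : W n = U by rewrite /W ltnn.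
have := indep n.+1 tt W tt0 ttnd mW.
have -> : \bigcap_(i < n.+1) [set w | W i (B (tt i.+1) w - B (tt i) w)] =
  \bigcap_(i < n) [set w | W i (B (tt i.+1) w - B (tt i) w)] `&`
  [set w | U (B (tt n.+1) w - B (tt n) w)].
  apply/seteqP; split => w /=.
    by move=> h; split=> [i ni|]; [exact: h (ltnW ni)|have := h n (ltnSn n); rewrite Wn].
  by move=> [h hn] i /=; rewrite ltnS leq_eqVlt => /predU1P[->|]; [rewrite Wn|exact: h].
rewrite [in X in _ = X]big_ord_recr /= -(indep n tt W tt0 ttnd mW) Wn.
suff -> : \bigcap_(i < n) [set w | W i (B (tt i.+1) w - B (tt i) w)] =
  \bigcap_(i < n) incr (tt i) (tt i.+1) @^-1` V i by [].
by apply: eq_bigcapr => i /= ni; rewrite WE.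
Qed.

(** B (tt k) - B (tt 0) is a sum of increments along the grid. *)
Lemma grid_measurable k : (k <= n)%N ->
  measurable_fun (setT : set (g_sigma_algebraType grid_events)) (incr (tt 0%N) (tt k)).
Proof.
move=> kn.
elim: k kn => [_|k IH kn].
  rewrite (_ : incr _ _ = cst 0)//.
  by apply/funext => w; rewrite /incr subrr.
have -> : incr (tt 0%N) (tt k.+1) = incr (tt 0%N) (tt k) \+ incr (tt k) (tt k.+1).
  by apply/funext => w; rewrite /incr /=; lra.
apply: measurable_funD; first exact: IH (ltnW kn).
move=> _ U mU; rewrite setTI; apply: sub_sigma_algebra.
exists (fun i => if i == k then U else setT); split; first by move=> i; case: ifP.
apply/seteqP; split => w /=.
  by move=> h i _; case: eqP => // ->.
by move=> /(_ k kn); rewrite eqxx.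
Qed.

End Grid.

Definition cylinders (us : seq R) : set (set T) :=
  [set A | exists u U, [/\ u \in us, measurable U & A = incr 0 u @^-1` U]].

(** Sorting the finitely many times that E depends on, between 0 and s, gives
    a grid whose next increment is the one from s to t. *)
Lemma cylinders_indep (us : seq R) s t E U : 0 <= s -> s <= t ->
  (forall u, u \in us -> 0 <= u <= s) -> measurable U -> <<s cylinders us >> E ->
  P (E `&` incr s t @^-1` U) = (P E * P (incr s t @^-1` U))%E.
Proof.
move=> s0 st us_s mU cE.
pose l := sort <=%R us; (* the grid is 0, the sorted times, s, and then t for ever *)
pose q := 0 :: rcons l s.
pose tt i := nth t q i; pose n := (size l).+1.
have sq : size q = n.+1 by rewrite /q /= size_rcons.
have ln u : u \in l -> 0 <= u <= s by rewrite mem_sort; exact: us_s.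
have q_sorted : sorted <=%R q.
  rewrite /q /= rcons_path; apply/andP; split.
    rewrite path_sortedE; last exact: le_trans.
    rewrite (sort_sorted le_total) andbT.
    by apply/allP => u /ln /andP[].
  by rewrite -[X in X <= _]/(last 0 l); have := mem_last 0 l;
     rewrite in_cons => /predU1P[->//|/ln/andP[]].
have q_le u : u \in q -> u <= t.
  rewrite in_cons mem_rcons in_cons => /predU1P[->|/predU1P[->//|/ln/andP[_ u_s]]].
    exact: le_trans st.
  exact: le_trans st.
have ttnd : nondecreasing_seq tt.
  move=> i j ij; have [jq|qj] := ltnP j (size q).
    apply: (sorted_leq_nth le_trans lexx t q_sorted) => //.
    by rewrite inE; exact: leq_ltn_trans jq.
  rewrite /tt (nth_default _ qj); have [iq|qi] := ltnP i (size q).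
    by apply: q_le; exact: mem_nth.
  by rewrite nth_default.
have tt0 : tt 0%N = 0 by [].
have ttn : tt n = s by rewrite /tt /q /= nth_rcons ltnn eqxx.
have ttn1 : tt n.+1 = t by rewrite /tt nth_default// sq.
have := @grid_indep tt n _ ttnd U E mU; rewrite tt0 lexx ttn ttn1; apply => //.
apply: (smallest_sub _ _ cE).
  exact: smallest_sigma_algebra.
move=> A [u [V [uus mV ->]]].
have ul : u \in l by rewrite mem_sort.
pose k := (index u l).+1.
have kn : (k <= n)%N by rewrite /k /n ltnS index_size.
have ttk : tt k = u.
  by rewrite /tt /k /q /= nth_rcons index_mem ul nth_index.
have := @grid_measurable tt n k kn measurableT V mV.
by rewrite tt0 ttk setTI.
Qed.

(** A pi-system that generates the past up to s together with the null
    events, each member being, up to a null event, an event about finitely many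
    increments. *)
Definition almost_past s : set (set T) :=
  [set E | measurable E /\ exists us E0, [/\ forall u, u \in us -> 0 <= u <= s,
     <<s cylinders us >> E0 & ae_same P E E0]].

Lemma cylindersS (us vs : seq R) E : {subset us <= vs} -> <<s cylinders us >> E -> <<s cylinders vs >> E.
Proof.
move=> uv; apply: smallest_sub; first exact: smallest_sigma_algebra.
by move=> A [u [V [uus mV ->]]]; apply: sub_sigma_algebra; exists u, V; split => //; exact: uv.
Qed.

Lemma almost_pastI s : setI_closed (almost_past s).
Proof.
move=> E F [mE [us [E0 [us_s cE EE0]]]] [mF [vs [F0 [vs_s cF FF0]]]].
split; first exact: measurableI.
exists (us ++ vs), (E0 `&` F0); split.
- by move=> u; rewrite mem_cat => /orP[/us_s|/vs_s].
- apply: (@measurableI _ (g_sigma_algebraType (cylinders (us ++ vs)))).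
    by apply: cylindersS cE => u ?; rewrite mem_cat; apply/orP; left.
  by apply: cylindersS cF => u ?; rewrite mem_cat; apply/orP; right.
- exact: ae_sameI.
Qed.

Lemma null_start : P [set w | ~ B 0 w = 0] = 0%E /\ measurable [set w | ~ B 0 w = 0].
Proof.
have mN : measurable [set w | ~ B 0 w = 0].
  rewrite (_ : [set w | ~ B 0 w = 0] = setT `&` B 0 @^-1` (~` [set 0])); last first.
    by rewrite setTI.
  by apply: bm_measurable => //; exact: measurableC.
split => //; have [_ h _ _ _] := hB.
by apply/negligibleP.
Qed.

Lemma past_almost s : 0 <= s -> past s `<=` almost_past s.
Proof.
move=> s0 E [[u [U [u0 us mU ->]]]|[mE E0]].
  split; first by rewrite -[X in measurable X]setTI; exact: bm_measurable.
  exists [:: u], (incr 0 u @^-1` U); split.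
  - by move=> v; rewrite inE => /eqP ->; rewrite u0.
  - by apply: sub_sigma_algebra; exists u, U; rewrite inE eqxx.
  - have [N0 mN] := null_start; exists [set w | ~ B 0 w = 0]; split => // w /contrapT Bw.
    by rewrite /incr /= Bw subr0.
split => //; exists [::], set0; split => //.
  by have [h _ _] := smallest_sigma_algebra setT (cylinders [::]).
by exists E; split => // w nE; split => // /nE.
Qed.

(** The usual monotone class argument, run on [almost_past]. *)
Lemma past_indep s t E U : 0 <= s -> s <= t -> measurable U -> <<s past s >> E ->
  P (E `&` incr s t @^-1` U) = (P E * P (incr s t @^-1` U))%E.
Proof.
move=> s0 st mU cE; have t0 := le_trans s0 st.
have mD := incr_event s0 t0 mU.
apply: (@indep_generate _ _ _ P (almost_past s)) => //.
- by move=> A [].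
- split => //; exists [::], setT; split => //.
    exact: (@measurableT _ (g_sigma_algebraType (cylinders [::]))).
  by exists set0.
- exact: almost_pastI.
- move=> A [mA [us [A0 [us_s cA AA0]]]].
  have mA0 : measurable A0.
    apply: smallest_sub cA; first exact: sigma_algebra_measurable.
    by move=> _ [u [V [/us_s/andP[u0 _] mV ->]]]; exact: incr_event.
  rewrite (ae_sameP mA mA0 AA0) -(cylinders_indep s0 st us_s mU cA).
  apply: ae_sameP; [exact: measurableI|exact: measurableI|].
  apply: ae_sameI => //; exists set0; split => //; exact: measure0.
- apply: (smallest_sub _ _ cE); first exact: smallest_sigma_algebra.
  by move=> A /(past_almost s0); exact: sub_sigma_algebra.
Qed.

End Brownian.

(** * Moments of Brownian increments under the usual filtration *)

Section Moments.
Context {R : realType} {d : measure_display} {T : measurableType d}.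
Variables (P : probability T R) (B : R -> T -> R).
Hypothesis hB : standard_brownian_motion P B.
Implicit Types (s t u : R) (E D : set T) (U : set R).
Local Notation mean := (mean P).
Local Notation integ := (integ P).
Local Notation dB := (incr B).
Local Notation F := (usual_filtration P B).

Lemma incr_law s t U : 0 <= s -> s < t -> measurable U ->
  P (dB s t @^-1` U) = normal_prob 0 (Num.sqrt (t - s)) U.
Proof. by move=> s0 st mU; have [_ _ _ h _] := hB; exact: h. Qed.

Lemma incr4 s t : 0 <= s -> s < t ->
  (\int[P]_w (dB s t w ^+ 4)%:E <= (128 * (t - s) ^+ 2)%:E)%E.
Proof.
move=> s0 st; have t0 : 0 <= t by apply: le_trans (ltW st).
have mX : measurable_fun setT (dB s t : T -> measurableTypeR R).
  exact: (incr_measurable hB).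
have st0 : 0 < t - s by rewrite subr_gt0.
have -> : (128 * (t - s) ^+ 2)%:E = (128 * Num.sqrt (t - s) ^+ 4)%:E :> \bar R.
  by rewrite (_ : 4 = 2 * 2)%N// exprM sqr_sqrtr// ltW.
apply: le_trans (normal_fourth _); last by rewrite sqrtr_gt0.
have m4 : measurable_fun setT (fun x : measurableTypeR R => (x ^+ 4)%:E).
  by apply/measurable_EFinP; exact: measurable_funX.
rewrite -[leLHS](@ge0_integral_pushforward _ _ _ _ _ _ mX P setT (fun x => (x ^+ 4)%:E))//; last first.
  by move=> x _; rewrite lee_fin exprn_even_ge0.
rewrite (eq_measure_integral (normal_prob 0 (Num.sqrt (t - s))))// => A mA _.
exact: incr_law.
Qed.

Lemma integ_incr4 s t : 0 <= s -> s <= t -> integ (fun w => dB s t w ^+ 4).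
Proof.
move=> s0; rewrite le_eqVlt => /predU1P[<-|st].
  under eq_fun do rewrite /incr subrr expr0n; exact: integ_cst.
have t0 : 0 <= t by apply: le_trans (ltW st).
apply/integrableP; split.
  by apply/measurable_EFinP; apply: measurable_funX; exact: (incr_measurable hB).
apply: le_lt_trans (ltry (128 * (t - s) ^+ 2)).
apply: le_trans (incr4 s0 st).
rewrite le_eqVlt; apply/orP; left; apply/eqP; apply: eq_integral => w _ /=.
by rewrite ger0_norm// exprn_even_ge0.
Qed.

Lemma mean_incr4 s t : 0 <= s -> s <= t ->
  mean (fun w => dB s t w ^+ 4) <= 128 * (t - s) ^+ 2.
Proof.
move=> s0 st; have fin : (\int[P]_w (dB s t w ^+ 4)%:E)%E \is a fin_num.
  by apply: integrable_fin_num => //; exact: integ_incr4.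
move: st; rewrite le_eqVlt => /predU1P[<-|st].
  under [X in mean X]eq_fun do rewrite /incr subrr expr0n.
  by rewrite mean_cst subrr expr0n mulr0.
by rewrite -lee_fin fineK// incr4.
Qed.

Lemma integ_incr2 s t : 0 <= s -> s <= t -> integ (fun w => dB s t w ^+ 2).
Proof.
move=> s0 st; have t0 : 0 <= t by exact: le_trans st.
apply: (integ_le _ (integD (integ_cst P 1) (integ_incr4 s0 st))).
  by apply: measurable_funX; exact: (incr_measurable hB).
move=> w; rewrite ger0_norm ?sqr_ge0//.
have := sqr_ge0 (dB s t w ^+ 2 - 1); have := sqr_ge0 (dB s t w).
have -> : dB s t w ^+ 4 = (dB s t w ^+ 2) ^+ 2 by rewrite -exprM.
rewrite sqrrB1; lra.
Qed.

Lemma integ_incr s t : 0 <= s -> s <= t -> integ (dB s t).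
Proof.
move=> s0 st; have t0 : 0 <= t by exact: le_trans st.
apply: (integ_le _ (integD (integ_cst P 1) (integ_incr2 s0 st))).
  exact: (incr_measurable hB).
move=> w; have := sqr_ge0 (`|dB s t w| - 1); have := normr_ge0 (dB s t w).
rewrite sqrrB1 real_normK ?num_real//; lra.
Qed.

(** From the fourth moment, as 2 h x^2 <= h^2 + x^4 with h = t - s: the
    constant is (1 + 128) / 2 rounded up. *)
Lemma mean_incr2 s t : 0 <= s -> s <= t ->
  mean (fun w => dB s t w ^+ 2) <= 65 * (t - s).
Proof.
move=> s0; rewrite le_eqVlt => /predU1P[<-|st].
  under [X in mean X]eq_fun do rewrite /incr subrr expr0n.
  by rewrite mean_cst subrr mulr0.
have st0 : 0 < t - s by rewrite subr_gt0.
have := mean_incr4 s0 (ltW st).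
have i2 := integ_incr2 s0 (ltW st); have i4 := integ_incr4 s0 (ltW st).
have : mean (fun w => (2 * (t - s)) * dB s t w ^+ 2) <=
       mean (fun w => (t - s) ^+ 2 + dB s t w ^+ 4).
  apply: mean_le => [||w]; [exact: integZ|by apply: integD => //; exact: integ_cst|].
  have -> : dB s t w ^+ 4 = (dB s t w ^+ 2) ^+ 2 by rewrite -exprM.
  have := sqr_ge0 (dB s t w ^+ 2 - (t - s)); lra.
rewrite meanZ// meanD//; last exact: integ_cst.
rewrite mean_cst => h1 h2.
rewrite -(ler_pM2l st0); have := sqr_ge0 (t - s); lra.
Qed.

Lemma mean_abs_incr s t e : 0 <= s -> s <= t -> 0 < e ->
  mean (fun w => `|dB s t w|) <= e + 65 * (t - s) / e.
Proof.
move=> s0 st e0.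
have i2 := integ_incr2 s0 st; have i1 := integ_norm (integ_incr s0 st).
apply: (@le_trans _ _ (mean (fun w => e + e^-1 * dB s t w ^+ 2))).
  apply: mean_le => // [|w]; first by apply: integD; [exact: integ_cst|exact: integZ].
  rewrite -(ler_pM2l e0) mulrDr mulVKf ?gt_eqF//.
  have := sqr_ge0 (`|dB s t w| - e); have := sqr_ge0 `|dB s t w|.
  rewrite -[X in _ <= _ + X]real_normK ?num_real//; have := sqr_ge0 e; lra.
rewrite meanD ?mean_cst ?meanZ//; [|exact: integ_cst|exact: integZ].
by rewrite lerD2l mulrC ler_pM2r ?invr_gt0// mean_incr2.
Qed.

(** The variable 1_E (B t - B s) has a symmetric law, since E is independent
    of the increment and the increment has a symmetric law. *)
Lemma past_centred s t E : 0 <= s -> s < t -> <<s past P B s >> E ->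
  mean (fun w => \1_E w * dB s t w) = 0.
Proof.
move=> s0 st cE; have t0 : 0 <= t by apply: le_trans (ltW st).
have mE := past_measurable hB cE.
have mX := incr_measurable hB s0 t0.
have Xi := integ_indicM mE (integ_incr s0 (ltW st)).
pose Y w : measurableTypeR R := \1_E w * dB s t w.
have mY : measurable_fun setT Y by exact: (integ_measurable Xi).
have mNY : measurable_fun setT (fun w => - Y w : measurableTypeR R).
  exact: (integ_measurable (integN Xi)).
have st0 : Num.sqrt (t - s) != 0 by rewrite gt_eqF// sqrtr_gt0 subr_gt0.
have law U : measurable U -> P (Y @^-1` U) = P ((fun w => - Y w) @^-1` U).
  have K V : measurable V -> P (Y @^-1` V) =
      (P E * normal_prob 0 (Num.sqrt (t - s)) V + P (~` E `&` [set w | V 0%R]))%E.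
    move=> mV; have mVX : measurable (dB s t @^-1` V) by exact: (incr_event hB s0 t0 mV).
    have -> : Y @^-1` V = (E `&` dB s t @^-1` V) `|` (~` E `&` [set w | V 0]).
      apply/seteqP; split => w; rewrite /Y /preimage /= indicE.
        have [Ew|Ew] := pselect (E w).
          by rewrite mem_set// mul1r => h; left.
        by rewrite memNset// mul0r => h; right.
      move=> [[Ew h]|[Ew h]]; first by rewrite mem_set// mul1r.
      by rewrite memNset// mul0r.
    rewrite measureU //.
    - by congr (_ + _)%E; rewrite -incr_law//; apply: (past_indep hB) => //; exact: ltW.
    - exact: measurableI.
    - apply: measurableI; first exact: measurableC.
      by have [V0|V0] := pselect (V 0);
        [rewrite (_ : [set _ | _] = setT)//|rewrite (_ : [set _ | _] = set0)//];
        apply/seteqP; split.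
    - by apply/seteqP; split => // w [[Ew _] [nEw _]].
  move=> mU.
  have -> : (fun w => - Y w) @^-1` U = Y @^-1` (-%R @^-1` U) by [].
  have mNU : measurable (-%R @^-1` U : set R).
    by rewrite -[X in measurable X]setTI; exact: oppr_measurable.
  by rewrite !K// normal_sym//= oppr0.
have : mean Y = mean (fun w => - Y w).
  rewrite /mean /Rintegral; congr fine.
  have mid : measurable_fun setT (EFin : measurableTypeR R -> \bar R) by exact: EFin_measurable.
  have := @integral_pushforward _ _ _ _ R Y mY P setT EFin mid Xi measurableT.
  have := @integral_pushforward _ _ _ _ R _ mNY P setT EFin mid (integN Xi) measurableT.
  rewrite !preimage_setT => <- <-.
  by apply: eq_measure_integral => A mA _; exact: law.
rewrite meanN// => /eqP; rewrite -addr_eq0 -mulr2n mulrn_eq0 => /eqP; exact.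
Qed.

(** An event of the right-continuous filtration at s is an event of the past
    at every s' > s; let s' tend to s, the contribution of [s, s'] being small
    in mean. *)
Lemma filtration_centred s t E : 0 <= s -> s <= t -> F s E ->
  mean (fun w => \1_E w * dB s t w) = 0.
Proof.
move=> s0; rewrite le_eqVlt => /predU1P[<- _|st FE].
  under [X in mean X]eq_fun do rewrite /incr subrr mulr0.
  exact: mean_cst.
have mE := filtration_measurable hB FE.
apply/eqP; rewrite -normr_le0; apply/ler_addgt0Pr => e e0; rewrite add0r.
pose h := e / 66; have h0 : 0 < h by rewrite divr_gt0.
(* with s' - s <= h^2 the mean of |B s' - B s| is at most h + 65 h *)
pose s' := s + Num.min ((t - s) / 2) (h ^+ 2).
have m0 : 0 < Num.min ((t - s) / 2) (h ^+ 2).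
  by rewrite lt_min exprn_gt0// andbT divr_gt0// subr_gt0.
have [m1 m2] : Num.min ((t - s) / 2) (h ^+ 2) <= (t - s) / 2 /\
     Num.min ((t - s) / 2) (h ^+ 2) <= h ^+ 2 by rewrite !ge_min !lexx orbT.
have ss' : s < s' by rewrite /s'; lra.
have s't : s' < t by rewrite /s'; lra.
have s'0 : 0 <= s' by apply: le_trans (ltW ss').
have -> : (fun w => \1_E w * dB s t w) = (fun w => \1_E w * dB s s' w + \1_E w * dB s' t w).
  by apply/funext => w; rewrite /incr; lra.
have i1 := integ_indicM mE (integ_incr s0 (ltW ss')).
have i2 := integ_indicM mE (integ_incr s'0 (ltW s't)).
rewrite meanD// (past_centred s'0 s't (filtration_past ss' FE)) addr0.
apply: le_trans (mean_norm i1) _.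
apply: (@le_trans _ _ (mean (fun w => `|dB s s' w|))).
  apply: mean_le => [||w].
  - exact: integ_norm.
  - by apply: integ_norm; exact: integ_incr (ltW ss').
  - by rewrite normrM ler_piMl// indic_le1.
apply: le_trans (mean_abs_incr s0 (ltW ss') h0) _.
have : 65 * (s' - s) / h <= 65 * h.
  rewrite ler_pdivrMr// -mulrA -expr2 ler_pM2l//; rewrite /s'; lra.
by have : e = 66 * h; rewrite /h; lra.
Qed.

(** Given E, the increment exceeds half its standard deviation with
    probability at least one half. *)
Lemma past_second_moment s t E : 0 <= s -> s < t -> <<s past P B s >> E ->
  fine (P E) * (t - s) / 8 <= mean (fun w => \1_E w * dB s t w ^+ 2).
Proof.
move=> s0 st cE; have t0 : 0 <= t by apply: le_trans (ltW st).
have mE := past_measurable hB cE.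
have st0 : 0 < t - s by rewrite subr_gt0.
pose sg := Num.sqrt (t - s); have sg0 : 0 < sg by rewrite sqrtr_gt0.
pose V := [set x : R | `|x| < sg / 2].
have mV : measurable V.
  rewrite (_ : V = `]- (sg / 2), sg / 2[%classic)//.
  by apply/seteqP; split => x; rewrite /V /= in_itv/= ltr_norml.
pose A := E `&` dB s t @^-1` (~` V).
have mA : measurable A by apply: measurableI => //; apply: (incr_event hB) => //; exact: measurableC.
have PA : fine (P E) / 2 <= fine (P A).
  rewrite (past_indep hB)// ?(ltW st)//; last exact: measurableC.
  rewrite fineM ?fin_num_measure//; last by apply: (incr_event hB) => //; exact: measurableC.
  rewrite ler_wpM2l ?fine_ge0//.
  rewrite incr_law//; last exact: measurableC.
  have NV : normal_prob 0 sg V = (fine (normal_prob 0 sg V))%:E.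
    by rewrite fineK// fin_num_measure.
  have hC : normal_prob 0 sg (~` V) = (1 - fine (normal_prob 0 sg V))%:E.
    by rewrite EFinB -NV; exact: probability_setC.
  have := normal_center_le sg0; rewrite -/V NV lee_fin => h.
  by rewrite -/sg hC /=; lra.
have i2 := integ_incr2 s0 (ltW st).
apply: (@le_trans _ _ (mean (fun w => (t - s) / 4 * \1_A w))).
  rewrite meanZ ?mean_indic//; last first.
    by apply: (@integ_bounded _ _ _ _ _ 1); [exact: indic_measurable|exact: indic_le1].
  have := ler_wpM2l (ltW st0) PA; lra.
apply: mean_le => [||w].
- by apply: integZ; apply: (@integ_bounded _ _ _ _ _ 1); [exact: indic_measurable|exact: indic_le1].
- exact: integ_indicM.
rewrite !indicE; have [Aw|Aw] := pselect (A w); last first.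
  by rewrite (memNset Aw) mulr0 mulr_ge0// sqr_ge0.
have [Ew nV] := Aw; rewrite !mem_set// mulr1 mul1r.
have : (sg / 2) ^+ 2 <= `|dB s t w| ^+ 2.
  rewrite ler_pXn2r ?nnegrE ?divr_ge0 ?(ltW sg0)//.
  by rewrite leNgt; apply/negP.
by rewrite real_normK ?num_real// expr_div_n sqr_sqrtr ?(ltW st0)//; lra.
Qed.

(** The passage from s' > s to s uses (x + y)^2 >= y^2 / 2 - x^2, which halves
    the constant. *)
Lemma filtration_second_moment s t E : 0 <= s -> s < t -> F s E ->
  fine (P E) * (t - s) / 16 <= mean (fun w => \1_E w * dB s t w ^+ 2).
Proof.
move=> s0 st FE; have mE := filtration_measurable hB FE.
apply/ler_addgt0Pr => e e0.
pose h := Num.min ((t - s) / 2) (e / 66).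
have h0 : 0 < h by rewrite lt_min !divr_gt0// subr_gt0.
have [m1 m2] : h <= (t - s) / 2 /\ h <= e / 66 by rewrite !ge_min !lexx orbT.
pose s' := s + h.
have ss' : s < s' by rewrite /s'; lra.
have s't : s' < t by rewrite /s'; lra.
have s'0 : 0 <= s' by apply: le_trans (ltW ss').
have i1 := integ_incr2 s0 (ltW ss').
have i2 := integ_indicM mE (integ_incr2 s'0 (ltW s't)).
have i3 := integ_indicM mE (integ_incr2 s0 (ltW st)).
have := past_second_moment s'0 s't (filtration_past ss' FE).
have := mean_incr2 s0 (ltW ss').
have : mean (fun w => 2^-1 * (\1_E w * dB s' t w ^+ 2)) <=
  mean (fun w => \1_E w * dB s t w ^+ 2 + dB s s' w ^+ 2).
  apply: mean_le => [||w]; [exact: integZ|exact: integD|].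
  have -> : dB s t w = dB s s' w + dB s' t w by rewrite /incr; lra.
  move: (dB s s' w) (dB s' t w) => x y.
  rewrite indicE; case: (w \in E); rewrite ?mul1r ?mul0r ?mulr0 ?add0r ?sqr_ge0//.
  have := sqr_ge0 (2 * x + y); lra.
rewrite meanZ// meanD//.
have p0 : 0 <= fine (P E) by rewrite fine_ge0.
have p1 : fine (P E) <= 1.
  by rewrite -lee_fin fineK ?fin_num_measure// probability_le1.
have hp : fine (P E) * (s' - s) <= s' - s by rewrite ler_piMl// subr_ge0 ltW.
have : s' - s <= e / 66 by rewrite /s'; lra.
have : fine (P E) * (t - s) = fine (P E) * (t - s') + fine (P E) * (s' - s) by ring.
move: hp; set m := mean _; set m' := mean _; set m'' := mean _.
lra.
Qed.

End Moments.

(** * Bounded weights *)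

Section Orthogonality.
Context {R : realType} {d : measure_display} {T : measurableType d}.
Variable P : probability T R.
Local Notation mean := (mean P).
Local Notation integ := (integ P).

(** The sum counts the integers in [1, m] that are at most x. *)
Lemma count_levels (x : R) (m : nat) : 0 <= x ->
  let S := \sum_(j < m) (j.+1%:R <= x)%R%:R in
  (m%:R <= x -> S = m%:R :> R) /\ (x < m%:R -> x - 1 < S <= x).
Proof.
move=> x0 /=; elim: m => [|m [IH1 IH2]].
  by rewrite big_ord0; split => // x0'; lra.
rewrite big_ord_recr /=; split => h.
  by rewrite IH1 ?h -?natr1//; move: h; rewrite -natr1; lra.
rewrite leNgt h /= addr0; have [mx|xm] := leP m%:R x; last exact: IH2.
by rewrite IH1//; move: h; rewrite -natr1; lra.
Qed.

(** f is a uniform limit of combinations of indicators of its upper level sets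
    {a <= f}, and X is orthogonal to these. *)
Lemma orthogonal_bounded (F0 : set (set T)) (X f : T -> R) (k : R) :
  integ X -> (forall E, F0 E -> measurable E) ->
  (forall E, F0 E -> mean (fun w => \1_E w * X w) = 0) ->
  measurable_fun setT f -> (forall a, F0 [set w | a <= f w]) ->
  (forall w, `|f w| <= k) -> mean (fun w => f w * X w) = 0.
Proof.
move=> Xi F0m orth mf Ff fk.
have k0 : 0 <= k by apply: le_trans (fk point).
have F0T : F0 setT.
  rewrite (_ : setT = [set w | - k <= f w]) //; apply/seteqP; split => // w _ /=.
  by have := fk w; rewrite ler_norml => /andP[].
have mX0 : mean X = 0.
  rewrite -(orth _ F0T); congr (Rintegral _ _ _).
  by apply/funext => w; rewrite indicT mul1r.
have fXi : integ (fun w => f w * X w) by exact: integM fk Xi.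
apply/eqP; rewrite -normr_le0; apply/ler_addgt0Pr => e e0; rewrite add0r.
pose M := mean (fun w => `|X w|).
have M0 : 0 <= M by exact: mean_ge0.
pose K := k + 1; have K0 : 0 < K by rewrite /K; lra.
pose n := (Num.truncn (K * M / e)).+1.
have n0 : 0 < n%:R :> R by rewrite ltr0n.
have nK : K * M <= e * n%:R.
  by rewrite [leRHS]mulrC -ler_pdivrMr//; apply: ltW; exact: truncnS_gt.
pose lev (j : nat) := - K + j.+1%:R * (K / n%:R).
pose g w := - K + \sum_(j < (2 * n)%N) (K / n%:R) * \1_[set w | lev j <= f w] w.
have gX : mean (fun w => g w * X w) = 0.
  have -> : (fun w => g w * X w) = (fun w => - K * X w +
      \sum_(j < (2 * n)%N) (K / n%:R) * (\1_[set w | lev j <= f w] w * X w)).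
    apply/funext => w; rewrite /g mulrDl mulr_suml; congr (_ + _).
    by apply: eq_bigr => j _; rewrite mulrA.
  have i1 (j : nat) : integ (fun w => \1_[set w | lev j <= f w] w * X w).
    apply: (@integM _ _ _ _ _ _ 1) => // [|w]; last exact: indic_le1.
    by apply: indic_measurable; exact: F0m.
  have i2 (j : nat) := integZ (K / n%:R) (i1 j).
  rewrite meanD; [|exact: integZ|by apply: integ_sum => j; exact: i2].
  rewrite meanZ// mX0 mulr0 add0r mean_sum; last by move=> j; exact: i2.
  by rewrite big1// => j _; rewrite meanZ// orth// mulr0.
have fg w : `|f w - g w| <= K / n%:R.
  pose x := (f w + K) * (n%:R / K).
  have /andP[f1 f2] : - k <= f w <= k by rewrite -ler_norml.
  have nK0 : 0 < n%:R / K by rewrite divr_gt0.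
  have x0 : 0 <= x by rewrite mulr_ge0 ?(ltW nK0)// /K; lra.
  have x2 : x < (2 * n)%:R.
    rewrite natrM /x mulrA ltr_pdivrMr// mulrAC ltr_pM2r//; rewrite /K; lra.
  have [_ /(_ x2)] := count_levels (2 * n) x0.
  set S := \sum_(j < _) _ => hS.
  have gS : g w = - K + (K / n%:R) * S.
    rewrite /g -mulr_sumr; congr (_ + _ * _); apply: eq_bigr => j _.
    rewrite indicE; congr ((nat_of_bool _)%:R); apply/idP/idP.
      rewrite inE /= /lev /x => h.
      rewrite -ler_pdivrMr// invf_div; lra.
    move=> h; rewrite inE /= /lev; move: h; rewrite /x -ler_pdivrMr// invf_div; lra.
  have xE : K / n%:R * x = f w + K by rewrite /x; field; rewrite !gt_eqF.
  have Kn : 0 < K / n%:R by rewrite divr_gt0.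
  have -> : f w - g w = K / n%:R * (x - S) by rewrite gS mulrBr xE; ring.
  rewrite normrM gtr0_norm// ler_piMr ?(ltW Kn)// ler_norml; lra.
have mg : measurable_fun setT g.
  apply: measurable_funD => //; apply: measurable_sum => j.
  by apply: measurable_funM => //; apply: indic_measurable; exact: F0m.
have gi : integ (fun w => (f w - g w) * X w).
  by apply: (integM _ fg) => //; exact: measurable_funB.
have gXi : integ (fun w => g w * X w).
  have -> : (fun w => g w * X w) = (fun w => f w * X w - (f w - g w) * X w).
    by apply/funext => w; ring.
  exact: integB.
have -> : mean (fun w => f w * X w) = mean (fun w => (f w - g w) * X w).
  rewrite -[RHS]addr0 -gX -meanD//; congr (Rintegral _ _ _).
  by apply/funext => w; ring.
apply: le_trans (mean_norm gi) _.
apply: (@le_trans _ _ (mean (fun w => K / n%:R * `|X w|))).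
  apply: mean_le => [||w]; [exact: integ_norm|by apply: integZ; exact: integ_norm|].
  by rewrite normrM ler_wpM2r.
rewrite meanZ; last exact: integ_norm.
by rewrite -/M mulrAC ler_pdivrMr.
Qed.

End Orthogonality.

(** * Bounded weights against a semimartingale *)

Section SubSigmaAlgebra.
Context {R : realType} {T : pointedType}.
Implicit Types (f g : T -> R).

(** Measurability with respect to a sigma-algebra that is not the canonical
    one of the type; [meas_wrtP] transfers the stability properties. *)
Definition meas_wrt (F0 : set (set T)) f := forall U : set R, measurable U -> F0 (f @^-1` U).

Definition funs_of (F0 : set (set T)) : set (g_sigma_algebraType F0) := setT.

Lemma meas_wrtP F0 f : sigma_algebra setT F0 ->
  meas_wrt F0 f <-> measurable_fun (@funs_of F0) f.
Proof.
move=> sF0; split => [h _ U mU|h U mU].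
  by rewrite setTI; apply: sub_sigma_algebra; exact: h.
have := h measurableT U mU; rewrite setTI => m.
exact: (smallest_sub sF0 _ m).
Qed.

End SubSigmaAlgebra.

Section SemimartingaleBound.
Context {R : realType} {d : measure_display} {T : measurableType d}.
Variable P : probability T R.
Local Notation mean := (mean P).
Local Notation integ := (integ P).
Variable F : R -> set (set T).
Hypothesis HFs : forall t, sigma_algebra setT (F t).
Hypothesis HFm : forall t E, F t E -> measurable E.
Hypothesis HFmono : forall s t, s <= t -> F s `<=` F t.

Lemma meas_wrt_measurable t (f : T -> R) : meas_wrt (F t) f -> measurable_fun setT f.
Proof. by move=> h _ U mU; rewrite setTI; apply: HFm (h U mU). Qed.

Lemma adapted_le (X : R -> T -> R) s t : adapted F X -> 0 <= s -> s <= t -> meas_wrt (F t) (X s).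
Proof. by move=> aX s0 st U mU; apply: (HFmono st); exact: aX. Qed.

Lemma filtration_setI t E D : F t E -> F t D -> F t (E `&` D).
Proof.
move=> FE FD; have := HFs t => sF.
have : <<s F t >> (E `&` D).
  by apply: (@measurableI _ (g_sigma_algebraType (F t))); exact: sub_sigma_algebra.
exact: smallest_sub.
Qed.

Lemma filtration_setC t E : F t E -> F t (~` E).
Proof. by move=> FE; have [_ h _] := HFs t; rewrite -setTD; exact: h. Qed.

Lemma meas_wrt_indic t E : F t E -> meas_wrt (F t) (\1_E : T -> R).
Proof.
move=> FE; apply/meas_wrtP => //; apply: measurable_indic.
exact: sub_sigma_algebra.
Qed.

Lemma meas_wrtM t (f g : T -> R) : meas_wrt (F t) f -> meas_wrt (F t) g ->
  meas_wrt (F t) (fun w => f w * g w).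
Proof.
move=> /(meas_wrtP _ (HFs t)) mf /(meas_wrtP _ (HFs t)) mg.
by apply/meas_wrtP => //; exact: measurable_funM.
Qed.

Lemma meas_wrt_ge t (f : T -> R) a : meas_wrt (F t) f -> F t [set w | a <= f w].
Proof.
move=> mf; have -> : [set w | a <= f w] = f @^-1` `[a, +oo[%classic.
  by apply/seteqP; split => w /=; rewrite in_itv/= andbT.
by apply: mf; exact: measurable_itv.
Qed.

Lemma martingale_mean M s t E : martingale P F M -> 0 <= s -> s <= t -> F s E ->
  mean (fun w => \1_E w * M t w) = mean (fun w => \1_E w * M s w).
Proof.
move=> [_ _ h] s0 st FE; rewrite !mean_indicM; try exact: HFm FE.
by rewrite /Rintegral (h s t E).
Qed.

(** The submartingale property of |M|, by splitting E according to the sign of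
    M s. *)
Lemma martingale_abs M s t E : martingale P F M -> 0 <= s -> s <= t -> F s E ->
  mean (fun w => \1_E w * `|M s w|) <= mean (fun w => \1_E w * `|M t w|).
Proof.
move=> mM s0 st FE; have [aM iM _] := mM; have t0 := le_trans s0 st.
pose Q := [set w | 0 <= M s w].
have FQ : F s Q by apply: meas_wrt_ge; exact: adapted_le.
pose E1 := E `&` Q; pose E2 := E `&` ~` Q.
have F1 : F s E1 by exact: filtration_setI.
have F2 : F s E2 by apply: filtration_setI => //; exact: filtration_setC.
have i1 := integ_indicM (HFm F1) (iM s s0); have i2 := integ_indicM (HFm F2) (iM s s0).
have j1 := integ_indicM (HFm F1) (iM t t0); have j2 := integ_indicM (HFm F2) (iM t t0).
have -> : (fun w => \1_E w * `|M s w|) = (fun w => \1_E1 w * M s w - \1_E2 w * M s w).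
  apply/funext => w; rewrite !indicE.
  have [Ew|Ew] := pselect (E w); last first.
    by rewrite !memNset ?mul0r ?subr0// => -[].
  have [Qw|Qw] := pselect (Q w).
    have w2 : ~ E2 w by move=> [_]; apply.
    by rewrite (mem_set Ew) (@mem_set _ E1 w)// (memNset w2) ger0_norm// !mul1r mul0r subr0.
  have w1 : ~ E1 w by move=> [].
  rewrite (mem_set Ew) (memNset w1) (@mem_set _ E2 w)// ler0_norm ?mul1r ?mul0r ?sub0r//.
  by apply: ltW; rewrite ltNge; apply/negP.
rewrite meanB// -(martingale_mean mM s0 st F1) -(martingale_mean mM s0 st F2) -meanB//.
apply: mean_le => [||w]; first exact: integB.
  by apply: integ_indicM; [exact: HFm FE|apply: integ_norm; exact: iM].
rewrite !indicE.
have [Ew|Ew] := pselect (E w); last first.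
  by rewrite !memNset ?mul0r ?subr0// => -[].
have := ler_norm (M t w); have := ler_norm (- M t w); rewrite normrN.
have [Qw|Qw] := pselect (Q w).
  have w2 : ~ E2 w by move=> [_]; apply.
  by rewrite (mem_set Ew) (@mem_set _ E1 w)// (memNset w2) !mul1r mul0r subr0.
have w1 : ~ E1 w by move=> [].
by rewrite (mem_set Ew) (memNset w1) (@mem_set _ E2 w)// ?mul1r ?mul0r ?sub0r.
Qed.

Variables (Y M A : R -> T -> R) (tau : T -> \bar R) (tt : nat -> R) (H : nat -> T -> R).
Hypothesis aY : adapted F Y.
Hypothesis aA : adapted F A.
Hypothesis A0 : forall w, A 0 w = 0.
Hypothesis mM : martingale P F M.
Hypothesis Ftau : forall t, 0 <= t -> F t [set w | (t%:E < tau w)%E].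
Hypothesis decomp : {ae P, forall w, forall t, 0 <= t -> (t%:E < tau w)%E ->
  Y t w = Y 0 w + M t w + A t w}.
Hypothesis tt0 : tt 0%N = 0.
Hypothesis ttnd : nondecreasing_seq tt.
Hypothesis mH : forall i, meas_wrt (F (tt i)) (H i).
Hypothesis H1 : forall i w, `|H i w| <= 1.

Definition grid_var (i : nat) (w : T) : R := \sum_(j < i) `|A (tt j.+1) w - A (tt j) w|.

(** The event that the weights are still switched on at the i-th time. *)
Definition good (K : R) (i : nat) : set T :=
  [set w | ((tt i)%:E < tau w)%E /\ grid_var i w <= K].

Let t_ge0 i : 0 <= tt i.
Proof. by rewrite -tt0; exact: ttnd. Qed.

Let tS i : tt i <= tt i.+1.
Proof. exact: ttnd. Qed.

Lemma grid_varS i w : grid_var i.+1 w = grid_var i w + `|A (tt i.+1) w - A (tt i) w|.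
Proof. by rewrite /grid_var big_ord_recr. Qed.

Lemma good_decr K i : good K i.+1 `<=` good K i.
Proof.
move=> w [h1 h2]; split; first by apply: le_lt_trans h1; rewrite lee_fin.
by apply: le_trans h2; rewrite grid_varS lerDl.
Qed.

Lemma good_F K i : F (tt i) (good K i).
Proof.
apply: (@filtration_setI _ [set w | ((tt i)%:E < tau w)%E] [set w | grid_var i w <= K]).
  exact: Ftau.
have -> : [set w | grid_var i w <= K] = grid_var i @^-1` `]-oo, K]%classic.
  by apply/seteqP; split => w /=; rewrite in_itv.
suff : meas_wrt (F (tt i)) (grid_var i) by apply; exact: measurable_itv.
apply/meas_wrtP => //; apply: measurable_sum => j.
apply: measurableT_comp => //; apply: measurable_funB.
  by apply/meas_wrtP => //; apply: adapted_le => //; apply: ttnd; case: j.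
by apply/meas_wrtP => //; apply: adapted_le => //; apply: ttnd; apply: ltnW; case: j.
Qed.

Lemma abs_A_le i w : `|A (tt i) w| <= grid_var i w.
Proof.
elim: i => [|i IH]; first by rewrite tt0 A0 normr0 /grid_var big_ord0.
rewrite grid_varS; apply: le_trans (_ : `|A (tt i) w| + `|A (tt i.+1) w - A (tt i) w| <= _).
  by have := ler_normD (A (tt i) w) (A (tt i.+1) w - A (tt i) w); rewrite addrC subrK.
by rewrite lerD2r.
Qed.

Definition weight K i w := \1_(good K i) w * H i w.
(** The part of the weighted increments of Y that does not come from the
    martingale. *)
Definition defect K i w := weight K i w * ((Y (tt i.+1) w - Y (tt i) w) - (M (tt i.+1) w - M (tt i) w)).
(** This is nonzero only for the step during which the weights get switched
    off; there the martingale increment is not comparable with that of A. *)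
Definition overshoot K i w := \1_(good K i `\` good K i.+1) w * `|M (tt i.+1) w|.

Lemma weight_le1 K i w : `|weight K i w| <= 1.
Proof. by rewrite normrM mulr_ile1// indic_le1. Qed.

(** While the weights stay on, the defect is an increment of A, and these add
    up to at most K.  In the step where they are switched off, the increment
    of Y is at most 2 C and the value of the martingale before the step is
    at most 2 C + K, because it equals Y - Y 0 - A. *)
Lemma defect_sum_le K C n : 0 <= K -> (forall t w, 0 <= t -> `|Y t w| <= C) ->
  {ae P, forall w,
  \sum_(i < n) `|defect K i w| <= 2 * K + 4 * C + \sum_(i < n) overshoot K i w}.
Proof.
move=> K0 Ybound; move: decomp; apply: filterS => w dec.
have C0 : 0 <= C by apply: le_trans (Ybound 0 w (lexx 0)).
suff key : \sum_(i < n) `|defect K i w| <=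
    (if w \in good K n then grid_var n w else 2 * K + 4 * C) + \sum_(i < n) overshoot K i w.
  apply: le_trans key _; rewrite lerD2r; case: ifPn => [|_]; last by [].
  by rewrite inE => -[_ h]; lra.
have o0 i : 0 <= overshoot K i w by rewrite /overshoot indicE mulr_ge0.
elim: n => [|n IH].
  rewrite !big_ord0 addr0; case: ifP => _; last lra.
  by rewrite /grid_var big_ord0.
rewrite !big_ord_recr /=; have [gn|gn] := pselect (good K n w); last first.
  have gn1 : ~ good K n.+1 w by move=> /good_decr.
  move: IH; rewrite (memNset gn) (memNset gn1) => IH.
  by rewrite {2}/defect /weight indicE (memNset gn) !mul0r normr0 addr0 addrA;
     apply: le_trans IH _; rewrite lerDl.
move: IH; rewrite (mem_set gn) => IH.
have [tn Vn] := gn; have dn := dec _ (t_ge0 n) tn.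
have Hn := H1 n w.
have dE : defect K n w = H n w * ((Y (tt n.+1) w - Y (tt n) w) - (M (tt n.+1) w - M (tt n) w)).
  by rewrite /defect /weight indicE (mem_set gn) mul1r.
have [gn1|gn1] := pselect (good K n.+1 w).
  have [tn1 _] := gn1; have dn1 := dec _ (t_ge0 n.+1) tn1.
  rewrite (mem_set gn1) grid_varS.
  have : `|defect K n w| <= `|A (tt n.+1) w - A (tt n) w|.
    rewrite dE normrM; apply: le_trans (ler_piMl _ Hn) _ => //.
    by rewrite dn dn1 le_eqVlt; apply/orP; left; apply/eqP; congr (`|_|); ring.
  have := o0 n; lra.
rewrite (memNset gn1).
have -> : overshoot K n w = `|M (tt n.+1) w|.
  by rewrite /overshoot indicE mem_set ?mul1r.
have : `|defect K n w| <= 4 * C + K + `|M (tt n.+1) w|.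
  rewrite dE normrM; apply: le_trans (ler_piMl _ Hn) _ => //.
  have hA := le_trans (abs_A_le n w) Vn.
  have y0 := Ybound 0 w (lexx 0); have y1 := Ybound _ w (t_ge0 n); have y2 := Ybound _ w (t_ge0 n.+1).
  have -> : Y (tt n.+1) w - Y (tt n) w - (M (tt n.+1) w - M (tt n) w) =
     (Y (tt n.+1) w - Y 0 w - A (tt n) w) - M (tt n.+1) w by rewrite dn; ring.
  apply: le_trans (ler_normB _ _) _; rewrite lerD2r.
  move: hA y0 y1 y2; rewrite !ler_norml; lra.
move: IH; lra.
Qed.

(** The martingale part has mean zero.  The overshoots are absolute values of M
    at a random grid time, so their mean is at most that of |M| at the last
    time. *)
Theorem semimartingale_bound K C n : 0 <= K ->
  (forall t w, 0 <= t -> `|Y t w| <= C) ->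
  `|mean (fun w => \sum_(i < n) weight K i w * (Y (tt i.+1) w - Y (tt i) w))| <=
  2 * K + 4 * C + mean (fun w => `|M (tt n) w|).
Proof.
move=> K0 Ybound; have [aM iM _] := mM.
have mY t : 0 <= t -> measurable_fun setT (Y t).
  by move=> t0; apply: (@meas_wrt_measurable t); exact: adapted_le.
have iY t : 0 <= t -> integ (Y t).
  by move=> t0; apply: (integ_bounded _ (mY t t0)) => w; exact: Ybound.
have Fw i : meas_wrt (F (tt i)) (weight K i).
  by apply: meas_wrtM => //; apply: meas_wrt_indic; exact: good_F.
have mw i : measurable_fun setT (weight K i) := meas_wrt_measurable (Fw i).
have idM i : integ (fun w => M (tt i.+1) w - M (tt i) w).
  by apply: integB; apply: iM; exact: t_ge0.
have idY i : integ (fun w => Y (tt i.+1) w - Y (tt i) w).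
  by apply: integB; apply: iY; exact: t_ge0.
have iwM i := integM (mw i) (@weight_le1 K i) (idM i).
have iwY i := integM (mw i) (@weight_le1 K i) (idY i).
have idef i : integ (defect K i).
  by apply: (integM (mw i) (@weight_le1 K i)); apply: integB.
have wM0 i : mean (fun w => weight K i w * (M (tt i.+1) w - M (tt i) w)) = 0.
  apply: (orthogonal_bounded (idM i) (HFm (t := tt i)) _ (mw i) _ (@weight_le1 K i)).
    move=> E FE; under [X in mean X]eq_fun do rewrite mulrBr.
    have i1 := integ_indicM (HFm FE) (iM _ (t_ge0 i)).
    have i2 := integ_indicM (HFm FE) (iM _ (t_ge0 i.+1)).
    by rewrite meanB// (martingale_mean mM (t_ge0 i) (tS i) FE) subrr.
  by move=> a; exact: meas_wrt_ge.
have Fog i : F (tt i.+1) (good K i `\` good K i.+1).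
  rewrite setDE; apply: filtration_setI; first by apply: (HFmono (tS i)); exact: good_F.
  by apply: filtration_setC; exact: good_F.
have iov i : integ (overshoot K i).
  apply: integ_indicM; first exact: HFm (Fog i).
  by apply: integ_norm; apply: iM; exact: t_ge0.
have -> : mean (fun w => \sum_(i < n) weight K i w * (Y (tt i.+1) w - Y (tt i) w)) =
    mean (fun w => \sum_(i < n) defect K i w).
  rewrite !mean_sum//; apply: eq_bigr => i _.
  rewrite -[LHS]subr0 -(wM0 i) -meanB//; congr (Rintegral _ _ _).
  by apply/funext => w; rewrite /defect; ring.
apply: le_trans (mean_norm (integ_sum _ _)) _ => //.
apply: (@le_trans _ _ (mean (fun w => 2 * K + 4 * C + \sum_(i < n) overshoot K i w))).
  apply: mean_ae_le.
  - by apply: integ_norm; exact: integ_sum.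
  - by apply: integD; [exact: integ_cst|exact: integ_sum].
  - move: (defect_sum_le n K0 Ybound); apply: filterS => w; apply: le_trans.
    exact: ler_norm_sum.
rewrite meanD; [|exact: integ_cst|exact: integ_sum].
rewrite mean_cst lerD2l mean_sum//.
apply: (@le_trans _ _ (\sum_(i < n) mean (fun w => \1_(good K i `\` good K i.+1) w * `|M (tt n) w|))).
  apply: ler_sum => i _; apply: (martingale_abs mM (t_ge0 i.+1) _ (Fog i)).
  by apply: ttnd; exact: ltn_ord.
have iMn := integ_norm (iM _ (t_ge0 n)).
have iind i := integ_indicM (HFm (Fog i)) iMn.
rewrite -mean_sum//; apply: mean_le => //; first exact: integ_sum.
move=> w; rewrite -mulr_suml ler_piMl//.
suff : \sum_(i < n) \1_(good K i `\` good K i.+1) w <= 1 - \1_(good K n) w :> R.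
  by rewrite indicE; case: (_ \in _) => /=; lra.
elim: (n) => [|m IH].
  by rewrite big_ord0 indicE; case: (_ \in _) => /=; lra.
rewrite big_ord_recr /=; move: IH; rewrite !indicE.
have [gm|gm] := pselect (good K m w); have [gm1|gm1] := pselect (good K m.+1 w).
- rewrite (mem_set gm) (mem_set gm1) memNset; last by move=> [].
  by rewrite /=; lra.
- by rewrite (mem_set gm) (memNset gm1) mem_set//=; lra.
- by have := good_decr gm1.
- rewrite (memNset gm) (memNset gm1) memNset; last by move=> [].
  by rewrite /=; lra.
Qed.

End SemimartingaleBound.

(** * Adaptedness and expected variation of the skeleton of Brownian motion *)

Section BrownianSkeleton.
Context {R : realType} {d : measure_display} {T : measurableType d}.
Variables (P : probability T R) (B : R -> T -> R).
Hypothesis hB : standard_brownian_motion P B.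
Implicit Types (s t u c h : R) (E : set T).
Local Notation mean := (mean P).
Local Notation integ := (integ P).
Local Notation dB := (incr B).
Local Notation F := (usual_filtration P B).

Lemma bm_path w : cont_from 0 (fun u => B u w).
Proof. by have [_ _ _ _ h] := hB; apply: continuous_cont_from; exact: h. Qed.

Lemma usual_sigma t : sigma_algebra setT (F t).
Proof.
split.
- by move=> s _; have [] := smallest_sigma_algebra setT (past P B s).
- move=> A FA s st; have [_ h _] := smallest_sigma_algebra setT (past P B s).
  by apply: h; exact: FA.
- move=> A FA s st; have [_ _ h] := smallest_sigma_algebra setT (past P B s).
  by apply: h => n; exact: FA.
Qed.

Lemma usual_mono s t : s <= t -> F s `<=` F t.
Proof. by move=> st E FE r /= tr; apply: FE => /=; exact: le_lt_trans tr. Qed.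

Lemma own_past_usual t E : <<s past_events B t >> E -> F t E.
Proof.
move=> cE s /= ts; apply: (smallest_sub _ _ cE); first exact: smallest_sigma_algebra.
move=> A [u [U [u0 ut mU ->]]]; apply: sub_sigma_algebra; left.
by exists u, U; split => //; apply: le_trans (ltW ts).
Qed.

(** Most processes here depend on the path up to time t only, without null
    events. *)
Lemma own_past_meas t (f : T -> R) : measurable_fun (@funs_of T (past_events B t)) f ->
  meas_wrt (F t) f.
Proof.
move=> mf U mU; apply: own_past_usual.
by have := mf measurableT U mU; rewrite setTI.
Qed.

Lemma bm_own_past u t : 0 <= u -> u <= t ->
  measurable_fun (@funs_of T (past_events B t)) (B u).
Proof.
move=> u0 ut _ U mU; rewrite setTI; apply: sub_sigma_algebra.
by exists u, U.
Qed.

Lemma play_own_past c h t i : 0 <= h -> i%:R * h <= t ->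
  measurable_fun (@funs_of T (past_events B t)) (fun w => play c (fun j => B (j%:R * h) w) i).
Proof.
move=> h0; elim: i => [|i IH] it.
  by apply: bm_own_past; rewrite mul0r// -(mul0r h).
have it' : i%:R * h <= t.
  by apply: le_trans it; rewrite ler_wpM2r// ler_nat.
have mBi : measurable_fun (@funs_of T (past_events B t)) (B (i.+1%:R * h)).
  by apply: bm_own_past => //; rewrite mulr_ge0.
apply: measurable_maxr; first exact: measurable_funB.
by apply: measurable_minr; [exact: measurable_funD|exact: IH].
Qed.

Definition skel c t (w : T) : R := skeleton (fun u => B u w) c t.

(** The skeleton at time t is a limit of plays sampled on grids of [0, t]. *)
Lemma skel_own_past c t : 0 < c -> 0 <= t ->
  measurable_fun (@funs_of T (past_events B t)) (skel c t).
Proof.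
move=> c0 t0.
pose hh (m : nat) := t / m.+1%:R.
have hh0 m : 0 <= hh m by rewrite divr_ge0.
have hht m : m.+1%:R * hh m = t by rewrite mulrC divfK.
apply: (@measurable_fun_cvg _ (g_sigma_algebraType (past_events B t)) R _ (fun m w => play c (fun j => B (j%:R * hh m) w) m.+1)).
  by move=> m; apply: play_own_past => //; rewrite hht.
move=> w _; apply/cvgrPdist_le => e e0.
have [dl dl0 Hd] := play_skeleton_cvg t (bm_path w) c0 e0.
have t1 : 0 < t + 1 by lra.
have := near_infty_natSinv_lt (PosNum (divr_gt0 dl0 t1)); apply: filterS => m mdl.
have {}mdl : m.+1%:R^-1 < dl / (t + 1) := mdl.
have := Hd (hh m) m.+1 (hh0 m); rewrite hht; apply => //.
rewrite /hh; apply: (@le_lt_trans _ _ ((t + 1) / m.+1%:R)).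
  by rewrite ler_pM2r ?invr_gt0//; lra.
by rewrite mulrC -ltr_pdivlMr.
Qed.

Lemma skel_meas c t : 0 < c -> 0 <= t -> meas_wrt (F t) (skel c t).
Proof. by move=> c0 t0; apply: own_past_meas; exact: skel_own_past. Qed.

Lemma bm_meas t : 0 <= t -> meas_wrt (F t) (B t).
Proof. by move=> t0; apply: own_past_meas; exact: bm_own_past. Qed.

Lemma gap_own_past k t : 0 <= t ->
  measurable_fun (@funs_of T (past_events B t)) (gap B k t).
Proof.
move=> t0; apply: measurable_funB; first exact: bm_own_past.
by apply: skel_own_past => //; exact: gamma_gt0.
Qed.

Lemma gap_meas k t : 0 <= t -> meas_wrt (F t) (gap B k t).
Proof. by move=> t0; apply: own_past_meas; exact: gap_own_past. Qed.

Lemma Y_adapted : adapted F (Y_process B).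
Proof.
move=> t U t0; apply: own_past_meas.
apply: (@measurable_fun_cvg _ (g_sigma_algebraType (past_events B t)) R _ (fun n => partial_Y B n t)); last first.
  by move=> w _; exact: partial_Y_cvg bm_path _ _ _.
move=> n; apply: measurable_sum => k; apply: measurable_funM => //.
exact: gap_own_past.
Qed.

Lemma filtration_orth s t (f : T -> R) k : 0 <= s -> s <= t -> meas_wrt (F s) f ->
  (forall w, `|f w| <= k) -> mean (fun w => f w * dB s t w) = 0.
Proof.
move=> s0 st mf fk.
apply: (orthogonal_bounded (integ_incr hB s0 st) (F0 := F s) _ _ _ _ fk).
- by move=> E; exact: filtration_measurable.
- by move=> E FE; exact: filtration_centred.
- by apply: (@meas_wrt_measurable _ _ _ F) mf => r E; exact: (filtration_measurable hB).
- by move=> a; exact: (meas_wrt_ge _ mf).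
Qed.

Lemma skel_measurable c t : 0 < c -> 0 <= t -> measurable_fun setT (skel c t).
Proof.
move=> c0 t0; apply: (@meas_wrt_measurable _ _ _ F) (skel_meas c0 t0) => r E.
exact: (filtration_measurable hB).
Qed.

Lemma skel_incr_le c s t w : 0 < c -> 0 <= s -> 0 <= t ->
  `|skel c t w - skel c s w| <= `|dB s t w| + 2 * c.
Proof.
move=> c0 s0 t0; have hs := skeleton_near (bm_path w) c0 s0.
have ht := skeleton_near (bm_path w) c0 t0.
have h1 := ler_norm (dB s t w); have h2 := ler_norm (- dB s t w).
move: h1 h2 hs ht; rewrite normrN /incr -/(skel c s w) -/(skel c t w).
move: `|B t w - B s w| (skel c s w) (skel c t w) (B s w) (B t w) => n y y' b b'.
by rewrite ler_norml; lra.
Qed.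

Lemma integ_skel_incr c s t : 0 < c -> 0 <= s -> s <= t ->
  integ (fun w => skel c t w - skel c s w).
Proof.
move=> c0 s0 st; have t0 := le_trans s0 st.
apply: (integ_le (g := fun w => `|dB s t w| + 2 * c)).
- by apply: measurable_funB; exact: skel_measurable.
- by apply: integD; [apply: integ_norm; exact: integ_incr|exact: integ_cst].
- by move=> w; exact: skel_incr_le.
Qed.

Definition sampled_play c h i (w : T) : R := play c (fun j => B (j%:R * h) w) i.

Lemma sampled_play_meas c h i : 0 <= h -> meas_wrt (F (i%:R * h)) (sampled_play c h i).
Proof. by move=> h0; apply: own_past_meas; exact: play_own_past. Qed.

Lemma sampled_play_measurable c h i : 0 <= h -> measurable_fun setT (sampled_play c h i).
Proof.
move=> h0; apply: (@meas_wrt_measurable _ _ _ F) (@sampled_play_meas c h i h0) => r E.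
exact: (filtration_measurable hB).
Qed.

Lemma sampled_play_near c h i w : 0 <= c -> `|B (i%:R * h) w - sampled_play c h i w| <= c.
Proof. by move=> c0; exact: play_near. Qed.

Lemma sampled_play_incr_le c h i j w : 0 <= c ->
  `|sampled_play c h j w - sampled_play c h i w| <= `|dB (i%:R * h) (j%:R * h) w| + 2 * c.
Proof.
move=> c0; have := sampled_play_near h i w c0; have := sampled_play_near h j w c0.
have h1 := ler_norm (dB (i%:R * h) (j%:R * h) w).
have h2 := ler_norm (- dB (i%:R * h) (j%:R * h) w).
move: h1 h2; rewrite normrN /incr; move: `|B (j%:R * h) w - B (i%:R * h) w|.
move: (sampled_play c h i w) (sampled_play c h j w) (B (j%:R * h) w) (B (i%:R * h) w) => y y' b b' n.
by rewrite !ler_norml; lra.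
Qed.

Lemma integ_sampled_play_incr c h i j : 0 <= c -> 0 <= h -> (i <= j)%N ->
  integ (fun w => sampled_play c h j w - sampled_play c h i w).
Proof.
move=> c0 h0 ij; have ih0 k : 0 <= k%:R * h by rewrite mulr_ge0.
apply: (integ_le (g := fun w => `|dB (i%:R * h) (j%:R * h) w| + 2 * c)).
- by apply: measurable_funB; exact: sampled_play_measurable.
- apply: integD; [apply: integ_norm|exact: integ_cst].
  by apply: (integ_incr hB) => //; rewrite ler_wpM2r// ler_nat.
- by move=> w; exact: sampled_play_incr_le.
Qed.

(** The mean of [play_variation]: the terms z_i dx_i are centred. *)
Lemma sampled_play_variation c h n : 0 < c -> 0 <= h ->
  mean (fun w => \sum_(i < n) `|sampled_play c h i.+1 w - sampled_play c h i w|) <= 65 * (n%:R * h) / (2 * c).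
Proof.
move=> c0 h0; have c0' := ltW c0.
pose tt (i : nat) := i%:R * h.
have tt0 i : 0 <= tt i by rewrite mulr_ge0.
have ttS i : tt i <= tt i.+1 by rewrite ler_wpM2r// ler_nat.
have iv i := integ_norm (integ_sampled_play_incr c0' h0 (leqnSn i)).
have iZ i : integ (fun w => (B (tt i) w - sampled_play c h i w) * dB (tt i) (tt i.+1) w).
  apply: (integM (k := c)) => [|w|]; [|exact: sampled_play_near|exact: integ_incr].
  by apply: measurable_funB; [exact: (bm_measurable hB)|exact: sampled_play_measurable].
have i2 i := integ_incr2 hB (tt0 i) (ttS i).
rewrite ler_pdivlMr ?mulr_gt0// mulrC -meanZ; last first.
  exact: (integ_sum _ (fun i : 'I_n => iv i)).
apply: (@le_trans _ _ (mean (fun w =>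
   2 * (\sum_(i < n) (B (tt i) w - sampled_play c h i w) * dB (tt i) (tt i.+1) w) +
   \sum_(i < n) dB (tt i) (tt i.+1) w ^+ 2))).
  apply: mean_le => [||w].
  - by apply: integZ; exact: (integ_sum _ (fun i : 'I_n => iv i)).
  - apply: integD; last exact: (integ_sum _ (fun i : 'I_n => i2 i)).
    by apply: integZ; exact: (integ_sum _ (fun i : 'I_n => iZ i)).
  - exact: play_variation.
rewrite meanD; last 2 first.
- by apply: integZ; exact: (integ_sum _ (fun i : 'I_n => iZ i)).
- exact: (integ_sum _ (fun i : 'I_n => i2 i)).
rewrite meanZ; last exact: (integ_sum _ (fun i : 'I_n => iZ i)).
rewrite (mean_sum _ (fun i : 'I_n => iZ i)) (mean_sum _ (fun i : 'I_n => i2 i)).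
rewrite big1 => [|i _]; last first.
  apply: (@filtration_orth _ _ _ c) => [//|//||w]; last exact: sampled_play_near.
  apply/meas_wrtP; first exact: usual_sigma.
  by apply: measurable_funB; apply/meas_wrtP;
    [exact: usual_sigma|exact: bm_meas|exact: usual_sigma|exact: sampled_play_meas].
rewrite mulr0 add0r.
apply: (@le_trans _ _ (\sum_(i < n) (65 * h))).
  apply: ler_sum => i _; apply: le_trans (mean_incr2 hB (tt0 i) (ttS i)) _.
  have -> : tt i.+1 - tt i = h by rewrite /tt -natr1; ring.
  exact: lexx.
by rewrite sumr_const card_ord -mulr_natl; lra.
Qed.

End BrownianSkeleton.

Lemma block_variation {R : realType} (g : nat -> R) (N M : nat) :
  \sum_(i < N) `|g (i.+1 * M)%N - g (i * M)%N| <= \sum_(j < N * M) `|g j.+1 - g j|.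
Proof.
have K a m : `|g (a + m)%N - g a| <= \sum_(j < m) `|g (a + j).+1 - g (a + j)%N|.
  elim: m => [|m IH]; first by rewrite addn0 subrr normr0 big_ord0.
  rewrite big_ord_recr /= addnS.
  have -> : g (a + m).+1 - g a = (g (a + m)%N - g a) + (g (a + m).+1 - g (a + m)%N) by ring.
  by apply: le_trans (ler_normD _ _) _; rewrite lerD2r.
elim: N => [|N IH]; first by rewrite big_ord0 mul0n big_ord0.
rewrite big_ord_recr /= [in X in _ <= X]mulSnr big_split_ord /= lerD//.
by rewrite mulSnr; exact: K.
Qed.

Section Variation.
Context {R : realType} {d : measure_display} {T : measurableType d}.
Variables (P : probability T R) (B : R -> T -> R).
Hypothesis hB : standard_brownian_motion P B.
Local Notation mean := (mean P).
Local Notation integ := (integ P).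
Local Notation dB := (incr B).
Local Notation F := (usual_filtration P B).
Local Notation y := (skel B).

Definition node (N i : nat) : R := i%:R / N%:R.

Lemma node_ge0 N i : 0 <= node N i.
Proof. by rewrite divr_ge0. Qed.

Lemma node_le N i j : (i <= j)%N -> node N i <= node N j.
Proof. by move=> ij; rewrite ler_wpM2r ?invr_ge0// ler_nat. Qed.

Lemma nodeS N i : (0 < N)%N -> node N i.+1 - node N i = N%:R^-1.
Proof. by move=> N0; rewrite /node -natr1; ring. Qed.

Lemma node_le1 N i : (i <= N)%N -> node N i <= 1.
Proof.
case: N => [|N] iN; first by rewrite /node invr0 mulr0.
by rewrite ler_pdivrMr// mul1r ler_nat.
Qed.

(** The bound of [sampled_play_variation] does not depend on the grid; refine
    the grid and use dominated convergence. *)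
Theorem skel_variation (c : R) (N : nat) : 0 < c -> (0 < N)%N ->
  mean (fun w => \sum_(i < N) `|y c (node N i.+1) w - y c (node N i) w|) <= 65 / (2 * c).
Proof.
move=> c0 N0; have c0' := ltW c0.
have Nr0 : 0 < N%:R :> R by rewrite ltr0n.
pose h L : R := (N * L.+1)%:R^-1.
have h0 L : 0 <= h L by rewrite invr_ge0.
have hN L i : (i * L.+1)%:R * h L = node N i.
  by rewrite /h !natrM invfM /node mulrACA mulfV// mulr1.
pose f (L : nat) (w : T) : R := \sum_(i < N) `|sampled_play B c (h L) (i.+1 * L.+1)%N w - sampled_play B c (h L) (i * L.+1)%N w|.
pose f0 (w : T) : R := \sum_(i < N) `|y c (node N i.+1) w - y c (node N i) w|.
pose g (w : T) : R := \sum_(i < N) (`|dB (node N i) (node N i.+1) w| + 2 * c).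
have le_g L w : f L w <= g w.
  apply: ler_sum => i _; have := @sampled_play_incr_le _ _ _ B c (h L) (i * L.+1) (i.+1 * L.+1) w c0'.
  by rewrite !hN.
have fi L : integ (f L).
  apply: integ_sum => i; apply: integ_norm; apply: integ_sampled_play_incr => //.
  by rewrite leq_mul2r leqnSn orbT.
have f0i : integ f0.
  apply: integ_sum => i; apply: integ_norm; apply: integ_skel_incr => //.
  exact: node_ge0.
  exact: node_le.
have gi : integ g.
  apply: integ_sum => i; apply: integD; last exact: integ_cst.
  by apply: integ_norm; apply: (integ_incr hB); [exact: node_ge0|exact: node_le].
have f_ge0 L w : 0 <= f L w by exact: sumr_ge0.
have fb L : mean (f L) <= 65 / (2 * c).
  apply: (@le_trans _ _ (mean (fun w => \sum_(i < N * L.+1) `|sampled_play B c (h L) i.+1 w - sampled_play B c (h L) i w|))).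
    apply: mean_le => // [|w]; last exact: (block_variation (fun j => sampled_play B c (h L) j w)).
    by apply: integ_sum => i; apply: integ_norm; exact: integ_sampled_play_incr.
  apply: le_trans (sampled_play_variation hB _ c0 (h0 L)) _.
  by rewrite /h mulfV ?mulr1// pnatr_eq0 -lt0n muln_gt0 N0.
have cv w : f L w @[L --> \oo] --> f0 w.
  apply/cvgrPdist_le => e e0.
  pose e' := e / (2 * N%:R); have e'0 : 0 < e' by rewrite divr_gt0// mulr_gt0.
  have [dl dl0 Hd] := play_skeleton_cvg 1 (bm_path hB w) c0 e'0.
  have := near_infty_natSinv_lt (PosNum dl0); apply: filterS => L Ldl.
  have {}Ldl : L.+1%:R^-1 < dl := Ldl.
  have hdl : h L < dl.
    apply: le_lt_trans Ldl; rewrite /h lef_pV2 ?posrE ?ltr0n ?muln_gt0 ?N0//.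
    by rewrite ler_nat leq_pmull.
  have near i : (i <= N)%N -> `|y c (node N i) w - sampled_play B c (h L) (i * L.+1)%N w| <= e'.
    move=> iN; have := Hd (h L) (i * L.+1)%N (h0 L) hdl; rewrite hN; apply.
    exact: node_le1.
  rewrite /f0 /f -sumrB; apply: le_trans (ler_norm_sum _ _ _) _.
  apply: (@le_trans _ _ (\sum_(i < N) 2 * e')).
    apply: ler_sum => i _; have := near i (ltnW (ltn_ord i)); have := near i.+1 (ltn_ord i).
    move=> n1 n2; apply: le_trans (ler_dist_dist _ _) _.
    have -> : y c (node N i.+1) w - y c (node N i) w -
       (sampled_play B c (h L) (i.+1 * L.+1)%N w - sampled_play B c (h L) (i * L.+1)%N w) =
       (y c (node N i.+1) w - sampled_play B c (h L) (i.+1 * L.+1)%N w) -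
       (y c (node N i) w - sampled_play B c (h L) (i * L.+1)%N w) by ring.
    apply: le_trans (ler_normB _ _) _; lra.
  rewrite sumr_const card_ord -mulr_natl /e' le_eqVlt; apply/orP; left; apply/eqP.
  by field; rewrite gt_eqF.
have lim : (\int[P]_w (f L w)%:E)%E @[L --> \oo] --> (\int[P]_w (f0 w)%:E)%E.
  apply: (@dominated_cvg _ _ _ P setT measurableT (fun L w => (f L w)%:E)
     (fun w => (f0 w)%:E) (fun w => (g w)%:E)) => //.
  - by move=> L; apply/measurable_EFinP; exact: integ_measurable.
  - by move=> w _; apply: cvg_EFin; [apply: nearW|exact: cv].
  - by move=> L w _; rewrite /= lee_fin ger0_norm.
have fin k : integ k -> (\int[P]_w (k w)%:E = (mean k)%:E)%E.
  by move=> ik; rewrite fineK//; exact: integrable_fin_num.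
rewrite -lee_fin -fin// -(cvg_lim _ lim)//.
apply: lime_le; first by apply/cvg_ex; eexists; exact: lim.
by apply: nearW => L; rewrite fin// lee_fin.
Qed.

End Variation.

(** * Lower bound for the energy of the gap *)

Section EnergyAlgebra.
Context {R : realType}.

(** The sum telescopes until the weights g are switched off, so it is a
    difference z_j^2 - z_0^2. *)
Lemma stopped_square_le (z g : nat -> R) (c : R) n :
  (forall i, g i = 0 \/ g i = 1) -> (forall i, g i.+1 <= g i) ->
  (forall i, z i ^+ 2 <= c ^+ 2) ->
  \sum_(i < n) g i * (z i.+1 ^+ 2 - z i ^+ 2) <= c ^+ 2.
Proof.
move=> g01 gd zc.
have z0 := sqr_ge0 (z 0%N).
suff [H1 H2] : (g n = 1 -> \sum_(i < n) g i * (z i.+1 ^+ 2 - z i ^+ 2) = z n ^+ 2 - z 0%N ^+ 2)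
  /\ \sum_(i < n) g i * (z i.+1 ^+ 2 - z i ^+ 2) <= c ^+ 2 by [].
elim: n => [|n [IH1 IH2]].
  by rewrite big_ord0 subrr; split => //; exact: sqr_ge0.
rewrite big_ord_recr /=; have := zc n.+1; have [gn|gn] := g01 n.
  rewrite gn mul0r addr0 => _; split => // gn1.
  by have := gd n; rewrite gn gn1; lra.
rewrite gn mul1r (IH1 gn) => zn; split; lra.
Qed.

(** If |x| <= eta the first term suffices; otherwise 1 <= (|x| / eta)^k trades
    lower powers of x for the fourth one. *)
Lemma cross_term_le (x v c eta : R) : 0 < eta -> 0 <= c -> `|v| <= `|x| + 2 * c ->
  `|x| * `|v| <= eta * `|v| + x ^+ 4 * (eta ^- 2 + 2 * c * eta ^- 3).
Proof.
move=> e0 c0; have -> : x ^+ 4 = `|x| ^+ 4.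
  by rewrite -normrX ger0_norm// exprn_even_ge0.
have := normr_ge0 v; have := normr_ge0 x.
move: `|x| `|v| => a u a0 u0 uv.
have i2 : 0 < eta ^- 2 by rewrite invr_gt0 exprn_gt0.
have i3 : 0 < eta ^- 3 by rewrite invr_gt0 exprn_gt0.
have [ae|ea] := leP a eta.
  have h1 : a * u <= eta * u by rewrite ler_wpM2r.
  have h2 : 0 <= a ^+ 4 * (eta ^- 2 + 2 * c * eta ^- 3).
    apply: mulr_ge0; first by rewrite exprn_ge0.
    by apply: addr_ge0; [exact: ltW|rewrite mulr_ge0 ?(ltW i3)// mulr_ge0].
  lra.
have ap : 0 < a by apply: lt_trans ea.
have h1 : a ^+ 2 <= a ^+ 4 * eta ^- 2.
  rewrite -[leLHS]mul1r (_ : a ^+ 4 * eta ^- 2 = (a ^+ 2 * eta ^- 2) * a ^+ 2); last by ring.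
  rewrite ler_wpM2r ?sqr_ge0// ler_pdivlMr ?exprn_gt0// mul1r.
  by rewrite ler_pXn2r ?nnegrE ?(ltW e0)// ltW.
have h2 : a <= a ^+ 4 * eta ^- 3.
  rewrite -[leLHS]mul1r (_ : a ^+ 4 * eta ^- 3 = (a ^+ 3 * eta ^- 3) * a); last by ring.
  rewrite ler_wpM2r// ler_pdivlMr ?exprn_gt0// mul1r.
  by rewrite ler_pXn2r ?nnegrE ?(ltW e0)// ltW.
have h3 : 2 * c * a <= 2 * c * (a ^+ 4 * eta ^- 3) by rewrite ler_wpM2l// mulr_ge0.
have h4 : a * u <= a * (a + 2 * c) by rewrite ler_wpM2l.
have h5 : 0 <= eta * u by rewrite mulr_ge0// ltW.
lra.
Qed.

(** Here x, v and z stand for increments of B, increments of its skeleton and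
    values of the gap.  Since (x - v)^2 >= x^2 - 2 x v, the squared increments
    of the gap dominate those of B up to cross terms; the sums of |v_i| and
    x_i^4 are small in mean. *)
Lemma energy_pointwise (x v z g : nat -> R) (c eta : R) n : 0 < eta -> 0 <= c ->
  (forall i, g i = 0 \/ g i = 1) -> (forall i, g i.+1 <= g i) ->
  (forall i, z i ^+ 2 <= c ^+ 2) -> (forall i, `|v i| <= `|x i| + 2 * c) ->
  (forall i, z i.+1 - z i = x i - v i) ->
  \sum_(i < n) g i * x i ^+ 2 - 2 * eta * \sum_(i < n) `|v i|
   - 2 * (eta ^- 2 + 2 * c * eta ^- 3) * \sum_(i < n) x i ^+ 4 - c ^+ 2 <=
  2 * \sum_(i < n) g i * (- z i) * (z i.+1 - z i).
Proof.
move=> e0 c0 g01 gd zc vx zxv.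
have := stopped_square_le n g01 gd zc.
set r := eta ^- 2 + _.
have : \sum_(i < n) g i * x i ^+ 2 - 2 * eta * \sum_(i < n) `|v i| - 2 * r * \sum_(i < n) x i ^+ 4
   - \sum_(i < n) g i * (z i.+1 ^+ 2 - z i ^+ 2) <= 2 * \sum_(i < n) g i * (- z i) * (z i.+1 - z i).
  rewrite !mulr_sumr -!sumrB; apply: ler_sum => i _.
  have := cross_term_le e0 c0 (vx i); rewrite -/r => cr.
  have -> : g i * (z i.+1 ^+ 2 - z i ^+ 2) =
     g i * (z i.+1 - z i) ^+ 2 + 2 * (g i * z i * (z i.+1 - z i)) by ring.
  rewrite zxv.
  suff : g i * x i ^+ 2 - 2 * (eta * `|v i| + x i ^+ 4 * r) <= g i * (x i - v i) ^+ 2 by lra.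
  have xv := ler_norm (x i * v i); rewrite normrM in xv.
  have v2 := sqr_ge0 (v i); have xv0 := mulr_ge0 (normr_ge0 (x i)) (normr_ge0 (v i)).
  by have [->|->] := g01 i; lra.
lra.
Qed.

End EnergyAlgebra.

Section Energy.
Context {R : realType} {d : measure_display} {T : measurableType d}.
Variables (P : probability T R) (B : R -> T -> R).
Hypothesis hB : standard_brownian_motion P B.
Local Notation mean := (mean P).
Local Notation integ := (integ P).
Local Notation dB := (incr B).
Local Notation F := (usual_filtration P B).
Local Notation y := (skel B).

(** In mean, [energy_pointwise] with eta = kap c is at least
    1/32 - 65 kap - 256 q / b - 1 / b^2, as N = b^3 = c^-3 and q depends
    on kap only.  With 65 kap = 1/100 this exceeds 1/64 for large b.  The
    power 3 makes N c^2 large, which is what the fourth moments require. *)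
Theorem energy_lower : exists b0 : R, forall (b : nat) (G : nat -> set T),
  (0 < b)%N -> b0 <= b%:R -> let N := (b ^ 3)%N in let c := b%:R^-1 in
  (forall i, F (node N i) (G i)) -> (forall i, G i.+1 `<=` G i) ->
  (forall i, (i < N)%N -> 2^-1 <= fine (P (G i))) ->
  b%:R / 128 <= mean (fun w => \sum_(i < N)
     \1_(G i) w * (- (B (node N i) w - y c (node N i) w) / c) *
     ((B (node N i.+1) w - y c (node N i.+1) w) - (B (node N i) w - y c (node N i) w))).
Proof.
have [kap [kap0 kapE]] : exists kap : R, 0 < kap /\ 65 * kap = 100^-1.
  exists (65^-1 * 100^-1); split; first by rewrite mulr_gt0// invr_gt0 ltr0n.
  by rewrite mulrA divff ?mul1r// pnatr_eq0.
pose q := kap ^- 2 + 2 * kap ^- 3.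
exists (200 * (256 * q + 1)) => b G b0 bb N c FG Gd PG.
have br0 : 0 < b%:R :> R by rewrite ltr0n.
have b1 : 1 <= b%:R :> R by rewrite (ler_nat _ 1).
have c0 : 0 < c by rewrite invr_gt0.
have q0 : 0 < q by rewrite addr_gt0 ?mulr_gt0// invr_gt0 exprn_gt0.
pose eta := kap * c; have eta0 : 0 < eta by rewrite mulr_gt0.
have N0 : (0 < N)%N by rewrite expn_gt0 b0.
have Nr : N%:R = b%:R ^+ 3 :> R by rewrite natrX.
have Nr0 : 0 < N%:R :> R by rewrite ltr0n.
pose z i w := B (node N i) w - y c (node N i) w.
pose x i := dB (node N i) (node N i.+1).
pose v i w := y c (node N i.+1) w - y c (node N i) w.
pose r := eta ^- 2 + 2 * c * eta ^- 3.
have nge i := @node_ge0 R N i; have nle i := @node_le R N i i.+1 (leqnSn i).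
have mG i : measurable (G i) by exact: filtration_measurable (FG i).
have i2 i : integ (fun w => \1_(G i) w * x i w ^+ 2).
  by apply: integ_indicM => //; exact: integ_incr2.
have iv i : integ (fun w => `|v i w|) by apply: integ_norm; exact: integ_skel_incr.
have i4 i : integ (fun w => x i w ^+ 4) by exact: integ_incr4.
have zc i w : `|z i w| <= c by apply: skeleton_dist => //; exact: (bm_path hB).
have mz i : measurable_fun setT (z i).
  by apply: measurable_funB; [exact: (bm_measurable hB)|exact: (skel_measurable hB)].
have idz i : integ (fun w => z i.+1 w - z i w).
  apply: (@integ_bounded _ _ _ P _ (2 * c)) => [|w]; first exact: measurable_funB.
  by apply: le_trans (ler_normB _ _) _; have := zc i w; have := zc i.+1 w; lra.
have mgz i : measurable_fun setT (fun w => \1_(G i) w * - z i w).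
  by apply: measurable_funM; [exact: indic_measurable|by apply: measurableT_comp].
have igz i : integ (fun w => \1_(G i) w * - z i w * (z i.+1 w - z i w)).
  apply: (integM (k := c)) => // w; rewrite normrM normrN.
  by apply: le_trans (zc i w); rewrite ler_piMl// indic_le1.
have key : mean (fun w => \sum_(i < N) \1_(G i) w * x i w ^+ 2 -
     2 * eta * \sum_(i < N) `|v i w| - 2 * r * \sum_(i < N) x i w ^+ 4 - c ^+ 2) <=
   mean (fun w => 2 * \sum_(i < N) \1_(G i) w * - z i w * (z i.+1 w - z i w)).
  apply: mean_le => [||w].
  - apply: integB; last exact: integ_cst.
    apply: integB; last by apply: integZ; exact: integ_sum.
    apply: integB; last by apply: integZ; exact: integ_sum.
    exact: integ_sum.
  - by apply: integZ; exact: integ_sum.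
  - apply: (@energy_pointwise _ (fun i => x i w) (fun i => v i w) (fun i => z i w)
      (fun i => \1_(G i) w)) => //; first exact: ltW.
    + by move=> i; rewrite indicE; case: (_ \in _); [right|left].
    + move=> i; rewrite !indicE ler_nat; have [g1|g1] := pselect (G i.+1 w).
        by rewrite (mem_set g1) (mem_set (Gd i w g1)).
      by rewrite (memNset g1).
    + by move=> i; rewrite -[z i w ^+ 2]real_normK ?num_real// ler_pXn2r ?nnegrE ?(ltW c0).
    + by move=> i; apply: (skel_incr_le hB).
    + by move=> i; rewrite /z /x /v /incr; ring.
pose S1 w := \sum_(i < N) \1_(G i) w * x i w ^+ 2; pose S2 w := \sum_(i < N) `|v i w|.
pose S3 w := \sum_(i < N) x i w ^+ 4.
pose S4 w := \sum_(i < N) \1_(G i) w * - z i w * (z i.+1 w - z i w).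
have iS1 : integ S1 by exact: integ_sum.
have iS2 : integ (fun w => 2 * eta * S2 w) by apply: integZ; exact: integ_sum.
have iS3 : integ (fun w => 2 * r * S3 w) by apply: integZ; exact: integ_sum.
have iS4 : integ S4 by exact: integ_sum.
have {}key : mean S1 - 2 * eta * mean S2 - 2 * r * mean S3 - c ^+ 2 <= 2 * mean S4.
  rewrite -(meanZ 2 iS4) -(meanZ (2 * eta) (integ_sum _ (fun i : 'I_N => iv i))).
  rewrite -(meanZ (2 * r) (integ_sum _ (fun i : 'I_N => i4 i))).
  rewrite -(mean_cst P (c ^+ 2)) -(meanB iS1 iS2).
  rewrite -(meanB (integB iS1 iS2) iS3).
  by rewrite -(meanB (integB (integB iS1 iS2) iS3) (integ_cst P _)).
move: key.
have m2 : 32^-1 <= mean (fun w => \sum_(i < N) \1_(G i) w * x i w ^+ 2).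
  rewrite mean_sum//; apply: (@le_trans _ _ (\sum_(i < N) (32 * N%:R)^-1)).
    rewrite sumr_const card_ord -mulr_natl le_eqVlt; apply/orP; left; apply/eqP.
    by field; rewrite gt_eqF.
  apply: ler_sum => i _.
  have nlt : node N i < node N i.+1 :> R.
    by rewrite /node ltr_pM2r ?invr_gt0// ltr_nat.
  apply: le_trans (filtration_second_moment hB (nge i) nlt (FG i)).
  rewrite nodeS// invfM; have := PG i (ltn_ord i) => pg.
  have : 2^-1 * N%:R^-1 <= fine (P (G i)) * N%:R^-1 by rewrite ler_wpM2r// invr_ge0 ltW.
  lra.
have mv : mean (fun w => \sum_(i < N) `|v i w|) <= 65 / (2 * c) by exact: skel_variation.
have m4 : mean (fun w => \sum_(i < N) x i w ^+ 4) <= 128 * N%:R^-1.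
  rewrite mean_sum//; apply: (@le_trans _ _ (\sum_(i < N) (128 * (N%:R^-1) ^+ 2))).
    apply: ler_sum => i _; apply: le_trans (mean_incr4 hB (nge i) (nle i)) _.
    by rewrite nodeS.
  rewrite sumr_const card_ord -mulr_natl le_eqVlt; apply/orP; left; apply/eqP.
  by field; rewrite gt_eqF.
have -> : (fun w => \sum_(i < N) \1_(G i) w * (- (B (node N i) w - y c (node N i) w) / c) *
     ((B (node N i.+1) w - y c (node N i.+1) w) - (B (node N i) w - y c (node N i) w))) =
   (fun w => b%:R * S4 w).
  apply/funext => w; rewrite mulr_sumr; apply: eq_bigr => i _.
  by rewrite /c invrK -/(z i w) -/(z i.+1 w); ring.
rewrite meanZ//.
have h1 : 2 * eta * mean (fun w => \sum_(i < N) `|v i w|) <= 100^-1.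
  apply: (@le_trans _ _ (2 * eta * (65 / (2 * c)))).
    by apply: ler_wpM2l mv; rewrite mulr_ge0// ltW.
  rewrite -kapE le_eqVlt; apply/orP; left; apply/eqP; rewrite /eta.
  by field; rewrite gt_eqF.
have r0 : 0 < r.
  by rewrite addr_gt0 ?mulr_gt0// invr_gt0 exprn_gt0.
have rE : r = q * b%:R ^+ 2.
  rewrite /r /q /eta /c; field; rewrite !gt_eqF//.
have h2 : 2 * r * mean (fun w => \sum_(i < N) x i w ^+ 4) <= 256 * q / b%:R.
  apply: (@le_trans _ _ (2 * r * (128 * N%:R^-1))).
    by apply: ler_wpM2l m4; rewrite mulr_ge0// ltW.
  rewrite rE Nr le_eqVlt; apply/orP; left; apply/eqP.
  by field; rewrite gt_eqF.
have h3 : c ^+ 2 <= b%:R^-1.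
  rewrite -/c expr2 ler_piMr ?(ltW c0)//; rewrite /c invf_le1//.
have h4 : 256 * q / b%:R + b%:R^-1 <= 200^-1.
  rewrite -[X in _ + X]mul1r -mulrDl ler_pdivrMr//; lra.
move: m2 h1 h2; rewrite -/S1 -/S2 -/S3.
move: (mean S1) (2 * eta * mean S2) (2 * r * mean S3) (mean S4) => m1 m3 m5 m m2 h1 h2 key.
have km : 64^-1 <= 2 * m by lra.
have : b%:R * 64^-1 <= b%:R * (2 * m) by rewrite ler_wpM2l// ltW.
lra.
Qed.

End Energy.

(** * Localisation *)

Section Localisation.
Context {R : realType} {d : measure_display} {T : measurableType d}.
Variable P : probability T R.

(** Continuity of P along an increasing sequence of events whose union is
    almost sure. *)
Lemma large_event (E : nat -> set T) (p : R) : p < 1 ->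
  (forall m, measurable (E m)) -> (forall m, E m `<=` E m.+1) ->
  {ae P, forall w, exists m, E m w} -> exists m, p <= fine (P (E m)).
Proof.
move=> p1 mE nd ae.
have mU : measurable (\bigcup_m E m) by exact: bigcupT_measurable.
have PU : P (\bigcup_m E m) = 1%E.
  apply/eqP; rewrite eq_le probability_le1//=.
  have : P (~` \bigcup_m E m) = 0%E.
    apply/negligibleP; first exact: measurableC.
    apply: negligibleS ae => w /= nU [m Ew]; apply: nU; by exists m.
  rewrite probability_setC//.
  have fU : P (\bigcup_m E m) \is a fin_num by rewrite fin_num_measure.
  rewrite -(fineK fU) -EFinB => /eqP; rewrite eqe subr_eq0 => /eqP <-.
  by rewrite lee_fin.
have nd' : {homo E : n m / (n <= m)%N >-> (n <= m)%O}.
  move=> n m nm; apply/subsetPset; rewrite -(subnK nm).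
  by elim: (m - n)%N => [//|k IH]; exact: subset_trans IH (nd _).
have : (P \o E) m @[m --> \oo] --> 1%E by rewrite -PU; exact: nondecreasing_cvg_mu.
move=> /fine_cvg /cvgr_gt /(_ p p1) [m _ hm]; exists m.
exact: ltW (hm m (leqnn m)).
Qed.

Lemma grid_variation_le (f : R -> R) (K : R) (N : nat) : (0 < N)%N ->
  ubound (variations 0 1 f) K ->
  \sum_(i < N) `|f (node N i.+1) - f (node N i)| <= K.
Proof.
move=> N0 ubK.
pose s := [seq (node N i.+1 : R) | i <- iota 0 N].
have ss : size s = N by rewrite size_map size_iota.
have nthE i : (i <= N)%N -> nth 1 (0 :: s) i = node N i.
  case: i => [_|i iN]; first by rewrite /node mul0r.
  by rewrite /= (nth_map 0%N) ?size_iota// nth_iota.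
have part : itv_partition 0 1 s.
  split; last first.
    by rewrite (last_nth 1) ss nthE// /node divff// pnatr_eq0 -lt0n.
  apply/(pathP 1) => i; rewrite ss => iN.
  rewrite nthE ?(ltnW iN)// -[nth 1 s i]/(nth 1 (0 :: s) i.+1) nthE//.
  by rewrite /node ltr_pM2r ?invr_gt0 ?ltr0n// ltr_nat.
have := ubK _ (variations_variation f part); apply: le_trans.
rewrite /variation ss big_mkord; apply: ler_sum => i _ /=.
by rewrite -[nth 1 s i]/(nth 1 (0 :: s) i.+1) (nthE _ (ltnW (ltn_ord i))) (nthE _ (ltn_ord i)).
Qed.

End Localisation.

Lemma norm_sub_le {R : realType} (a b k : R) : `|a| <= k -> `|b| <= k -> `|a - b| <= 2 * k.
Proof. by move=> ak bk; apply: le_trans (ler_normB _ _) _; lra. Qed.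

(** * The contradiction *)

Section BetaGrowth.
Context {R : realType}.

Lemma beta_seq_homo k n : (k <= n)%N -> beta_seq k <= beta_seq n :> R.
Proof.
elim: n => [|n IH]; first by rewrite leqn0 => /eqP ->.
rewrite leq_eqVlt => /predU1P[->//|]; rewrite ltnS => /IH h; apply: (le_trans h).
case: n {IH h} => [//|n]; rewrite beta_seqSS.
have b1 := @beta_ge1 R n.+1.
apply: (@le_trans _ _ (beta_seq n.+1 ^+ 6)).
  by rewrite exprS ler_peMr ?exprn_ege1// (le_trans _ b1).
by rewrite ler_peMl ?exprn_ge0 ?(le_trans _ b1)// exprn_ege1// ler1n.
Qed.

Lemma beta_seq_ge n : n%:R <= beta_seq n :> R.
Proof.
case: n => [|[|n]] //; rewrite beta_seqSS.
have b1 := @beta_ge1 R n.+1.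
apply: (@le_trans _ _ (n.+2%:R ^+ 2)).
  by rewrite expr2 ler_peMr// ler1n.
by rewrite ler_peMr ?sqr_ge0// exprn_ege1.
Qed.

(** With a = beta(n - 1), the left-hand sum is at most 33 n a^2, while
    alpha(n) beta(n) = n^3 a^9. *)
Lemma growth_contradiction (C0 b0 : R) : exists n, [/\ (2 <= n)%N, b0 <= beta_seq n &
  C0 + \sum_(2 <= k < n) alpha_seq k * (33 * beta_seq k) < alpha_seq n * (beta_seq n / 128)].
Proof.
pose n := maxn (Num.truncn `|b0|).+1 (Num.truncn (128 * (`|C0| + 34))).+3.
have n2 : (2 <= n)%N by rewrite leq_max orbC.
have nb : b0 <= n%:R.
  apply: le_trans (ler_norm _) _; apply: ltW; apply: lt_le_trans (truncnS_gt _) _.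
  by rewrite ler_nat leq_maxl.
have nC : 128 * (`|C0| + 34) <= n%:R.
  apply: ltW; apply: lt_le_trans (truncnS_gt _) _; rewrite ler_nat.
  by apply: leq_trans (leq_maxr _ _); rewrite leqW// leqW.
exists n; split => //; first exact: le_trans (beta_seq_ge n).
case: n n2 nC {nb} => [//|[//|m]] _ nC; pose n := m.+2.
pose a : R := beta_seq m.+1; have a1 : 1 <= a by exact: beta_ge1.
have nr1 : 1 <= n%:R :> R by rewrite ler1n.
have sumE : \sum_(2 <= k < n) alpha_seq k * (33 * beta_seq k) <= 33 * (n%:R * a ^+ 2).
  apply: (@le_trans _ _ (\sum_(2 <= k < n) (33 * a ^+ 2))).
    rewrite big_nat [leRHS]big_nat; apply: ler_sum => k /andP[_ kn].
    have bk : beta_seq k <= a by apply: beta_seq_homo.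
    have b0k := @beta_gt0 R k.
    have h1 : alpha_seq k <= a by apply: le_trans (alpha_le_beta k) bk.
    have : alpha_seq k * beta_seq k <= a * a by apply: ler_pM => //; apply: ltW => //; exact: alpha_gt0.
    rewrite expr2; lra.
  rewrite sumr_const_nat -[leLHS]mulr_natr [leRHS](_ : _ = 33 * a ^+ 2 * n%:R); last by ring.
  have a20 : 0 <= 33 * a ^+ 2 by rewrite mulr_ge0 ?sqr_ge0.
  by apply: (ler_wpM2l a20); rewrite ler_nat leq_subr.
apply: (@le_lt_trans _ _ (C0 + 33 * (n%:R * a ^+ 2))); first by rewrite lerD2l.
have -> : alpha_seq n * (beta_seq n / 128) = n%:R * a ^+ 2 * (n%:R ^+ 2 * a ^+ 7 / 128).
  rewrite alphaSS beta_seqSS -/a -[m.+2]/n; move: (n%:R : R) => nr.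
  by field.
set u := n%:R * a ^+ 2.
have u1 : 1 <= u by rewrite mulr_ege1// exprn_ege1.
have h : `|C0| + 34 <= n%:R ^+ 2 * a ^+ 7 / 128.
  rewrite ler_pdivlMr// mulrC; apply: le_trans nC _.
  apply: (@le_trans _ _ (n%:R ^+ 2)); first by rewrite expr2 ler_peMr.
  by rewrite ler_peMr ?sqr_ge0// exprn_ege1.
have h2 : u * (`|C0| + 34) <= u * (n%:R ^+ 2 * a ^+ 7 / 128).
  by rewrite ler_wpM2l//; lra.
apply: lt_le_trans h2.
have := ler_norm C0; have : `|C0| <= u * `|C0| by rewrite ler_peMl.
lra.
Qed.

End BetaGrowth.

Section NotSemimartingale.
Context {R : realType} {d : measure_display} {T : measurableType d}.
Variables (P : probability T R) (B : R -> T -> R).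
Hypothesis hB : standard_brownian_motion P B.
Local Notation mean := (mean P).
Local Notation integ := (integ P).
Local Notation dB := (incr B).
Local Notation F := (usual_filtration P B).

Lemma usual_measurable t E : F t E -> measurable E.
Proof. exact: (filtration_measurable hB). Qed.

Let Usig : forall t, sigma_algebra setT (F t) := usual_sigma P B.
Let Umono : forall s t, s <= t -> F s `<=` F t := @usual_mono R d T P B.

(** The increments of B are centred given the weights, so only the variation
    of the skeleton remains. *)
Lemma gap_weighted_le k N (W : nat -> T -> R) : (0 < N)%N ->
  (forall i, meas_wrt (F (node N i)) (W i)) -> (forall i w, `|W i w| <= 1) ->
  `|mean (fun w => \sum_(i < N) W i w * (gap B k (node N i.+1) w - gap B k (node N i) w))| <=
  33 * beta_seq k.
Proof.
move=> N0 mW W1; have g0 := @gamma_gt0 R k.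
have nge i := @node_ge0 R N i; have nle i := @node_le R N i i.+1 (leqnSn i).
have mWT i : measurable_fun setT (W i) := meas_wrt_measurable usual_measurable (mW i).
pose v i w := skel B (gamma_seq k) (node N i.+1) w - skel B (gamma_seq k) (node N i) w.
have iv i : integ (v i) by exact: (integ_skel_incr hB).
have iWv i : integ (fun w => W i w * v i w) by exact: integM (W1 i) (iv i).
have iWB i : integ (fun w => W i w * dB (node N i) (node N i.+1) w).
  by apply: (integM _ (W1 i)) => //; exact: integ_incr.
have -> : (fun w => \sum_(i < N) W i w * (gap B k (node N i.+1) w - gap B k (node N i) w)) =
  (fun w => \sum_(i < N) W i w * dB (node N i) (node N i.+1) w - \sum_(i < N) W i w * v i w).
  apply/funext => w; rewrite -sumrB; apply: eq_bigr => i _.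
  by rewrite /gap /v /incr /skel; ring.
rewrite meanB; [|exact: integ_sum|exact: integ_sum].
rewrite mean_sum// big1 ?sub0r ?normrN => [|i _]; last first.
  exact: (filtration_orth hB (nge i) (nle i) (mW i) (W1 i)).
apply: le_trans (mean_norm (integ_sum _ _)) _ => //.
apply: (@le_trans _ _ (mean (fun w => \sum_(i < N) `|v i w|))).
  apply: mean_le => [||w].
  - by apply: integ_norm; exact: integ_sum.
  - by apply: integ_sum => i; exact: integ_norm.
  - apply: le_trans (ler_norm_sum _ _ _) _; apply: ler_sum => i _.
    by rewrite normrM ler_piMl.
apply: le_trans (skel_variation hB g0 N0) _.
rewrite invfM /gamma_seq invrK; have := @beta_gt0 R k; lra.
Qed.

(** There are beta(n)^3 steps, and the tail is at most
    2 / alpha(n + 1) = 2 / ((n + 1) beta(n)^3). *)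
Lemma tail_weighted_le n (W : nat -> T -> R) : (2 <= n)%N ->
  let N := (beta_nat n ^ 3)%N in
  (forall i, meas_wrt (F (node N i)) (W i)) -> (forall i w, `|W i w| <= 1) ->
  let tail t w := Y_process B t w - partial_Y B n.+1 t w in
  (forall t, 0 <= t -> measurable_fun setT (tail t)) ->
  `|mean (fun w => \sum_(i < N) W i w * (tail (node N i.+1) w - tail (node N i) w))| <= 4.
Proof.
move=> n2 N mW W1 tail mtail.
have nge i := @node_ge0 R N i.
have mWT i : measurable_fun setT (W i) := meas_wrt_measurable usual_measurable (mW i).
have tl i w : `|tail (node N i) w| <= 2 * (alpha_seq n.+1)^-1.
  by apply: (Y_tail (bm_path hB)) => //; exact: leqW.
have dl i w : `|tail (node N i.+1) w - tail (node N i) w| <= 4 * (alpha_seq n.+1)^-1.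
  rewrite (_ : 4 * _ = 2 * (2 * (alpha_seq n.+1)^-1)); last by ring.
  exact: norm_sub_le.
have id i : integ (fun w => W i w * (tail (node N i.+1) w - tail (node N i) w)).
  apply: (integM _ (W1 i)) => //; apply: (@integ_bounded _ _ _ P _ (4 * (alpha_seq n.+1)^-1)) => //.
  by apply: measurable_funB; exact: mtail.
apply: le_trans (mean_norm (integ_sum _ _)) _ => //.
rewrite -(mean_cst P 4); apply: mean_le => [||w]; [by apply: integ_norm; exact: integ_sum|exact: integ_cst|].
apply: le_trans (ler_norm_sum _ _ _) _.
apply: (@le_trans _ _ (\sum_(i < N) 4 * (alpha_seq n.+1)^-1)).
  by apply: ler_sum => i _; rewrite normrM; apply: le_trans (dl i w); rewrite ler_piMl.
rewrite sumr_const card_ord -[leLHS]mulr_natl /N natrX -beta_natE.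
case: n n2 {N mW W1 tail mtail nge mWT tl dl id} => [//|n] _.
rewrite alphaSS invfM.
have b0 : beta_seq n.+1 ^+ 3 != 0 :> R by rewrite expf_neq0// gt_eqF// beta_gt0.
have -> : beta_seq n.+1 ^+ 3 * (4 * (n.+2%:R^-1 * (beta_seq n.+1 ^+ 3)^-1)) = 4 * n.+2%:R^-1 :> R.
  by rewrite mulrCA [X in _ * X = _]mulrCA mulfV// mulr1.
by rewrite ler_piMr// invf_le1// ler1n.
Qed.

(** The weights of the n-th test are - gap / gamma(n), switched off outside
    the events [good]; these have probability at least 1/2 because the
    localising time and K are chosen so that each of the two conditions fails
    with probability at most 1/4, simultaneously for all grids. *)
Theorem Y_not_semimartingale : ~ semimartingale P F (Y_process B).
Proof.
move=> [aY _ [M [A [[aM _ [taus [tau_stop tau_lim mart]]] [aA _ bvA] MA0 dec]]]].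
have YB (t : R) w : 0 <= t -> `|Y_process B t w| <= 1 by exact: (Y_le1 (bm_path hB)).
have Ftau n t : 0 <= t -> F t [set w | (t%:E < taus n w)%E].
  move=> t0; have [_ h] := tau_stop n.
  rewrite (_ : [set w | _] = ~` [set w | (taus n w <= t%:E)%E]).
    by apply: (filtration_setC Usig); exact: h.
  by apply/seteqP; split => w /=; rewrite ltNge => /negP.
have meas_t t X : adapted F X -> 0 <= t -> measurable_fun setT (X t).
  by move=> aX t0; apply: (meas_wrt_measurable usual_measurable) => U mU; exact: aX.
have [n0 Pn0] : exists n, 3 / 4 <= fine (P [set w | (1%:E < taus n w)%E]).
  (* taking all n >= m gives events that increase with m on every path *)
  pose Q m := \bigcap_(n in [set n | (m <= n)%N]) [set w | (1%:E < taus n w)%E].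
  have mQ m : measurable (Q m).
    by apply: bigcap_measurableType => n _; exact: usual_measurable (Ftau n 1 ler01).
  have [|//|m w Qm n /= mn||m Qm] := @large_event _ _ _ P Q (3 / 4).
  - lra.
  - by apply: Qm; exact: ltnW.
  - move: tau_lim; apply: filterS => w [_ /cvgey_gt/(_ 1)[m _ hm]].
    by exists m => n /= mn; exact: hm.
  exists m; apply: le_trans Qm _; apply: fine_le; rewrite ?fin_num_measure//.
    exact: usual_measurable (Ftau m 1 ler01).
  apply: le_measure; rewrite ?inE//; first exact: usual_measurable (Ftau m 1 ler01).
  by move=> w /(_ m (leqnn m)).
pose tau := taus n0.
pose var N w := \sum_(i < N) `|A (node N i.+1) w - A (node N i) w|.
have mvar N : measurable_fun setT (var N).
  apply: measurable_sum => i; apply: measurableT_comp => //.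
  by apply: measurable_funB; apply: meas_t => //; exact: node_ge0.
pose S (m : nat) := \bigcap_N [set w | var N w <= m%:R].
have mS m : measurable (S m).
  apply: bigcapT_measurable => N.
  rewrite (_ : [set w | _] = setT `&` var N @^-1` `]-oo, m%:R]%classic).
    by apply: mvar => //; exact: measurable_itv.
  by rewrite setTI; apply/seteqP; split => w /=; rewrite in_itv.
have [m Pm] : exists m, 3 / 4 <= fine (P (S m)).
  apply: large_event => //.
  - lra.
  - by move=> m w Sm N _ /=; apply: le_trans (Sm N I) _; rewrite ler_nat.
  - apply: aeW => w; have [K ubK] := bvA w 1 ler01.
    exists (Num.truncn `|K|).+1 => N _ /=.
    have [->|N0] := posnP N; first by rewrite /var big_ord0.
    apply: le_trans (grid_variation_le N0 ubK) _.
    by apply: le_trans (ler_norm _) _; apply: ltW; exact: truncnS_gt.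
pose K : R := m%:R; have K0 : 0 <= K by exact: ler0n.
pose M' (t : R) w := stopped M tau t w - M 0 w.
have mM' : martingale P F M' := mart n0.
have A0 w : A 0 w = 0 by have [_] := MA0 w.
have decomp : {ae P, forall w, forall t, 0 <= t -> (t%:E < tau w)%E ->
    Y_process B t w = Y_process B 0 w + M' t w + A t w}.
  move: dec; apply: filterS => w h t t0 ttau; rewrite h//.
  rewrite /M' /stopped; have [-> _] := MA0 w.
  by rewrite subr0 min_r//; exact: ltW.
pose C := 2 * K + 4 * 1 + mean (fun w => `|M' 1 w|).
have [b0 energy] := energy_lower hB.
have [n [n2 bn absurd]] := growth_contradiction (C + 4) b0.
set b := beta_nat n; pose N := (b ^ 3)%N.
have bE : beta_seq n = b%:R :> R by exact: beta_natE.
have bp : (0 < b)%N by exact: beta_nat_gt0.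
have N0 : (0 < N)%N by rewrite expn_gt0 bp.
pose c : R := b%:R^-1.
have cE : gamma_seq n = c by rewrite /gamma_seq bE.
have c0 : 0 < c by rewrite -cE gamma_gt0.
have nge i := @node_ge0 R N i.
have tt0 : node N 0 = 0 :> R by rewrite /node mul0r.
have ttnd : nondecreasing_seq (node N : nat -> R) by move=> i j; exact: node_le.
pose H i w := - gap B n (node N i) w / c.
have mH i : meas_wrt (F (node N i)) (H i).
  have -> : H i = (fun w => gap B n (node N i) w * (- c^-1)).
    by apply/funext => w; rewrite /H mulNr mulrN.
  apply: (meas_wrtM Usig); first exact: (gap_meas hB).
  by apply/meas_wrtP; [exact: Usig|exact: measurable_cst].
have H1 i w : `|H i w| <= 1.
  rewrite normrM normrN normfV (gtr0_norm c0) ler_pdivrMr// mul1r -cE.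
  by apply: (gap_le (bm_path hB)).
pose G := good A tau (node N) K.
have FG i : F (node N i) (G i).
  by apply: (good_F Usig Umono aA (Ftau n0) tt0 ttnd).
have Gd i : G i.+1 `<=` G i by exact: good_decr.
have PG i : (i < N)%N -> 2^-1 <= fine (P (G i)).
  move=> iN; pose D := [set w | (1%:E < tau w)%E].
  have mD : measurable D by exact: usual_measurable (Ftau n0 1 ler01).
  have mG : measurable (G i) by exact: usual_measurable (FG i).
  have sub : D `&` S m `<=` G i.
    move=> w [Dw Sw]; split.
      by apply: le_lt_trans Dw; rewrite lee_fin; apply: node_le1; exact: ltnW.
    apply: le_trans (Sw N I); rewrite /grid_var /var.
    rewrite -(subnKC (ltnW iN)) big_split_ord /= lerDl; exact: sumr_ge0.
  have h1 : fine (P (D `&` S m)) <= fine (P (G i)).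
    apply: fine_le; rewrite ?fin_num_measure//; try exact: measurableI.
    by apply: le_measure; rewrite ?inE//; exact: measurableI.
  have h2 : fine (P D) + fine (P (S m)) <= 1 + fine (P (D `&` S m)).
    rewrite -!mean_indic//; last exact: measurableI.
    have ii (E : set T) : measurable E -> integ (\1_E).
      move=> mE; apply: (@integ_bounded _ _ _ P _ 1); first exact: indic_measurable.
      by move=> w; exact: indic_le1.
    have mI : measurable (D `&` S m) by exact: measurableI.
    rewrite -meanD; [|exact: ii|exact: ii].
    rewrite -[X in X + _](mean_cst P) -meanD; [|exact: integ_cst|exact: ii].
    apply: mean_le => [||w]; [by apply: integD; exact: ii|by apply: integD; [exact: integ_cst|exact: ii]|].
    rewrite indicI /= !indicE; case: (w \in D) => /=; case: (w \in S m) => /=;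
      by rewrite ?mulr1 ?mulr0 ?mul0r ?addr0 ?add0r ?lexx.
  have : 3 / 4 <= fine (P D) by exact: Pn0.
  lra.
have bn' : b0 <= b%:R by rewrite -bE.
have low := energy b G bp bn' FG Gd PG.
have := semimartingale_bound Usig usual_measurable Umono aY aA A0 mM'
   (Ftau n0) decomp tt0 ttnd mH H1 N K0 YB.
pose W := weight A tau (node N) H K.
have W1 i w : `|W i w| <= 1 by exact: weight_le1.
have mW i : meas_wrt (F (node N i)) (W i).
  by apply: (meas_wrtM Usig) => //; apply: (meas_wrt_indic Usig); exact: FG.
have mWT i : measurable_fun setT (W i) := meas_wrt_measurable usual_measurable (mW i).
have -> : node N N = 1 :> R by rewrite /node divff// pnatr_eq0 -lt0n.
rewrite -/C => up.
pose dg k i w := gap B k (node N i.+1) w - gap B k (node N i) w.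
pose tail t w := Y_process B t w - partial_Y B n.+1 t w.
have mgap k t : 0 <= t -> measurable_fun setT (gap B k t).
  by move=> t0; apply: (meas_wrt_measurable usual_measurable (gap_meas hB k t0)).
have mtail t : 0 <= t -> measurable_fun setT (tail t).
  move=> t0; apply: measurable_funB; first exact: meas_t.
  by apply: measurable_sum => k; apply: measurable_funM => //; exact: mgap.
have idg k i : integ (fun w => W i w * dg k i w).
  apply: (integM _ (W1 i)) => //.
  apply: (@integ_bounded _ _ _ P _ (2 * gamma_seq k)).
    by apply: measurable_funB; exact: mgap.
  by move=> w; apply: norm_sub_le; apply: (gap_le (bm_path hB)).
pose I1 k := mean (fun w => \sum_(i < N) W i w * dg k i w).
pose I2 := mean (fun w => \sum_(i < N) W i w * (tail (node N i.+1) w - tail (node N i) w)).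
have I2b : `|I2| <= 4 by exact: tail_weighted_le.
have I1b k : `|I1 k| <= 33 * beta_seq k by exact: gap_weighted_le.
have I1n : beta_seq n / 128 <= I1 n.
  rewrite bE; apply: le_trans low _; rewrite le_eqVlt; apply/orP; left; apply/eqP.
  congr (Rintegral _ _ _); apply/funext => w; apply: eq_bigr => i _.
  by rewrite /W /weight /H /dg /gap /skel cE.
have iT : integ (fun w => \sum_(i < N) W i w * (tail (node N i.+1) w - tail (node N i) w)).
  apply: integ_sum => i; apply: (integM _ (W1 i)) => //.
  have tl j w : `|tail (node N j) w| <= 2 * (alpha_seq n.+1)^-1.
    by apply: (Y_tail (bm_path hB)) => //; exact: leqW.
  apply: (@integ_bounded _ _ _ P _ (2 * (2 * (alpha_seq n.+1)^-1))).
    by apply: measurable_funB; exact: mtail.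
  by move=> w; exact: norm_sub_le.
have split_sum : mean (fun w => \sum_(i < N) W i w * (Y_process B (node N i.+1) w - Y_process B (node N i) w)) =
   \sum_(2 <= k < n.+1) alpha_seq k * I1 k + I2.
  have ik k : integ (fun w => alpha_seq k * \sum_(i < N) W i w * dg k i w).
    by apply: integZ; exact: integ_sum.
  have -> : \sum_(2 <= k < n.+1) alpha_seq k * I1 k =
      mean (fun w => \sum_(2 <= k < n.+1) alpha_seq k * \sum_(i < N) W i w * dg k i w).
    rewrite mean_sum//; apply: eq_bigr => k _; rewrite meanZ//; exact: integ_sum.
  rewrite -meanD//; last exact: integ_sum.
  congr (Rintegral _ _ _); apply/funext => w.
  under [X in _ = X + _]eq_bigr do rewrite mulr_sumr.
  rewrite exchange_big -big_split /=; apply: eq_bigr => i _.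
  have -> : \sum_(2 <= k < n.+1) alpha_seq k * (W i w * dg k i w) =
     W i w * (partial_Y B n.+1 (node N i.+1) w - partial_Y B n.+1 (node N i) w).
    rewrite !partial_YE -sumrB mulr_sumr; apply: eq_bigr => k _.
    by rewrite /dg; ring.
  rewrite /tail; move: (W i w) (Y_process B (node N i.+1) w) (Y_process B (node N i) w).
  move: (partial_Y B n.+1 (node N i.+1) w) (partial_Y B n.+1 (node N i) w) => p1 p0 x y1 y0.
  ring.
rewrite split_sum big_nat_recr //= in up.
have early : `|\sum_(2 <= k < n) alpha_seq k * I1 k| <= \sum_(2 <= k < n) alpha_seq k * (33 * beta_seq k).
  apply: le_trans (ler_norm_sum _ _ _) _; apply: ler_sum => k _.
  by rewrite normrM gtr0_norm ?alpha_gt0// ler_wpM2l// ltW// alpha_gt0.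
have main : alpha_seq n * (beta_seq n / 128) <= alpha_seq n * I1 n.
  by rewrite ler_wpM2l// ltW// alpha_gt0.
move: absurd up I2b early main.
move: (\sum_(2 <= k < n) alpha_seq k * I1 k) (\sum_(2 <= k < n) _) (I2) => s1 s2 i2.
move: (alpha_seq n * (beta_seq n / 128)) (alpha_seq n * I1 n) => q1 q2.
move: (C) => C0 absurd; rewrite !ler_norml => /andP[_ u1] /andP[u2 u3] /andP[u4 u5] u6.
lra.
Qed.

End NotSemimartingale.

Theorem mainTheorem5 (R : realType) (d : measure_display) (T : measurableType d)
    (P : probability T R) (B : R -> T -> R)
    (hB : standard_brownian_motion P B) :
  [/\ forall (t : R) (w : T), 0 <= t -> cvgn (fun n => partial_Y B n t w),
      bounded_process (Y_process B),
      continuous_process (Y_process B),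
      adapted (usual_filtration P B) (Y_process B) &
      ~ semimartingale P (usual_filtration P B) (Y_process B)].
Proof.
have path := bm_path hB; split.
- by move=> t w t0; exact: partial_Y_cvg.
- by exists 1 => t w t0; exact: Y_le1.
- by move=> w; apply: cont_from_continuous; exact: Y_cont.
- exact: Y_adapted hB.
- exact: Y_not_semimartingale hB.
Qed.
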